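(* Let $F_\phi(n)$ be the number of Frobenius symbols of size $n$ with no zeros in the top row, and let $F_0(n)$ be the number of Frobenius symbols of size $n$ that contain a zero in the top row. Then, as $n \to \infty$, $$F_\phi(n) \sim F_0(n) \sim \frac{1}{8\sqrt{3}\, n}\, e^{\pi\sqrt{\frac{2}{3} n}}.$$
   Context: A Frobenius symbol is a pair of strictly decreasing sequences of nonnegative integers of the same length $k\ge 0$, written as two rows $$\begin{pmatrix}\alpha_1 & \alpha_2 & \dots & \alpha_k\\ \beta_1 & \beta_2 & \dots & \beta_k\end{pmatrix},\qquad \alpha_1>\alpha_2>\dots>\alpha_k\ge 0,\quad \beta_1>\beta_2>\dots>\beta_k\ge 0.$$ Its size is $k+\alpha_1+\dots+\alpha_k+\beta_1+\dots+\beta_k$. The top row is $(\alpha_1,\dots,\alpha_k)$; it contains a zero if and only if $k\ge1$ and $\alpha_k=0$. Here $f(n)\sim g(n)$ means $f(n)/g(n)\to 1$. *)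

(* Defs.v *)
From mathcomp Require Import all_boot all_order all_algebra.
From mathcomp Require Import finmap.
From mathcomp Require Import all_classical all_reals all_analysis.
Set Implicit Arguments.
Unset Strict Implicit.
Unset Printing Implicit Defensive.
Import Order.TTheory GRing.Theory Num.Theory.
Import numFieldNormedType.Exports.

Local Open Scope classical_set_scope.
Local Open Scope ring_scope.

(* A two-row array is a pair (top row, bottom row). *)
Definition frobenius_symbol (s : seq nat * seq nat) : bool :=
  [&& size s.1 == size s.2, sorted gtn s.1 & sorted gtn s.2].

Definition frobenius_size (s : seq nat * seq nat) : nat :=
  (size s.1 + sumn s.1 + sumn s.2)%N.

Definition frobenius_symbols (n : nat) : set (seq nat * seq nat) :=
  [set s | frobenius_symbol s /\ frobenius_size s = n].

Definition frobenius_nozero (n : nat) : set (seq nat * seq nat) :=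
  [set s | frobenius_symbols n s /\ 0%N \notin s.1].

Definition frobenius_zero (n : nat) : set (seq nat * seq nat) :=
  [set s | frobenius_symbols n s /\ 0%N \in s.1].

Lemma leq_mem_sumn (s : seq nat) (x : nat) : x \in s -> (x <= sumn s)%N.
Proof.
elim: s => //= y s IHs; rewrite inE => /orP[/eqP ->|/IHs h].
  exact: leq_addr.
exact: leq_trans h (leq_addl _ _).
Qed.

Lemma seq_bseq_ord (n : nat) (s : seq nat) :
  (size s <= n)%N -> (sumn s <= n)%N ->
  exists t : {bseq n of 'I_n.+1}, map val t = s.
Proof.
move=> sz sm.
have sz' : (size (map (@inord n) s) <= n)%N by rewrite size_map.
exists (Bseq sz') => /=; rewrite -map_comp -[RHS]map_id.
apply/eq_in_map => x xs /=.
by rewrite inordK // ltnS (leq_trans (leq_mem_sumn xs)).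
Qed.

(* [fset_set] is the empty set on infinite sets, so the cardinals below are
   the intended ones only thanks to this finiteness. *)
Lemma finite_frobenius_symbols (n : nat) : finite_set (frobenius_symbols n).
Proof.
pose T := ({bseq n of 'I_n.+1} * {bseq n of 'I_n.+1})%type.
pose f (t : T) : seq nat * seq nat := (map val t.1, map val t.2).
apply: (@sub_finite_set _ _ (f @` [set: T])); last first.
  exact/finite_image/finite_finset.
move=> [a b] [/and3P[/= /eqP sab _ _]]; rewrite /frobenius_size /= => sz.
have [t1 <-] : exists t : {bseq n of 'I_n.+1}, map val t = a.
  by apply: seq_bseq_ord; rewrite -sz -addnA ?leq_addr// addnCA leq_addr.
have [t2 <-] : exists t : {bseq n of 'I_n.+1}, map val t = b.
  by apply: seq_bseq_ord; rewrite -sz ?leq_addl// -sab -addnA leq_addr.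
by exists (t1, t2).
Qed.

Definition F_phi (n : nat) : nat := #|` fset_set (frobenius_nozero n)|.

Definition F_0 (n : nat) : nat := #|` fset_set (frobenius_zero n)|.

Definition asymp_equiv (R : realType) (f g : nat -> R) : Prop :=
  f n / g n @[n --> \oo] --> (1 : R).

(* Main.v *)
Require Import Defs.
From mathcomp Require Import all_boot all_order all_algebra.
From mathcomp Require Import finmap.
From mathcomp Require Import all_classical all_reals all_analysis.
From mathcomp Require Import measurable_realfun complex.
From mathcomp Require Import zify ring lra.
Set Implicit Arguments.
Unset Strict Implicit.
Unset Printing Implicit Defensive.
Import Order.TTheory GRing.Theory Num.Theory.
Import numFieldNormedType.Exports.
Local Open Scope classical_set_scope.
Local Open Scope ring_scope.

(** Let [f n] be the number of all Frobenius symbols of size [n].  Increasing the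
    largest entry of a row preserves the zeros, and appending a zero to both rows
    is a bijection; together they give [0 <= F_phi n - F_0 n <= f n - f (n - 1)].
    So it is enough to show [f n ~ exp (pi * sqrt (2 n / 3)) / (4 * sqrt 3 * n)],
    which also gives [f (n - 1) ~ f n].

    The finite form of the Jacobi triple product counts the symbols with entries
    below [n] by [(q)_(2n) / (q)_n ^ 2], so [f] has generating function
    [P = prod_m 1 / (1 - q ^ m)].  The Gaussian estimate of the theta series in
    Gauss's identity [sum_j q ^ (j (j + 1) / 2) = P (q) / P (q ^ 2) ^ 2]
    evaluates [ln P (exp (- t))] up to [o(1)], by a telescoping argument over
    [t, t / 2, t / 4, ...].  In the Fourier integral for [f n] on the circle of
    radius [exp (- t)], [t = pi / sqrt (6 n)], the rescaled integrand tends to a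
    Gaussian and is dominated by a multiple of [1 / (1 + u ^ 2)].  Its first two
    moments are obtained without differentiating the expansion of [ln P], by
    convexity. *)

(** * Frobenius symbols *)

(** The coefficient of index $N$ is read off the box of entries below $N$, so only finite products
    occur on the circle. In $(q)_{2N}/(q)_N^2$ the factors of index above $N$ tend to 1 uniformly,
    because $N t$ grows like $\sqrt N$. Up to its value at the positive real point, each factor
    $1/(1-q^m)$ is the characteristic function of a geometric variable of mean $1/(e^{mt}-1)$, so
    the Gaussian limit is a central limit theorem for a weighted sum of such variables. The variance
    is of order $t^{-3}$, whence the scale $t^{3/2}$ for the angle. The obstacle is the mean, which
    must agree with $N$ up to $o(t^{-3/2})$; the leading order of $\ln P$ does not give this.
    Multiplying $t$ by $1 + x\sqrt t$ changes $\pi^2/(6t) + N t$ by a bounded quadratic term, so a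
    convex function known up to $o(1)$ has its slope at $t$ determined to exactly this precision.
    Hence $\ln P$ is needed up to $o(1)$. The relation between $t$ and $2t$ given by the theta
    series leaves a term $C/t$ undetermined; it is fixed by $\zeta(2) = \pi^2/6$. *)

Fixpoint decseqs (n : nat) : seq (seq nat) :=
  if n is m.+1 then decseqs m ++ map (cons m) (decseqs m) else [:: [::]].

Lemma mem_decseqs n s :
  (s \in decseqs n) = sorted gtn s && all (fun x => x < n)%N s.
Proof.
have path_gtn x t : path gtn x t = all (gtn x) t && sorted gtn t.
  by rewrite path_sortedE// => a b c /= h1 h2; exact: ltn_trans h2 h1.
elim: n s => [|n IHn] s /=; first by case: s => //= x s; rewrite andbF.
rewrite mem_cat IHn; apply/idP/idP.
  case/orP => [/andP[-> /allP h]|/mapP[t]].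
    by apply/allP => x /h /leqW.
  rewrite IHn => /andP[st /allP h] -> /=.
  rewrite path_gtn st ltnSn !andbT /=; apply/andP; split; apply/allP => x /h //.
  exact: leqW.
case/andP => ss /allP h.
case: s ss h => [|x s] //= ss h.
have := h x (mem_head _ _); rewrite ltnS leq_eqVlt => /orP[/eqP xn|xn].
  apply/orP; right; apply/mapP; exists s; last by rewrite xn.
  by rewrite IHn; move: ss; rewrite path_gtn xn andbC.
apply/orP; left; rewrite ss xn /=.
by move: ss; rewrite path_gtn => /andP[/allP k _]; apply/allP => y /k /= yx; exact: ltn_trans yx xn.
Qed.

Lemma uniq_decseqs n : uniq (decseqs n).
Proof.
elim: n => //= n IHn; rewrite cat_uniq IHn map_inj_uniq ?IHn ?andbT//=; last first.
  by move=> s t [].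
apply/hasPn => _ /mapP[s _ ->]; apply/negP.
by rewrite mem_decseqs /= ltnn andbF.
Qed.

Definition box_symbols (n : nat) : seq (seq nat * seq nat) :=
  [seq p <- [seq (a, b) | a <- decseqs n, b <- decseqs n]
          | size p.1 == size p.2].

Definition symbols_where (n : nat) (Q : pred (seq nat * seq nat)) :=
  [seq p <- box_symbols n | (frobenius_size p == n) && Q p].

Lemma uniq_box_symbols n : uniq (box_symbols n).
Proof.
apply: filter_uniq; apply: allpairs_uniq; rewrite ?uniq_decseqs//.
by move=> [a b] [c d] _ _ [-> ->].
Qed.

Lemma uniq_symbols_where n Q : uniq (symbols_where n Q).
Proof. exact/filter_uniq/uniq_box_symbols. Qed.

(** The box loses nothing: the column of an entry adds 1 to the size, so every entry of a symbol of
    size [n] is below [n]. *)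
Lemma mem_symbols_where n Q p :
  (p \in symbols_where n Q) =
  [&& frobenius_symbol p, frobenius_size p == n & Q p].
Proof.
rewrite mem_filter mem_filter.
case: p => a b; apply/idP/idP.
  case/andP => /andP[-> ->] /andP[/= sab /allpairsP[[c d]]] /=.
  rewrite !mem_decseqs => -[/andP[sc _] /andP[sd _] [ac bd]].
  by rewrite /frobenius_symbol /= ac bd sc sd -ac -bd sab.
case/and3P => /and3P[/= sab sa sb] szn Qp; rewrite szn Qp sab /=.
apply/allpairsP; exists (a, b) => /=; rewrite !mem_decseqs sa sb /=.
move: szn; rewrite /frobenius_size /= => /eqP szn; split => //; apply/allP => x xa.
  have := leq_mem_sumn xa.
  by case: (a) xa szn => //= y s _; lia.
have := leq_mem_sumn xa.
by move: sab; case: (b) xa szn => //= y s _; lia.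
Qed.

Lemma card_symbols_where n (Q : pred _) :
  #|` fset_set [set s | frobenius_symbols n s /\ Q s]| =
  size (symbols_where n Q).
Proof.
have -> : [set s | frobenius_symbols n s /\ Q s] =
          [set` [fset x in symbols_where n Q]%fset].
  apply/seteqP; split => s /=.
    by move=> [[h /eqP k] q]; rewrite in_fset mem_symbols_where h k.
  by rewrite in_fset mem_symbols_where => /and3P[h /eqP k q].
by rewrite set_fsetK card_fseq undup_id// uniq_symbols_where.
Qed.

Lemma F_phiE n : F_phi n = size (symbols_where n (fun p => 0%N \notin p.1)).
Proof. by rewrite -card_symbols_where. Qed.

Lemma F_0E n : F_0 n = size (symbols_where n (fun p => 0%N \in p.1)).
Proof. by rewrite -card_symbols_where. Qed.

Definition nsymbols n := size (symbols_where n xpredT).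

Lemma size_symbols_whereD n (P Q : pred _) :
  size (symbols_where n P) =
  (size (symbols_where n (predI P Q)) + size (symbols_where n (predI P (predC Q))))%N.
Proof.
rewrite !size_filter -count_predUI [X in (_ + X)%N](_ : _ = 0)%N ?addn0.
  by apply: eq_count => p /=; case: (_ == _); case: (P p); case: (Q p).
apply/eqP; rewrite -leqn0 leqNgt -has_count; apply/hasPn => p _ /=.
by case: (_ == _); case: (P p); case: (Q p).
Qed.

Lemma leq_symbols_where (g : seq nat * seq nat -> seq nat * seq nat) n m (P Q : pred _) :
  {in symbols_where n P &, injective g} ->
  {in symbols_where n P, forall p, g p \in symbols_where m Q} ->
  (size (symbols_where n P) <= size (symbols_where m Q))%N.
Proof.
move=> gi gP; rewrite -(size_map g); apply: uniq_leq_size.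
  by rewrite map_inj_in_uniq// uniq_symbols_where.
by move=> _ /mapP[p /gP ? ->].
Qed.

Lemma nsymbolsE n : nsymbols n = (F_phi n + F_0 n)%N.
Proof.
rewrite F_phiE F_0E /nsymbols (size_symbols_whereD _ _ (fun p => 0%N \notin p.1)).
by congr (_ + _)%N; apply/congr1/eq_filter => p /=; rewrite ?negbK.
Qed.

Definition has0 : pred (seq nat * seq nat) := fun p => (0%N \in p.1) || (0%N \in p.2).

Definition incr_head (s : seq nat) := if s is x :: t then x.+1 :: t else [::].

Lemma sorted_incr_head s : sorted gtn s -> sorted gtn (incr_head s).
Proof. by case: s => [|x [|y s]]//= /andP[/leqW -> ->]. Qed.

Lemma size_incr_head s : size (incr_head s) = size s.
Proof. by case: s. Qed.

Lemma sumn_incr_head s : (0 < size s)%N -> sumn (incr_head s) = (sumn s).+1.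
Proof. by case: s => //= x s _; rewrite addSn. Qed.

Lemma incr_head_inj : injective incr_head.
Proof. by move=> [|x s] [|y t]//= [-> ->]. Qed.

Lemma mem0_incr_head s : sorted gtn s -> s != [:: 0%N] ->
  (0%N \in incr_head s) = (0%N \in s).
Proof.
case: s => [|x [|y s]]//=; first by case: x.
by move=> /andP[yx _] _; rewrite !inE /=; case: x yx.
Qed.

(* The largest entry of the top row is incremented, unless that row is (0), where
   this would lose its zero: then the bottom row is changed instead. *)
Lemma leq_symbols_has0 (b : bool) n : (0 < n)%N ->
  (size (symbols_where n (fun p => has0 p == b)) <=
   size (symbols_where n.+1 (fun p => has0 p == b)))%N.
Proof.
move=> n0; pose g (p : seq nat * seq nat) :=
  if p.1 == [:: 0%N] then (p.1, incr_head p.2) else (incr_head p.1, p.2).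
apply: (@leq_symbols_where g) => [[a c] [d e] _ _|[a c]].
  rewrite /g /=; case: ifPn => [/eqP ->|a0]; case: ifPn => [/eqP ->|d0].
  - by move=> [/incr_head_inj ->].
  - by case: (d) => [|? ?] [].
  - by case: (a) => [|? ?] [].
  - by move=> [/incr_head_inj -> ->].
rewrite !mem_symbols_where /frobenius_symbol /frobenius_size /=.
case/and3P => /and3P[/eqP sac sa sc] /eqP sz /eqP hb.
(* Here [0 < n] excludes the empty symbol, which has no entry to increase. *)
have a0 : (0 < size a)%N by move: sz sac; case: (a) => //=; case: (c) => //=; lia.
rewrite /g /=; case: ifPn => [/eqP a_|a_] /=; rewrite ?sorted_incr_head//.
  rewrite size_incr_head sac eqxx sa sumn_incr_head -?sac// addnS sz eqxx /=.
  by move: hb; rewrite /has0 a_ /= => ->.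
rewrite size_incr_head sac eqxx sc sumn_incr_head// addnS addSn -sac sz eqxx /=.
by rewrite /has0 /= mem0_incr_head// -hb.
Qed.

Lemma sorted_gtn_rcons0 s : sorted gtn (rcons s 0%N) = sorted gtn s && (0%N \notin s).
Proof.
elim: s => [|x s IHs]//=; case: s IHs => [|y s] /=.
  by rewrite inE; case: x.
move=> ->; by case: x => [|x]; rewrite /= ?ltn0// !in_cons !negb_or !andbA ?andbT.
Qed.

Lemma sorted_gtn_mem0 s : sorted gtn s -> 0%N \in s -> exists t, s = rcons t 0%N.
Proof.
elim: s => [|x s IHs]//= ss; rewrite in_cons => /orP[/eqP x0|/(IHs (path_sorted ss))[t ->]].
  by exists [::]; move: ss; rewrite -x0; case: (s).
by exists (x :: t).
Qed.

Lemma size_symbols_both0 n :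
  size (symbols_where n.+1 (fun p => (0%N \in p.1) && (0%N \in p.2))) =
  size (symbols_where n (fun p => has0 p == false)).
Proof.
pose g (p : seq nat * seq nat) := (rcons p.1 0%N, rcons p.2 0%N).
have gi : injective g.
  by move=> [a b] [c d] [/rcons_inj[->] /rcons_inj[->]].
rewrite -[RHS](size_map g); apply: perm_size; apply: uniq_perm.
- exact: uniq_symbols_where.
- by rewrite map_inj_uniq// uniq_symbols_where.
move=> [a b]; rewrite mem_symbols_where; apply/idP/mapP.
  rewrite /frobenius_symbol /= => /and3P[/and3P[sab sa sb] sz /andP[a0 b0]].
  have [c ac] := sorted_gtn_mem0 sa a0; have [d bd] := sorted_gtn_mem0 sb b0.
  exists (c, d); last by rewrite /g ac bd.
  move: sab sa sb sz; rewrite mem_symbols_where /frobenius_symbol /frobenius_size /has0 ac bd /=.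
  rewrite !sorted_gtn_rcons0 !size_rcons eqSS => -> /andP[-> /negPf ->] /andP[-> /negPf ->].
  by rewrite !sumn_rcons !addn0 !addSn eqSS => ->.
move=> [[c d]]; rewrite mem_symbols_where /frobenius_symbol /frobenius_size /has0 /=.
rewrite eqbF_neg negb_or => /and3P[/and3P[sab sa sb] /eqP sz /andP[a0 b0]] [-> ->].
rewrite !size_rcons eqSS sab !sorted_gtn_rcons0 sa sb a0 b0 !sumn_rcons !addn0 /=.
by rewrite !addSn sz eqxx !mem_rcons !inE.
Qed.

Lemma size_symbols_swap n :
  size (symbols_where n (fun p => (0%N \in p.1) && (0%N \notin p.2))) =
  size (symbols_where n (fun p => (0%N \notin p.1) && (0%N \in p.2))).
Proof.
have si : injective (fun p : seq nat * seq nat => (p.2, p.1)).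
  by move=> [a b] [c d] [-> ->].
have ssz (p : seq nat * seq nat) : frobenius_symbol p ->
    frobenius_size (p.2, p.1) = frobenius_size p.
  by move=> /and3P[/eqP e _ _]; rewrite /frobenius_size /= e addnAC.
have sfs p : frobenius_symbol p -> frobenius_symbol (p.2, p.1).
  by rewrite /frobenius_symbol /= => /and3P[/eqP -> -> ->]; rewrite eqxx.
apply/eqP; rewrite eqn_leq; apply/andP.
by split; apply: (leq_symbols_where (g := fun p => (p.2, p.1)));
  do ?[by move=> ? ? _ _ /si];
  move=> p; rewrite !mem_symbols_where => /and3P[fp sp hp];
  rewrite sfs// ssz// sp /= andbC.
Qed.

(* By symmetry of the rows, the difference is the number of symbols without
   zeros minus the number of symbols with a zero in both rows. *)
Lemma F_phi_sub_F_0 n :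
  (F_phi n.+1 + size (symbols_where n (fun p => has0 p == false)) =
   F_0 n.+1 + size (symbols_where n.+1 (fun p => has0 p == false)))%N.
Proof.
rewrite -size_symbols_both0 F_phiE F_0E.
rewrite (size_symbols_whereD _ (fun p => 0%N \notin p.1) (fun p => 0%N \in p.2)).
rewrite (size_symbols_whereD _ (fun p => 0%N \in p.1) (fun p => 0%N \in p.2)).
have E1 : symbols_where n.+1 (predI (fun p => 0%N \notin p.1) (predC (fun p => 0%N \in p.2))) =
         symbols_where n.+1 (fun p => has0 p == false).
  by apply: eq_filter => p /=; rewrite /has0 eqbF_neg negb_or.
have E2 := size_symbols_swap n.+1.
rewrite E1 -[X in ((X + _) + _)%N]E2 addnC addnA; congr (_ + _)%N.
Qed.

Lemma leq_F_0_F_phi n : (0 < n)%N -> (F_0 n.+1 <= F_phi n.+1)%N.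
Proof.
move=> n0; have := F_phi_sub_F_0 n; have := leq_symbols_has0 false n0; lia.
Qed.

(** The excess of [F_phi] over [F_0] is the increase of the number of zero-free symbols. The symbols
    with a zero increase in number too, so the excess is at most the increase of the total. *)
Lemma leq_F_phi_F_0 n : (0 < n)%N ->
  (F_phi n.+1 + nsymbols n <= F_0 n.+1 + nsymbols n.+1)%N.
Proof.
move=> n0; have := F_phi_sub_F_0 n; have := leq_symbols_has0 true n0.
have e m : nsymbols m = (size (symbols_where m (fun p => has0 p == true)) +
                         size (symbols_where m (fun p => has0 p == false)))%N.
  rewrite /nsymbols (size_symbols_whereD _ _ has0); congr (_ + _)%N.
    by apply/congr1/eq_filter => p /=; rewrite eqb_id.
  by apply/congr1/eq_filter => p /=; rewrite eqbF_neg.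
rewrite !e; lia.
Qed.

(** * Finite Jacobi triple product *)

Section qBinomial.
Variables (A : comNzRingType) (q : A).

Definition qpoch (n : nat) : A := \prod_(i < n) (1 - q ^+ i.+1).

Lemma qpochS n : qpoch n.+1 = qpoch n * (1 - q ^+ n.+1).
Proof. by rewrite /qpoch big_ord_recr. Qed.

(** A top entry $i$ contributes $q^{i+1}X$, the extra $q$ counting its column. The second product is
    $X^b\prod_j(1+q^jX^{-1})$: clearing the negative powers moves the constant term of the Jacobi
    product to the coefficient of $X^b$. *)
Definition row_poly (a b : nat) : {poly A} :=
  (\prod_(i < a) (1 + q ^+ i.+1 *: 'X)) * (\prod_(j < b) ('X + (q ^+ j)%:P)).

Lemma row_polySb a b k : (row_poly a b.+1)`_k =
  (if k is k'.+1 then (row_poly a b)`_k' else 0) + q ^+ b * (row_poly a b)`_k.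
Proof.
rewrite /row_poly big_ord_recr /= mulrA mulrDr coefD coefMX coefMC [_ * q ^+ b]mulrC.
by case: k.
Qed.

Lemma row_polySa a b k : (row_poly a.+1 b)`_k =
  (row_poly a b)`_k + (if k is k'.+1 then q ^+ a.+1 * (row_poly a b)`_k' else 0).
Proof.
rewrite /row_poly big_ord_recr /= mulrAC mulrDr mulr1 coefD -scalerAr coefZ coefMX.
by case: k => //=; rewrite mulr0.
Qed.

Lemma size_row_poly a b : (size (row_poly a b) <= (a + b).+1)%N.
Proof.
apply/leq_sizeP; elim: a => [|a IHa].
  elim: b => [|b IHb] k.
    by rewrite /row_poly !big_ord0 mulr1 coef1; case: k.
  by case: k => // k kb; rewrite row_polySb !IHb ?mulr0 ?addr0//; lia.
by case=> // k kb; rewrite row_polySa !IHa ?mulr0 ?addr0//; lia.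
Qed.

(** The triangular number $j(j+1)/2$ at the integer $j = k - b$ of either sign; with truncated
    subtraction at most one of the two terms is nonzero. *)
Let T k b : nat := ('C(k.+1 - b, 2) + 'C(b - k, 2))%N.

(** Induction by the $q$-Pascal rule. Denominators are cleared because [qpoch] need not be
    invertible in [A]. *)
Lemma row_poly_qbinomial0 b k : (k <= b)%N ->
  (row_poly 0 b)`_k * qpoch k * qpoch (b - k) = q ^+ 'C(b - k, 2) * qpoch b.
Proof.
elim: b k => [|b IHb] k.
  rewrite leqn0 => /eqP ->.
  by rewrite subnn /row_poly /qpoch !big_ord0 !mulr1 coef1 expr0.
case: k => [_|k].
  rewrite row_polySb add0r subn0 {1}/qpoch big_ord0 mulr1 -mulrA [in LHS]qpochS.
  have := IHb 0%N (leq0n _); rewrite subn0 {1}/qpoch big_ord0 mulr1 => E.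
  by rewrite !mulrA -(mulrA (q ^+ b)) E binS bin1 addnC exprD qpochS !mulrA.
rewrite ltnS => kb; rewrite row_polySb subSS mulrDl mulrDl.
have E1 : (row_poly 0 b)`_k * qpoch k.+1 * qpoch (b - k) =
          q ^+ 'C(b - k, 2) * qpoch b * (1 - q ^+ k.+1).
  by rewrite qpochS -(IHb k kb); ring.
rewrite E1.
have E2 : q ^+ b * (row_poly 0 b)`_k.+1 * qpoch k.+1 * qpoch (b - k) =
          q ^+ 'C(b - k, 2) * q ^+ k.+1 * qpoch b * (1 - q ^+ (b - k)).
  move: kb; rewrite leq_eqVlt => /orP[/eqP kb|kb].
    rewrite kb subnn expr0 subrr mulr0.
    by rewrite nth_default ?mulr0 ?mul0r// (leq_trans (size_row_poly _ _)).
  have -> : (b - k)%N = (b - k.+1).+1 by lia.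
  rewrite [qpoch (_ - _).+1]qpochS.
  have -> : q ^+ 'C((b - k.+1).+1, 2) * q ^+ k.+1 = q ^+ b * q ^+ 'C(b - k.+1, 2).
    by rewrite -!exprD binS bin1; congr (_ ^+ _); lia.
  have := IHb _ kb; move: (qpoch (b - k.+1)) (qpoch k.+1) ((row_poly 0 b)`_k.+1).
  by move=> u v w E; move: (1 - q ^+ (b - k.+1).+1) => y; rewrite -(mulrA _ _ (qpoch b)) -E; ring.
(* The two parts combine by $(1-q^{k+1}) + q^{k+1}(1-q^{b-k}) = 1-q^{b+1}$. *)
rewrite E2 qpochS; have -> : q ^+ b.+1 = q ^+ k.+1 * q ^+ (b - k).
  by rewrite -exprD; congr (_ ^+ _); lia.
ring.
Qed.

(* A form of the q-binomial theorem, which is the finite form of the Jacobi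
   triple product. *)
Lemma row_poly_qbinomial a b k : (k <= a + b)%N ->
  (row_poly a b)`_k * qpoch k * qpoch (a + b - k) = q ^+ T k b * qpoch (a + b).
Proof.
elim: a k => [|a IHa] k kab.
  rewrite row_poly_qbinomial0// /T [X in (X + _)%N]bin_small//; lia.
rewrite addSn in kab *; rewrite row_polySa.
case: k kab => [_|k].
  have := IHa 0%N (leq0n _); rewrite !subn0 addr0 => E.
  by rewrite [in LHS]qpochS mulrA E qpochS mulrA.
rewrite ltnS => kab; rewrite subSS mulrDl mulrDl.
have Tk : (T k b + a.+1 = T k.+1 b + (a + b - k))%N.
  rewrite /T; case: (leqP b k) => bk.
    have -> : (k.+2 - b = (k.+1 - b).+1)%N by lia.
    rewrite binS bin1 [X in (_ + X + _)%N]bin_small; last by lia.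
    rewrite [X in (_ = _ + X + _)%N]bin_small; lia.
  have -> : (b - k = (b - k.+1).+1)%N by lia.
  rewrite binS bin1 [X in (X + _ + _)%N]bin_small; last by lia.
  rewrite [X in (_ = X + _ + _)%N]bin_small; lia.
have E1 : q ^+ a.+1 * (row_poly a b)`_k * qpoch k.+1 * qpoch (a + b - k) =
          q ^+ T k.+1 b * q ^+ (a + b - k) * qpoch (a + b) * (1 - q ^+ k.+1).
  rewrite -exprD -Tk exprD qpochS.
  have := IHa k kab; move: (qpoch (a + b - k)) (qpoch k) ((row_poly a b)`_k) => u v w E.
  by transitivity (q ^+ a.+1 * (w * v * u) * (1 - q ^+ k.+1)); [ring|rewrite E; ring].
have E2 : (row_poly a b)`_k.+1 * qpoch k.+1 * qpoch (a + b - k) =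
          q ^+ T k.+1 b * qpoch (a + b) * (1 - q ^+ (a + b - k)).
  move: kab; rewrite leq_eqVlt => /orP[/eqP kab|kab].
    rewrite kab subnn expr0 subrr mulr0.
    by rewrite nth_default ?mulr0 ?mul0r// (leq_trans (size_row_poly _ _)) ?kab.
  have -> : (a + b - k)%N = (a + b - k.+1).+1 by lia.
  rewrite [qpoch (_ - _).+1]qpochS.
  have := IHa _ kab; move: (qpoch (a + b - k.+1)) (qpoch k.+1) ((row_poly a b)`_k.+1).
  by move=> u v w E; rewrite !mulrA E.
rewrite E1 E2 qpochS; have -> : q ^+ (a + b).+1 = q ^+ k.+1 * q ^+ (a + b - k).
  by rewrite -exprD; congr (_ ^+ _); lia.
ring.
Qed.

(** Choosing one term in each factor amounts to choosing the two rows. A bottom entry that is not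
    chosen contributes $X$, whence the exponent [b - size t]. *)
Lemma row_poly_decseqs a b : row_poly a b =
  \sum_(s <- decseqs a) \sum_(t <- decseqs b)
    q ^+ (size s + sumn s + sumn t) *: 'X^(size s + (b - size t)).
Proof.
have szd n s : s \in decseqs n -> (size s <= n)%N.
  elim: n s => [|n IHn] s /=; first by rewrite inE => /eqP ->.
  by rewrite mem_cat => /orP[/IHn /leqW//|/mapP[t /IHn ? ->]].
have -> : row_poly a b = (\sum_(s <- decseqs a) q ^+ (size s + sumn s) *: 'X^(size s)) *
   (\sum_(t <- decseqs b) q ^+ sumn t *: 'X^(b - size t)).
  congr (_ * _).
    elim: a => [|a IHa]; first by rewrite big_ord0 big_seq1 expr0 scale1r.
    rewrite big_ord_recr /= IHa big_cat big_map /= mulrDr mulr1; congr (_ + _).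
    rewrite big_distrl /=; apply: eq_bigr => s _.
    rewrite -scalerAl -scalerAr scalerA -exprSr -exprD; congr (_ ^+ _ *: _); lia.
  elim: b => [|b IHb]; first by rewrite big_ord0 big_seq1 expr0 scale1r.
  rewrite big_ord_recr /= IHb big_cat big_map /= mulrDr; congr (_ + _).
    rewrite big_distrl /=; apply: eq_big_seq => s /szd sb.
    by rewrite -scalerAl -exprSr subSn.
  rewrite big_distrl /=; apply: eq_big_seq => s /szd sb.
  by rewrite subSS [_ *: _ * _]mulrC mul_polyC scalerA -exprD.
rewrite big_distrl /=; apply: eq_bigr => s _; rewrite big_distrr /=.
apply: eq_bigr => t _.
by rewrite -scalerAl -scalerAr scalerA -!exprD.
Qed.

(** In [row_poly n n] the coefficient of $X^n$ collects exactly the pairs of rows of equal length,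
    and its triangular exponent is 0. *)
Lemma box_symbols_qbinomial n :
  (\sum_(p <- box_symbols n) q ^+ frobenius_size p) * qpoch n * qpoch n =
  qpoch (n + n).
Proof.
have := @row_poly_qbinomial n n n (leq_addr _ _).
rewrite addnK /T subSn// subnn /= !bin_small// expr0 mul1r => <-.
congr (_ * _ * _).
rewrite row_poly_decseqs coef_sum big_filter big_mkcond big_allpairs_dep /=.
apply: eq_big_seq => s sn; rewrite coef_sum; apply: eq_big_seq => t tn.
rewrite coefZ coefXn /frobenius_size /=.
have szd m (u : seq nat) : u \in decseqs m -> (size u <= m)%N.
  elim: m u => [|m IHm] u /=; first by rewrite inE => /eqP ->.
  by rewrite mem_cat => /orP[/IHm /leqW//|/mapP[v /IHm ? ->]].
have := szd _ _ sn; have := szd _ _ tn; move: (size s) (size t) => c d h1 h2.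
have -> : (n == c + (n - d))%N = (c == d).
  by apply/idP/idP => /eqP h; apply/eqP; lia.
by case: eqP; rewrite ?mulr1 ?mulr0.
Qed.

End qBinomial.

(** * Shanks's finite form of Gauss's identity *)

Section ShanksIdentity.
Variables (F : fieldType) (q : F).
Hypothesis q_neq1 : forall k, 1 - q ^+ k.+1 != 0.

(** A partial product of $\prod_{k\ge1}(1-q^{2k})/(1-q^{2k-1})$, the product side of Gauss's
    identity. *)
Definition shanks_prod (n : nat) : F :=
  \prod_(k < n) ((1 - q ^+ k.+1.*2) / (1 - q ^+ k.*2.+1)).

Lemma shanks_prodS n :
  shanks_prod n.+1 = shanks_prod n * (1 - q ^+ n.*2.+2) / (1 - q ^+ n.*2.+1).
Proof. by rewrite /shanks_prod big_ord_recr /= mulrA doubleS. Qed.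

Lemma shanks_prod_neq0 n : shanks_prod n != 0.
Proof.
elim: n => [|n IHn]; first by rewrite /shanks_prod big_ord0 oner_neq0.
by rewrite shanks_prodS !mulf_neq0// invr_neq0.
Qed.

(** A certificate in the manner of Wilf and Zeilberger: the increment in [n] of the summand of
    [shanks_identity] is a multiple, independent of [s], of the increment in [s] of [U]. *)
Let U n s : F := q ^+ (s * n.*2.+1) * (1 - q ^+ s.*2) / shanks_prod s.

Lemma shanks_telescope n m :
  \sum_(s < m) (shanks_prod n.+1 / shanks_prod s * q ^+ (s * n.+1.*2.+1)
                - shanks_prod n / shanks_prod s * q ^+ (s * n.*2.+1)) =
  shanks_prod n / (1 - q ^+ n.*2.+1) * U n m.
Proof.
elim: m => [|m IHm]; first by rewrite big_ord0 /U expr0 subrr mulr0 mul0r mulr0.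
rewrite big_ord_recr /= IHm /U shanks_prodS.
have -> : (m * n.+1.*2.+1 = m * n.*2.+1 + m.*2)%N by rewrite -!muln2; ring.
have -> : (m.+1 * n.*2.+1 = m * n.*2.+1 + n.*2.+1)%N by rewrite -!muln2; ring.
rewrite doubleS shanks_prodS.
have -> : q ^+ n.*2.+2 = q * q ^+ n.*2.+1 by rewrite exprS.
have -> : q ^+ m.*2.+2 = q * q ^+ m.*2.+1 by rewrite exprS.
have := q_neq1 m.*2; have := q_neq1 n.*2; have := q_neq1 m.*2.+1.
have := shanks_prod_neq0 m.
rewrite !exprD; move: (q ^+ (m * n.*2.+1)) (shanks_prod n) (shanks_prod m) => x y z.
rewrite [q ^+ m.*2.+2]exprS [q ^+ m.*2.+1]exprS.
move: (q ^+ m.*2) (q ^+ n.*2.+1) => u v z0 h1 h2 h3.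
by field; rewrite z0 h1 h2 h3.
Qed.

Lemma shanks_identity n :
  \sum_(s < n) shanks_prod n / shanks_prod s * q ^+ (s * n.*2.+1) =
  \sum_(j < n.*2) q ^+ 'C(j.+1, 2).
Proof.
elim: n => [|n IHn]; first by rewrite !big_ord0.
have := shanks_telescope n n.+1; rewrite sumrB => /eqP; rewrite subr_eq => /eqP ->.
rewrite [in LHS]big_ord_recr /= IHn doubleS 2!big_ord_recr /=.
(* The two new exponents are the triangular numbers of index $2n$ and $2n+1$. The first comes from
   the term $s = n$ for the old product, the second from the end of the telescoping sum. *)
have -> : 'C(n.*2.+1, 2) = (n * n.*2.+1)%N.
  by rewrite bin2odd /= ?doubleK ?odd_double//; lia.
have -> : 'C(n.*2.+2, 2) = (n.+1 * n.*2.+1)%N.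
  by rewrite binS bin1 bin2odd /= ?odd_double// doubleK [RHS]mulSnr; congr (_ + _)%N; rewrite mulnC.
rewrite divff ?shanks_prod_neq0// mul1r [LHS]addrC; congr (_ + _).
rewrite /U shanks_prodS doubleS.
have := q_neq1 n.*2.+1; have := q_neq1 n.*2; have := shanks_prod_neq0 n.
move: (q ^+ (n.+1 * n.*2.+1)) (q ^+ n.*2.+2) (q ^+ n.*2.+1) (shanks_prod n) => a b c d h1 h2 h3.
by field; rewrite h1 h2 h3.
Qed.

End ShanksIdentity.

(** * Asymptotics of the partition generating function *)

Section LogPartition.
Variable R : realType.
Implicit Types (x t : R) (N : nat).

Definition lnP_term x : R := - ln (1 - expR (- x)).

Definition lnP_trunc N t : R := \sum_(m < N) lnP_term (m.+1%:R * t).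

Definition lnP t : R := limn (lnP_trunc ^~ t).

Lemma expRN_lt1 x : 0 < x -> 0 < 1 - expR (- x).
Proof. by move=> x0; rewrite subr_gt0 expR_lt1 oppr_lt0. Qed.

Lemma lnP_term_ge0 x : 0 < x -> 0 <= lnP_term x.
Proof. by move=> x0; rewrite oppr_ge0 ln_le0// gerBl expR_ge0. Qed.

Lemma lnP_term_le x : 0 < x -> lnP_term x <= expR (- x) / (1 - expR (- x)).
Proof.
move=> x0; have p := expRN_lt1 x0.
rewrite /lnP_term -lnV ?posrE//.
rewrite [X in ln X](_ : _ = 1 + expR (- x) / (1 - expR (- x))); last first.
  by field; rewrite gt_eqF.
by rewrite le_ln1Dx// (lt_le_trans (ltrN10 _))// divr_ge0 ?expR_ge0// ltW.
Qed.

Lemma sum_geometric_le (y : R) M N : 0 <= y < 1 ->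
  \sum_(M <= m < N) y ^+ m.+1 <= y ^+ M.+1 / (1 - y).
Proof.
move=> /andP[y0 y1]; have y1' : 0 < 1 - y by rewrite subr_gt0.
case: (leqP N M) => NM; first by rewrite big_geq// divr_ge0 ?exprn_ge0// ltW.
rewrite ler_pdivlMr// mulrC.
have -> : (1 - y) * \sum_(M <= m < N) y ^+ m.+1 = y ^+ M.+1 - y ^+ N.+1.
  rewrite big_distrr /=.
  under eq_bigr do rewrite mulrBl mul1r -exprS -opprB.
  by rewrite sumrN telescope_sumr ?opprB// ltnW.
by rewrite gerBl exprn_ge0.
Qed.

Lemma lnP_sum_le t M N : 0 < t ->
  \sum_(M <= m < N) lnP_term (m.+1%:R * t) <= expR (- t) ^+ M.+1 / (1 - expR (- t)) ^+ 2.
Proof.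
move=> t0; have p := expRN_lt1 t0.
rewrite expr2 invfM mulrA ler_pdivlMr//.
have e01 : 0 <= expR (- t) < 1 by rewrite expR_ge0 /= expR_lt1 oppr_lt0.
apply: le_trans (sum_geometric_le M N e01).
rewrite big_distrl /=; apply: ler_sum => m _.
rewrite -ler_pdivlMr//; apply: le_trans (lnP_term_le _) _.
  by rewrite mulr_gt0.
rewrite -expRM_natl mulrN; apply: ler_pM => //; rewrite ?expR_ge0//.
  by rewrite invr_ge0 ltW// expRN_lt1// mulr_gt0.
rewrite lef_pV2 ?posrE ?expRN_lt1 ?mulr_gt0// lerD2l lerN2 ler_expR lerN2.
by rewrite ler_peMl ?ler1n// ltW.
Qed.

Lemma lnP_truncB t M N : (M <= N)%N ->
  lnP_trunc N t - lnP_trunc M t = \sum_(M <= m < N) lnP_term (m.+1%:R * t).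
Proof.
move=> MN; rewrite /lnP_trunc -!(big_mkord xpredT (fun m => lnP_term (m.+1%:R * t))).
by rewrite (big_cat_nat (leq0n M) MN) /= addrAC subrr add0r.
Qed.

Lemma nondecreasing_lnP_trunc t : 0 < t -> nondecreasing_seq (lnP_trunc ^~ t).
Proof.
move=> t0 M N MN; rewrite -subr_ge0 lnP_truncB// sumr_ge0// => m _.
by rewrite lnP_term_ge0// mulr_gt0.
Qed.

Lemma cvg_lnP_trunc t : 0 < t -> lnP_trunc N t @[N --> \oo] --> lnP t.
Proof.
move=> t0; apply: nondecreasing_is_cvgn; first exact: nondecreasing_lnP_trunc.
exists (expR (- t) / (1 - expR (- t)) ^+ 2) => _ [N _ <-].
have := lnP_sum_le 0 N t0; rewrite expr1; apply: le_trans.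
by rewrite /lnP_trunc big_mkord.
Qed.

Lemma lnP_trunc_le N t : 0 < t -> lnP_trunc N t <= lnP t.
Proof.
move=> t0; apply: nondecreasing_cvgn_le.
  exact: nondecreasing_lnP_trunc.
by apply/cvg_ex; exists (lnP t); exact: cvg_lnP_trunc.
Qed.

(** The bound is explicit because the truncation index and [t] will vary together. *)
Lemma lnP_tail N t : 0 < t ->
  lnP t - lnP_trunc N t <= expR (- t) ^+ N.+1 / (1 - expR (- t)) ^+ 2.
Proof.
move=> t0; rewrite lerBlDr; apply: limr_le.
  by apply/cvg_ex; exists (lnP t); exact: cvg_lnP_trunc.
near=> M; rewrite -lerBlDr lnP_truncB ?lnP_sum_le//.
by near: M; exact: nbhs_infty_ge.
Unshelve. all: by end_near. Qed.

End LogPartition.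

(** * Gaussian estimate of Gauss's theta series *)

Section Theta.
Variable R : realType.
Implicit Types (x t h : R) (n N : nat).
Let I : R -> R := gauss_integral_proof.integral0_gauss.

(** The Gaussian decreases on the nonnegative half-line, so its integral over $[x, x+h]$ lies
    between the rectangles at the two ends. *)
Lemma integral0_gauss_step x h : 0 <= x -> 0 < h ->
  h * gauss_fun (x + h) <= I (x + h) - I x <= h * gauss_fun x.
Proof.
move=> x0 h0; rewrite /I /gauss_integral_proof.integral0_gauss.
have ci (a b : R) : (@lebesgue_measure R).-integrable `[a, b] (EFin \o @gauss_fun R).
  apply: continuous_compact_integrable; first exact: segment_compact.
  by apply: continuous_subspaceT; exact: continuous_gauss_fun.
have xh : x <= x + h by rewrite lerDl ltW.
rewrite Rintegral_itvB ?bnd_simp//.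
have ioc : (@lebesgue_measure R).-integrable `]x, x + h] (EFin \o @gauss_fun R).
  apply: (integrableS _ _ _ (ci x (x + h))) => //.
  by apply: subset_itvr; rewrite bnd_simp.
have ic c : (@lebesgue_measure R).-integrable `]x, x + h] (EFin \o cst c).
  have cc : (@lebesgue_measure R).-integrable `[x, x + h] (EFin \o cst c).
    apply: continuous_compact_integrable; first exact: segment_compact.
    by apply: continuous_subspaceT => ?; exact: cvg_cst.
  apply: (integrableS _ _ _ cc) => //.
  by apply: subset_itvr; rewrite bnd_simp.
have Ic c : \int[@lebesgue_measure R]_(_ in `]x, x + h]) c = h * c.
  rewrite Rintegral_cst//= lebesgue_measure_itv /= lte_fin ltrDl h0 /=.
  by rewrite addrAC subrr add0r mulrC.
have gd a b : 0 <= a -> a <= b -> gauss_fun b <= gauss_fun a :> R.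
  move=> a0 ab; rewrite /gauss_fun ler_expR lerN2.
  by rewrite ler_sqr ?nnegrE// (le_trans a0).
rewrite -!Ic; apply/andP; split.
  apply: le_Rintegral => //=; first exact: ic.
  move=> y; rewrite in_itv /= => /andP[xy yh]; apply: gd => //.
  by rewrite (le_trans x0)// ltW.
apply: le_Rintegral => //=; first exact: ic.
by move=> y; rewrite in_itv /= => /andP[xy yh]; apply: gd => //; exact: ltW.
Qed.

Lemma integral0_gauss0 : I 0 = 0.
Proof.
by rewrite /I /gauss_integral_proof.integral0_gauss set_itv1 Rintegral_set1.
Qed.

Lemma nondecreasing_integral0_gauss x y : 0 <= x -> x <= y -> I x <= I y.
Proof.
move=> x0; rewrite le_eqVlt => /orP[/eqP ->//|xy].
have /andP[+ _] := @integral0_gauss_step x (y - x) x0 ltac:(by rewrite subr_gt0).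
rewrite (_ : x + (y - x) = y); last by rewrite addrC subrK.
rewrite -[I x <= _]subr_ge0; apply: le_trans.
by rewrite mulr_ge0 ?gauss_fun_ge0// subr_ge0 ltW.
Qed.

Lemma cvg_integral0_gauss : I x @[x --> +oo] --> Num.sqrt pi / 2.
Proof.
have -> : I = (fun x => Num.sqrt (I x ^+ 2)).
  apply/funext => x; rewrite sqrtr_sqr ger0_norm//.
  exact: gauss_integral_proof.integral0_gauss_ge0.
have -> : Num.sqrt pi / 2 = Num.sqrt (pi / 4) :> R.
  rewrite sqrtrM ?pi_ge0// sqrtrV// (_ : 4 = 2 ^+ 2) ?sqrtr_sqr ?ger0_norm//.
  by rewrite expr2 -natrM.
apply: continuous_cvg; first exact: sqrt_continuous.
exact: gauss_integral_proof.cvg_integral0_gauss_sqr.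
Qed.

Lemma integral0_gauss_le x : 0 <= x -> I x <= Num.sqrt pi / 2.
Proof.
move=> x0; apply: (cvgr_to_ge cvg_integral0_gauss).
near=> y; apply: nondecreasing_integral0_gauss => //.
Unshelve. all: by end_near. Qed.

Lemma gauss_sum_ge n h : 0 < h ->
  I (n%:R * h) <= h * \sum_(j < n) gauss_fun (j%:R * h).
Proof.
move=> h0; elim: n => [|n IHn].
  by rewrite mul0r integral0_gauss0 big_ord0 mulr0.
rewrite big_ord_recr /= mulrDr; apply: le_trans (lerD IHn (lexx _)).
have /andP[_] := @integral0_gauss_step (n%:R * h) h ltac:(by rewrite mulr_ge0// ltW) h0.
by rewrite -natr1 mulrDl mul1r lerBlDl.
Qed.

Lemma gauss_sum_le n h : 0 < h ->
  h * \sum_(j < n) gauss_fun (j.+1%:R * h) <= I (n%:R * h).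
Proof.
move=> h0; elim: n => [|n IHn].
  by rewrite mul0r integral0_gauss0 big_ord0 mulr0.
rewrite big_ord_recr /= mulrDr.
have /andP[+ _] := @integral0_gauss_step (n%:R * h) h ltac:(by rewrite mulr_ge0// ltW) h0.
rewrite -natr1 mulrDl mul1r lerBrDr => H; apply: le_trans H.
by rewrite addrC lerD2l.
Qed.

Definition theta_sum n t : R := \sum_(j < n) expR (- t) ^+ 'C(j.+1, 2).

Lemma binom2R (j : nat) : ('C(j.+1, 2))%:R = j.+1%:R * j%:R / 2 :> R.
Proof.
have H : ('C(j.+1, 2) * 2 = j.+1 * j)%N.
  by have := mul_bin_left j.+1 1; rewrite bin1 subn1 /= mulnC => ->; rewrite mulnC.
by apply: (@mulIf _ 2); rewrite ?pnatr_eq0// divfK ?pnatr_eq0// -!natrM H.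
Qed.

(** Since $j^2 \le j(j+1) \le (j+1)^2$, the term of index $j$ lies between the Gaussian samples at
    $(j+1)h$ and $jh$ with $h = \sqrt{t/2}$. Both Riemann sums differ from the integral by at most
    one term, of value $h$. *)
Lemma theta_sum_bounds n t : 0 < t ->
  I (n%:R * Num.sqrt (t / 2)) - Num.sqrt (t / 2) <= Num.sqrt (t / 2) * theta_sum n t
    <= Num.sqrt (t / 2) + Num.sqrt pi / 2.
Proof.
move=> t0; set h := Num.sqrt (t / 2); have h0 : 0 < h by rewrite sqrtr_gt0 divr_gt0.
have hh (c : R) : (c * h) ^+ 2 = c ^+ 2 * t / 2.
  by rewrite exprMn sqr_sqrtr ?mulrA// divr_ge0// ltW.
have E j : expR (- t) ^+ 'C(j.+1, 2) = expR (- (j.+1%:R * j%:R * t / 2)).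
  by rewrite -expRM_natl binom2R; congr expR; lra.
apply/andP; split.
  have := gauss_sum_ge n.+1 h0; rewrite big_ord_recl /= mul0r mulrDr.
  rewrite {1}/gauss_fun expr0n/= oppr0 expR0 mulr1 -lerBlDl => H.
  apply: le_trans (le_trans H _).
    rewrite lerD2r; apply: nondecreasing_integral0_gauss.
      by rewrite mulr_ge0// ltW.
    by rewrite ler_pM2r// ler_nat.
  rewrite ler_pM2l//; apply: ler_sum => j _; rewrite E /gauss_fun ler_expR lerN2 hh.
  rewrite ler_pM2r// ler_pM2r// expr2 ler_pM2l// ler_nat; exact: leqnSn.
case: n => [|n].
  by rewrite /theta_sum big_ord0 mulr0 addr_ge0 ?divr_ge0 ?sqrtr_ge0 ?ltW.
rewrite /theta_sum big_ord_recl bin_small// expr0 mulrDr mulr1 lerD2l.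
have nh0 : 0 <= n%:R * h by rewrite mulr_ge0// ltW.
apply: le_trans (integral0_gauss_le nh0).
apply: le_trans (gauss_sum_le n h0); rewrite ler_pM2l//; apply: ler_sum => j _.
rewrite lift0 E /gauss_fun ler_expR lerN2 hh.
by rewrite ler_pM2r// ler_pM2r// expr2 ler_pM2r// ler_nat.
Qed.

(** The sum of the theta series at $q = e^{-t}$, defined by the product side $P(q)/P(q^2)^2$ of
    Gauss's identity. *)
Definition theta t : R := expR (lnP t - 2 * lnP (2 * t)).

Lemma expR_lnP_term x : 0 < x -> expR (lnP_term x) = (1 - expR (- x))^-1.
Proof. by move=> x0; rewrite /lnP_term expRN lnK// posrE expRN_lt1. Qed.

Lemma shanks_prod_lnP n t : 0 < t ->
  shanks_prod (expR (- t)) n = expR (lnP_trunc n.*2 t - 2 * lnP_trunc n (2 * t)).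
Proof.
move=> t0; elim: n => [|n IHn].
  by rewrite /shanks_prod /lnP_trunc !big_ord0 mulr0 subrr expR0.
rewrite shanks_prodS IHn doubleS /lnP_trunc !big_ord_recr /=.
have e2 : n.+1%:R * (2 * t) = n.*2.+2%:R * t :> R.
  by rewrite mulrA -natrM muln2 doubleS.
rewrite e2.
set x := \sum_(i < n.*2) _; set y := \sum_(i < n) _.
set c := n.*2.+2%:R * t; set d := n.*2.+1%:R * t.
have c0 : 0 < c by rewrite mulr_gt0.
have d0 : 0 < d by rewrite mulr_gt0.
have -> : x + lnP_term d + lnP_term c - 2 * (y + lnP_term c) =
   (x - 2 * y) + (lnP_term d - lnP_term c) by ring.
rewrite [in RHS]expRD [expR (lnP_term d - _)]expRB !expR_lnP_term// invrK -mulrA.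
congr (_ * _); rewrite mulrC; congr (_^-1 * _).
  by rewrite -expRM_natl mulrN.
by rewrite -expRM_natl mulrN.
Qed.

Lemma cvg_shanks_prod t : 0 < t ->
  shanks_prod (expR (- t)) n @[n --> \oo] --> theta t.
Proof.
move=> t0; under eq_fun do rewrite shanks_prod_lnP//.
have c1 : lnP_trunc n.*2 t @[n --> \oo] --> lnP t.
  have dc : n.*2 @[n --> \oo] --> \oo.
    apply/cvgnyPge => M; near=> n; rewrite -addnn (leq_trans _ (leq_addr _ _))//.
    by near: n; exact: nbhs_infty_ge.
  exact: (cvg_comp _ _ dc (cvg_lnP_trunc t0)).
have c2 : 2 * lnP_trunc n (2 * t) @[n --> \oo] --> 2 * lnP (2 * t).
  by apply: cvgMl_tmp; apply: cvg_lnP_trunc; rewrite mulr_gt0.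
exact: (cvg_comp _ _ (cvgB c1 c2) (@continuous_expR R _)).
Unshelve. all: by end_near. Qed.

(** In [shanks_identity] the term $s = 0$ is the product itself. The term of index $s \ge 1$ is
    nonnegative and at most $q^{n+s}$ times it, since every [shanks_prod] is at least 1. *)
Lemma shanks_prod_theta_sum n t : 0 < t ->
  shanks_prod (expR (- t)) n.+1 <= theta_sum n.+1.*2 t <=
  shanks_prod (expR (- t)) n.+1 * (1 + expR (- t) ^+ n / (1 - expR (- t))).
Proof.
move=> t0; rewrite /theta_sum; set q := expR (- t).
have q0 : 0 < q by exact: expR_gt0.
have q1 : q < 1 by rewrite expR_lt1 oppr_lt0.
have qk k : 0 < 1 - q ^+ k.+1 by rewrite subr_gt0 exprn_ilt1// ltW.
have qN k : 1 - q ^+ k.+1 != 0 by rewrite gt_eqF.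
have P1 k : 1 <= shanks_prod q k.
  elim: k => [|k IHk]; first by rewrite /shanks_prod big_ord0.
  rewrite shanks_prodS -mulrA mulr_ege1// ler_pdivlMr ?qk// mul1r.
  by rewrite lerD2l lerN2 exprS ler_piMl ?exprn_ge0// ltW.
have P0 k : 0 < shanks_prod q k by exact: lt_le_trans (P1 k).
rewrite -shanks_identity// big_ord_recl mul0n expr0 mulr1.
have -> : shanks_prod q (ord0 : 'I_n.+1) = 1 by rewrite /shanks_prod big_ord0.
rewrite divr1; apply/andP; split.
  rewrite lerDl; apply: sumr_ge0 => s _.
  by rewrite mulr_ge0 ?exprn_ge0 ?divr_ge0// ltW.
rewrite mulrDr mulr1 lerD2l; apply: (@le_trans _ _ (\sum_(s < n)
    shanks_prod q n.+1 * q ^+ n * q ^+ s.+1)).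
  apply: ler_sum => s _; rewrite lift0 -!mulrA ler_pM2l//.
  rewrite -[leRHS]mul1r ler_pM ?exprn_ge0 ?invr_ge0 ?(ltW (P0 _)) ?(ltW q0)//.
    by rewrite invf_le1.
  rewrite -exprD ler_wiXn2l ?(ltW q0) ?(ltW q1)//; nia.
rewrite -big_distrr /= -mulrA; apply: ler_wpM2l; first exact: ltW.
apply: ler_wpM2l; first by rewrite exprn_ge0// ltW.
have q01 : 0 <= q < 1 by rewrite ltW.
have := @sum_geometric_le _ q 0 n q01; rewrite big_mkord => /le_trans; apply.
by rewrite expr1 ler_piMl ?invr_ge0 ?ltW// subr_gt0.
Qed.

Lemma theta_bounds t : 0 < t ->
  Num.sqrt pi / 2 - Num.sqrt (t / 2) <= Num.sqrt (t / 2) * theta t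
    <= Num.sqrt (t / 2) + Num.sqrt pi / 2.
Proof.
move=> t0; set h := Num.sqrt (t / 2); have h0 : 0 < h by rewrite sqrtr_gt0 divr_gt0.
have q1 : `|expR (- t)| < 1 by rewrite ger0_norm ?expR_ge0// expR_lt1 oppr_lt0.
have cS : shanks_prod (expR (- t)) n.+1 @[n --> \oo] --> theta t.
  by have := cvg_shanks_prod t0; rewrite -(@cvg_shiftS R (shanks_prod (expR (- t)))).
have cP : h * shanks_prod (expR (- t)) n.+1 @[n --> \oo] --> h * theta t.
  exact: cvgMl_tmp.
apply/andP; split; last first.
  apply: (cvgr_to_le cP); near=> n.
  have /andP[_] := theta_sum_bounds n.+1.*2 t0; apply: le_trans.
  by rewrite ler_pM2l//; have /andP[] := shanks_prod_theta_sum n t0.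
have cI : I (n.+1.*2%:R * h) - h @[n --> \oo] --> Num.sqrt pi / 2 - h.
  apply: cvgB; last exact: cvg_cst.
  apply: (cvg_comp _ _ _ cvg_integral0_gauss).
  apply/cvgryPge => M; near=> n; rewrite -ler_pdivrMr//.
  apply: le_trans (_ : n%:R <= _); first by near: n; exact: nbhs_infty_ger.
  by rewrite ler_nat -addnn; apply: leq_trans (leqnSn _) (leq_addr _ _).
have cR : h * (shanks_prod (expR (- t)) n.+1 * (1 + expR (- t) ^+ n / (1 - expR (- t))))
    @[n --> \oo] --> h * theta t.
  rewrite -[X in _ --> h * X]mulr1; apply: cvgMl_tmp; apply: cvgM => //.
  rewrite -[X in _ --> X]addr0; apply: cvgD; first exact: cvg_cst.
  rewrite -(mul0r (1 - expR (- t))^-1); apply: cvgMr_tmp.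
  exact: cvg_expr.
apply: (ler_cvg_to cI cR); near=> n.
have /andP[+ _] := theta_sum_bounds n.+1.*2 t0; move=> /le_trans; apply.
by rewrite ler_pM2l//; have /andP[] := shanks_prod_theta_sum n t0.
Unshelve. all: by end_near. Qed.

End Theta.

(** * Taylor bounds for sine and cosine *)

Section TrigBounds.
Variable R : realType.
Implicit Types x y : R.

Lemma MVT_is_derive (f df : R -> R) a b : a <= b ->
  (forall y, a <= y <= b -> is_derive y (1 : R) f (df y)) ->
  exists2 c, a <= c <= b & f b - f a = df c * (b - a).
Proof.
move=> ab fd.
have fc : {within `[a, b], continuous f}.
  apply: derivable_within_continuous => y; rewrite in_itv /= => /fd.
  by case.
have fd' y : y \in `]a, b[ -> is_derive y (1 : R) f (df y).
  by rewrite in_itv /= => /andP[/ltW ay /ltW yb]; apply: fd; rewrite ay.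
by have [c + E] := MVT_segment ab fd' fc; rewrite in_itv; exists c.
Qed.

Lemma derive_ge0_le (f df : R -> R) a b : a <= b ->
  (forall y, is_derive y (1 : R) f (df y)) ->
  (forall y, a <= y <= b -> 0 <= df y) -> f a <= f b.
Proof.
move=> ab fd dfge.
have [c cab E] := MVT_is_derive ab (fun y _ => fd y).
by rewrite -subr_ge0 E mulr_ge0 ?subr_ge0// dfge.
Qed.

Lemma sin_le_id x : 0 <= x -> sin x <= x.
Proof.
move=> x0.
have := @derive_ge0_le (fun y => y - sin y) (fun y => 1 - cos y) 0 x x0.
rewrite sin0 !subr0 subr_ge0; apply => y _ /=.
by rewrite subr_ge0 cos_le1.
Qed.

Lemma cos_ge_taylor2 x : 1 - x ^+ 2 / 2 <= cos x.
Proof.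
wlog x0 : x / 0 <= x.
  move=> H; case: (leP 0 x) => [/H//|x0].
  by rewrite -cosN -sqrrN H// oppr_ge0 ltW.
have := @derive_ge0_le (fun y => cos y + y ^+ 2 / 2) (fun y => y - sin y) 0 x x0.
rewrite cos0 expr0n /= mul0r addr0 lerBlDr; apply => y /=.
  have -> : y - sin y = - sin y + 2^-1 *: ((2%:R * y ^+ 1) *: 1).
    by rewrite /GRing.scale /= expr1; field.
  rewrite (_ : (fun _ => _) = cos + (2^-1 \*: (id ^+ 2))); last first.
    by apply/funext => z; rewrite /= /GRing.scale /= mulrC.
  by apply: is_deriveD; apply: is_deriveZ; apply: is_deriveX.
by move=> /andP[y0 _]; rewrite subr_ge0 sin_le_id.
Qed.

Lemma sin_ge_taylor3 x : 0 <= x -> x - x ^+ 3 / 6 <= sin x.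
Proof.
move=> x0.
have := @derive_ge0_le (fun y => (sin y - y) + y ^+ 3 / 6)
  (fun y => cos y - 1 + y ^+ 2 / 2) 0 x x0.
rewrite sin0 expr0n /= mul0r !subr0 addr0.
have -> : (x - x ^+ 3 / 6 <= sin x) = (0 <= sin x - x + x ^+ 3 / 6).
  by apply/idP/idP; lra.
apply => y /=.
  have -> : cos y - 1 + y ^+ 2 / 2 = cos y - 1 + 6^-1 *: ((3%:R * y ^+ 2) *: 1).
    by rewrite /GRing.scale /=; field.
  rewrite (_ : (fun _ => _) = sin - id + (6^-1 \*: (id ^+ 3))); last first.
    by apply/funext => z; rewrite /= /GRing.scale /= [_ / _]mulrC.
  by apply: is_deriveD; apply: is_deriveZ; apply: is_deriveX.
by move=> _; have := cos_ge_taylor2 y; lra.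
Qed.

Lemma cos_le_taylor4 x : cos x <= 1 - x ^+ 2 / 2 + x ^+ 4 / 24.
Proof.
wlog x0 : x / 0 <= x.
  move=> H; case: (leP 0 x) => [/H//|x0].
  by rewrite -cosN -sqrrN -[x ^+ 4](_ : (- x) ^+ 4 = _) ?H ?oppr_ge0 ?ltW//; ring.
have := @derive_ge0_le (fun y => - cos y - y ^+ 2 / 2 + y ^+ 4 / 24)
  (fun y => sin y - y + y ^+ 3 / 6) 0 x x0.
rewrite cos0 !expr0n /= !mul0r subr0 addr0 => H.
have : -1 <= - cos x - x ^+ 2 / 2 + x ^+ 4 / 24; last by lra.
apply: H => y /=.
  have -> : sin y - y + y ^+ 3 / 6 = - (- sin y) - 2^-1 *: ((2%:R * y ^+ 1) *: 1)
      + 24^-1 *: ((4%:R * y ^+ 3) *: 1).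
    by rewrite /GRing.scale /=; field.
  rewrite (_ : (fun _ => _) = - cos - (2^-1 \*: (id ^+ 2)) + (24^-1 \*: (id ^+ 4))); last first.
    by apply/funext => z; rewrite /= /GRing.scale /= ![_ / _]mulrC.
  exact: is_deriveD.
by move=> /andP[y0 _]; have := sin_ge_taylor3 y0; lra.
Qed.

Lemma mul_cos_le_sin x : 0 <= x <= pi -> x * cos x <= sin x.
Proof.
move=> /andP[x0 xpi].
have := @derive_ge0_le (fun y => sin y - y * cos y) (fun y => y * sin y) 0 x x0.
rewrite sin0 mul0r subr0 subr_ge0; apply => y /=.
  have -> : y * sin y = cos y - (y *: (- sin y) + cos y *: 1).
    by rewrite /GRing.scale /=; ring.
  by apply: is_deriveB; apply: is_deriveM.
by move=> /andP[y0 yx]; rewrite mulr_ge0// sin_ge0_pi// y0 (le_trans yx).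
Qed.

End TrigBounds.

(** * The value of $\zeta(2)$ *)

Section Basel.
Variable R : realType.
Implicit Types x : R.

(** The lower bound is $\sin x \le x$. Squaring $x\cos x \le \sin x$ gives $x^2 \le (1+x^2)\sin^2
    x$, which is the upper bound. *)
Lemma inv_sin2_bounds x : 0 < x < pi / 2 ->
  x ^- 2 <= (sin x) ^- 2 <= x ^- 2 + 1.
Proof.
move=> /andP[x0 xpi].
have xpi' : x <= pi by apply: le_trans (ltW xpi) _; have := @pi_ge0 R; lra.
have s0 : 0 < sin x by rewrite sin_gt0_pihalf// x0.
have c0 : 0 <= cos x by rewrite cos_ge0_pihalf// (ltW xpi) andbT; have := @pi_gt0 R; lra.
apply/andP; split.
  by rewrite lef_pV2 ?posrE ?exprn_gt0// ler_sqr ?nnegrE ?(ltW s0) ?(ltW x0)// sin_le_id// ltW.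
have : (x * cos x) ^+ 2 <= sin x ^+ 2.
  rewrite ler_sqr ?nnegrE ?mulr_ge0// ?(ltW x0) ?(ltW s0)//.
  by rewrite mul_cos_le_sin// (ltW x0).
rewrite exprMn cos2sin2 => H.
rewrite -(ler_pM2r (exprn_gt0 2 s0)) mulVf ?expf_neq0 ?gt_eqF//.
rewrite -(ler_pM2l (exprn_gt0 2 x0)) mulr1.
rewrite (_ : x ^+ 2 * _ = sin x ^+ 2 + x ^+ 2 * sin x ^+ 2); first lra.
by field; rewrite gt_eqF.
Qed.

(** The odd multiples of $\pi/2^{m+2}$; those with $k < 2^m$ are the ones in $(0, \pi/2)$. *)
Let ang m k : R := k.*2.+1%:R * pi / (2 ^ m.+2)%:R.

Let ang_itv m k : (k < 2 ^ m)%N -> 0 < ang m k < pi / 2.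
Proof.
move=> km; have p0 := @pi_gt0 R; rewrite /ang divr_gt0 ?mulr_gt0 ?ltr0n ?expn_gt0//=.
rewrite ltr_pdivrMr ?ltr0n ?expn_gt0// mulrC -mulrA ltr_pM2l//.
rewrite -(ltr_pM2l (_ : 0 < 2)) // mulrA divff// mul1r -natrM ltr_nat !expnS; lia.
Qed.

(* By 1 / sin(x)^2 + 1 / sin(pi/2 - x)^2 = 4 / sin(2x)^2. *)
Lemma sum_inv_sin2 m : \sum_(k < 2 ^ m) (sin (ang m k)) ^- 2 = 2 * 4 ^+ m.
Proof.
elim: m => [|m IHm].
  rewrite expn0 big_ord1 /ang mul1r expr0 mulr1.
  have -> : pi / (2 ^ 2)%:R = pi / 2 / 2 :> R by field.
  have := @cos_mulr2n R (pi / 2 / 2); have -> : (pi / 2 / 2) *+ 2 = pi / 2 :> R by rewrite -mulr_natr divfK.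
  rewrite cos_pihalf cos2sin2 -mulr_natr.
  move=> H; have -> : sin (pi / 2 / 2) ^+ 2 = 2^-1 :> R by lra.
  by rewrite invrK.
rewrite expnS mul2n -addnn big_split_ord /=.
rewrite [X in _ + X](reindex_inj rev_ord_inj) /= -big_split /=.
rewrite [4 ^+ m.+1]exprS mulrCA -IHm big_distrr /=; apply: eq_bigr => k _.
have km : (k < 2 ^ m)%N by [].
have E1 : ang m k = ang m.+1 k *+ 2.
  rewrite /ang -mulr_natr [in RHS]expnS natrM.
  by field; rewrite pnatr_eq0 expn_eq0.
have E2 : ang m.+1 (2 ^ m + (2 ^ m - k.+1)) = pi / 2 - ang m.+1 k.
  rewrite /ang.
  have -> : ((2 ^ m + (2 ^ m - k.+1)).*2.+1 = 2 ^ m.+2 - k.*2.+1)%N.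
    by rewrite !expnS; lia.
  rewrite natrB; last by rewrite !expnS; lia.
  rewrite [in LHS]expnS [in X in _ = _ - X]expnS !natrM.
  by field; rewrite pnatr_eq0 expn_eq0.
rewrite E2 E1.
have -> : sin (pi / 2 - ang m.+1 k) = cos (ang m.+1 k).
  by rewrite addrC sinDpihalf cosN.
have /andP[a0 a1] : 0 < ang m.+1 k < pi / 2.
  by apply: ang_itv; rewrite expnS mul2n -addnn ltn_addr.
have s0 : 0 < sin (ang m.+1 k) by rewrite sin_gt0_pihalf// a0.
have c0 : 0 < cos (ang m.+1 k).
  by rewrite cos_gt0_pihalf// a1 andbT (lt_trans _ a0)// oppr_lt0 divr_gt0// pi_gt0.
rewrite sin_mulr2n; have := cos2Dsin2 (ang m.+1 k).
move: (sin _) (cos _) s0 c0 => s c s0 c0 sc.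
have -> : (c * s) *+ 2 = 2 * (c * s) by rewrite mulr_natl.
transitivity ((c ^+ 2 + s ^+ 2) / (c * s) ^+ 2).
  by field; rewrite !gt_eqF.
by rewrite sc; field; rewrite !gt_eqF.
Qed.

Definition odd_sum N : R := \sum_(k < N) (k.*2.+1%:R) ^- 2.

(** Replacing each $1/\sin^2$ by $1/x^2$ in [sum_inv_sin2] costs at most 1 per angle, hence $2^m$
    against a total of $2\cdot4^m$. *)
Lemma odd_sum_bounds m :
  odd_sum (2 ^ m) <= pi ^+ 2 / 8 <= odd_sum (2 ^ m) + pi ^+ 2 / 16 * (2 ^- m).
Proof.
have p0 := @pi_gt0 R.
have e : 4 ^+ m = 2 ^+ m * 2 ^+ m :> R by rewrite -exprMn; congr (_ ^+ _); lra.
have E : \sum_(k < 2 ^ m) (ang m k) ^- 2 = 16 / pi ^+ 2 * 4 ^+ m * odd_sum (2 ^ m).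
  rewrite /odd_sum big_distrr /=; apply: eq_bigr => k _.
  have w : (2 ^ m.+2)%:R = 4 * 2 ^+ m :> R by rewrite !expnS !natrM natrX; ring.
  have k0 : k.*2.+1%:R != 0 :> R by rewrite pnatr_eq0.
  have q0 : 2 ^+ m != 0 :> R by rewrite expf_neq0.
  have p1 : pi != 0 :> R by rewrite gt_eqF.
  by rewrite /ang w e; move: k0 q0 p1; move: (_%:R) (2 ^+ m) pi => c q p k0 q0 p1; field; rewrite k0 q0 p1.
have L : 16 / pi ^+ 2 * 4 ^+ m * odd_sum (2 ^ m) <= 2 * 4 ^+ m.
  rewrite -E -sum_inv_sin2; apply: ler_sum => k _.
  by have /andP[] := inv_sin2_bounds (ang_itv (ltn_ord k)).
have U : 2 * 4 ^+ m <= 16 / pi ^+ 2 * 4 ^+ m * odd_sum (2 ^ m) + 2 ^+ m.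
  rewrite -E -sum_inv_sin2.
  have -> : 2 ^+ m = \sum_(k < 2 ^ m) 1 :> R.
    by rewrite sumr_const card_ord natrX.
  rewrite -big_split /=; apply: ler_sum => k _.
  by have /andP[] := inv_sin2_bounds (ang_itv (ltn_ord k)).
have q0 : 0 < 2 ^+ m :> R by rewrite exprn_gt0.
have pp0 : 0 < pi ^+ 2 :> R by rewrite exprn_gt0.
move: L U; rewrite e; set O := odd_sum _; move: (2 ^+ m) q0 (pi ^+ 2) pp0 => q q0 p pp0 L U.
have eO : 16 / p * (q * q) * O = (16 * O) / p * (q * q) by field; rewrite gt_eqF.
rewrite !eO in L U; apply/andP; split.
  move: L; rewrite ler_pM2r ?mulr_gt0// ler_pdivrMr// => L; lra.
have : 2 <= 16 * O / p + q^-1.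
  rewrite -(ler_pM2r (mulr_gt0 q0 q0)); apply: le_trans U _.
  by rewrite le_eqVlt; apply/orP; left; apply/eqP; field; rewrite !gt_eqF.
rewrite -(ler_pM2r pp0) (_ : (16 * O / p + q^-1) * p = 16 * O + q^-1 * p :> R) => [H|]; last first.
  by field; rewrite !gt_eqF.
have -> : p / 16 * q^-1 = (q^-1 * p) / 16 by ring.
lra.
Qed.

Lemma nondecreasing_odd_sum : nondecreasing_seq odd_sum.
Proof.
apply/nondecreasing_seqP => n.
by rewrite /odd_sum big_ord_recr /= lerDl invr_ge0 exprn_ge0.
Qed.

Lemma cvg_odd_sum : odd_sum n @[n --> \oo] --> pi ^+ 2 / 8.
Proof.
have ub n : odd_sum n <= pi ^+ 2 / 8.
  have /andP[+ _] := odd_sum_bounds n; apply: le_trans.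
  by apply: nondecreasing_odd_sum; rewrite ltnW// ltn_expl.
apply/cvgrPdist_le => e e0.
have c : pi ^+ 2 / 16 * 2 ^- m @[m --> \oo] --> (0 : R).
  rewrite -(mulr0 (pi ^+ 2 / 16)); apply: cvgMl_tmp.
  under eq_fun do rewrite -exprVn.
  by apply: cvg_expr; rewrite ger0_norm// invf_lt1// ltr1n.
have /cvgrPdist_le/(_ _ e0)[m _ /(_ m (leqnn m))] := c.
rewrite sub0r normrN => /(le_trans (ler_norm _)) mP.
near=> n; rewrite ger0_norm ?subr_ge0// lerBlDr.
have /andP[_ H] := odd_sum_bounds m; apply: le_trans H _.
rewrite addrC; apply: lerD => //; apply: nondecreasing_odd_sum.
by near: n; exact: nbhs_infty_ge.
Unshelve. all: by end_near. Qed.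

Definition zeta2_sum N : R := \sum_(k < N) (k.+1%:R) ^- 2.

Lemma zeta2_sum_double n : zeta2_sum n.*2 = odd_sum n + zeta2_sum n / 4.
Proof.
elim: n => [|n IHn]; first by rewrite /zeta2_sum /odd_sum !big_ord0 mul0r addr0.
rewrite doubleS /zeta2_sum /odd_sum !big_ord_recr /= -/(zeta2_sum _) IHn.
rewrite -/(odd_sum _) -/(zeta2_sum _).
have -> : n.*2.+2%:R = 2 * n.+1%:R :> R by rewrite -natrM mul2n doubleS.
have n0 : n.+1%:R != 0 :> R by rewrite pnatr_eq0.
have n1 : n.*2.+1%:R != 0 :> R by rewrite pnatr_eq0.
by move: n0 n1; move: (n.+1%:R) (n.*2.+1%:R) => c d n0 n1; field; rewrite n0 n1.
Qed.

(** Separating odd and even indices, the limit $l$ satisfies $l = \pi^2/8 + l/4$. *)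
Lemma cvg_zeta2_sum : zeta2_sum n @[n --> \oo] --> pi ^+ 2 / 6.
Proof.
have nd : nondecreasing_seq zeta2_sum.
  apply/nondecreasing_seqP => n.
  by rewrite /zeta2_sum big_ord_recr /= lerDl invr_ge0 exprn_ge0.
have ub n : zeta2_sum n <= pi ^+ 2 / 6.
  have h1 : zeta2_sum n <= zeta2_sum n.*2 by apply: nd; rewrite -addnn leq_addr.
  have h2 : odd_sum n <= pi ^+ 2 / 8.
    have /andP[+ _] := odd_sum_bounds n; apply: le_trans.
    by apply: nondecreasing_odd_sum; rewrite ltnW// ltn_expl.
  have := zeta2_sum_double n; lra.
have : cvgn zeta2_sum.
  by apply: nondecreasing_is_cvgn => //; exists (pi ^+ 2 / 6) => _ [n _ <-].
move=> /cvg_ex[/= l cl].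
suff -> : pi ^+ 2 / 6 = l by [].
have dc : n.*2 @[n --> \oo] --> \oo.
  apply/cvgnyPge => M; near=> n; rewrite -addnn (leq_trans _ (leq_addr _ _))//.
  by near: n; exact: nbhs_infty_ge.
have c1 := cvg_comp _ _ dc cl.
have c2 : odd_sum n + zeta2_sum n / 4 @[n --> \oo] --> pi ^+ 2 / 8 + l / 4.
  by apply: cvgD; [exact: cvg_odd_sum|exact: cvgMr_tmp].
have : l = pi ^+ 2 / 8 + l / 4.
  move: c2; under eq_fun do rewrite -zeta2_sum_double.
  by move=> c2; exact: (cvg_unique _ c1 c2).
lra.
Unshelve. all: by end_near. Qed.

End Basel.

(** * Expansion of $\ln P(e^{-t})$ as $t \to 0^+$ *)

Section LogPartitionAsymptotics.
Variable R : realType.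
Implicit Types (x t : R) (N K : nat).

(** The remainder of the series vanishes at 0 and has derivative $z^K/(1-z)$, which is nonnegative
    and largest at $z = y$. *)
Lemma ln_series_bounds (y : R) K : 0 <= y < 1 ->
  \sum_(k < K) y ^+ k.+1 / k.+1%:R <= - ln (1 - y)
    <= \sum_(k < K) y ^+ k.+1 / k.+1%:R + y ^+ K.+1 / (1 - y).
Proof.
move=> /andP[y0 y1]; have y1' : 0 < 1 - y by rewrite subr_gt0.
pose f := - ((@ln R) \o (cst 1 - id)) - \sum_(k < K) (k.+1%:R^-1 \*: (id ^+ k.+1)) : R -> R.
have fE z : f z = - ln (1 - z) - \sum_(k < K) z ^+ k.+1 / k.+1%:R.
  rewrite /f /= fct_sumE; congr (_ - _); apply: eq_bigr => k _.
  by rewrite exprfctE /GRing.scale /= mulrC.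
have df z : 0 <= z <= y -> is_derive z (1 : R) f (z ^+ K / (1 - z)).
  move=> /andP[z0 zy]; have z1 : 0 < 1 - z by rewrite subr_gt0 (le_lt_trans zy).
  have -> : z ^+ K / (1 - z) =
     - ((1 - z)^-1 * (0 - 1)) - \sum_(k < K) k.+1%:R^-1 *: ((k.+1%:R * z ^+ k) *: 1).
    have -> : \sum_(k < K) k.+1%:R^-1 *: ((k.+1%:R * z ^+ k) *: 1) = \sum_(k < K) z ^+ k.
      apply: eq_bigr => k _; rewrite /GRing.scale /= mulr1 mulKf//.
    have := subrX1 z K; set S := \sum_(i < K) _ => H.
    have -> : z ^+ K = 1 + (z - 1) * S by rewrite -H addrC subrK.
    by field; rewrite gt_eqF.
  rewrite /f; apply: is_deriveB.
  apply: is_deriveN.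
  have d1 : is_derive z (1 : R) (cst 1 - id : R -> R) (0 - 1) by exact: is_deriveB.
  have d2 := is_derive1_ln z1.
  exact (@is_derive1_comp R (@ln R) (cst 1 - id) z _ _ d2 d1).
have [c /andP[c0 cy]] := MVT_is_derive y0 df.
have f0 : f 0 = 0.
  rewrite fE subr0 ln1 oppr0 sub0r big1 ?oppr0// => k _.
  by rewrite expr0n mul0r.
rewrite f0 fE !subr0 => E.
have c1 : 0 < 1 - c by rewrite subr_gt0 (le_lt_trans cy).
apply/andP; split.
  by rewrite -subr_ge0 E mulr_ge0// divr_ge0 ?exprn_ge0// ltW.
rewrite -lerBlDl E exprSr [leRHS]mulrAC; apply: ler_wpM2r => //.
apply: ler_pM; rewrite ?exprn_ge0 ?invr_ge0 ?(ltW c1)//.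
  by rewrite lerXn2r ?nnegrE.
by rewrite lef_pV2 ?posrE// lerD2l lerN2.
Qed.

Lemma bose_le x : 0 < x -> expR (- x) / (1 - expR (- x)) <= x^-1.
Proof.
move=> x0; rewrite ler_pdivrMr ?expRN_lt1// mulrC ler_pdivlMr//.
rewrite expRN -[X in X - _](@divff _ (expR x)) ?gt_eqF ?expR_gt0// -{3}[_^-1]mul1r -mulrBl.
rewrite mulrC ler_wpM2r ?invr_ge0 ?expR_ge0// lerBrDl.
exact: expR_ge1Dx.
Qed.

Lemma bose_ge x : 0 < x -> x^-1 - 1 <= expR (- x) / (1 - expR (- x)).
Proof.
move=> x0; rewrite ler_pdivlMr ?expRN_lt1//.
have h1 : 1 - expR (- x) <= x by have := expR_ge1Dx (- x); lra.
have h2 : 0 <= 1 - expR (- x) by rewrite ltW// expRN_lt1.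
have h3 : x^-1 * (1 - expR (- x)) <= 1 by rewrite mulrC ler_pdivrMr ?mul1r.
rewrite mulrBl mul1r; lra.
Qed.

(** Expanding the logarithms and exchanging the sums gives $\ln P(e^{-t}) = \sum_k 1/(k(e^{kt}-1))$,
    and $1/(e^{kt}-1) \le 1/(kt)$. The exchange is done on finite sums, [K] tending to infinity
    before [N]. *)
Lemma lnP_le t : 0 < t -> lnP t <= pi ^+ 2 / 6 / t.
Proof.
move=> t0; apply: (cvgr_to_le (cvg_lnP_trunc t0)); near=> N.
have q1 : expR (- t) < 1 by rewrite expR_lt1 oppr_lt0.
have c : pi ^+ 2 / 6 / t + N%:R * (expR (- t) ^+ K.+1 / (1 - expR (- t))) @[K --> \oo]
    --> pi ^+ 2 / 6 / t + N%:R * (0 * expR (- t) / (1 - expR (- t))).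
  apply: cvgD; first exact: cvg_cst.
  apply: cvgMl_tmp; apply: cvgMr_tmp; under eq_fun do rewrite exprSr.
  by apply: cvgMr_tmp; apply: cvg_expr; rewrite ger0_norm ?expR_ge0.
rewrite -[leRHS]addr0 -(mulr0 N%:R) -(mul0r (1 - expR (- t))^-1) -[X in X / (1 - _)](mul0r (expR (- t))).
apply: (cvgr_to_ge c); near=> K.
have E (x : R) : 0 < x -> 0 <= expR (- x) < 1 by move=> x0; rewrite expR_ge0 expR_lt1 oppr_lt0.
have m0 (m : nat) : 0 < m.+1%:R * t by rewrite mulr_gt0.
have -> : N%:R = \sum_(m < N) 1 :> R by rewrite sumr_const card_ord.
rewrite big_distrl /=.
apply: (@le_trans _ _ (\sum_(m < N) (\sum_(k < K) expR (- (m.+1%:R * t)) ^+ k.+1 / k.+1%:R +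
    expR (- t) ^+ K.+1 / (1 - expR (- t))))).
  apply: ler_sum => m _.
  have /andP[_ H] := ln_series_bounds K (E _ (m0 m)).
  apply: le_trans H _; rewrite lerD2l.
  have h : expR (- (m.+1%:R * t)) <= expR (- t).
    by rewrite ler_expR lerN2 ler_peMl ?ler1n// ltW.
  apply: ler_pM; rewrite ?exprn_ge0 ?expR_ge0 ?invr_ge0 ?(ltW (expRN_lt1 _))//.
    by rewrite lerXn2r ?nnegrE ?expR_ge0.
  by rewrite lef_pV2 ?posrE ?expRN_lt1// lerD2l lerN2.
rewrite big_split /=; under [X in _ <= _ + X]eq_bigr do rewrite mul1r.
rewrite lerD2r exchange_big /=.
apply: (@le_trans _ _ (zeta2_sum R K / t)); last first.
  rewrite ler_pM2r ?invr_gt0//.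
  apply: (cvgr_to_ge (@cvg_zeta2_sum R)); near=> n.
  rewrite /zeta2_sum -!(big_mkord xpredT (fun k => k.+1%:R ^- 2)).
  have Kn : (K <= n)%N by near: n; exact: nbhs_infty_ge.
  by rewrite [leRHS](big_cat_nat (leq0n K) Kn)/= lerDl sumr_ge0.
rewrite /zeta2_sum big_distrl /=; apply: ler_sum => k _.
rewrite -big_distrl /= expr2 invfM -mulrA mulrC ler_wpM2l ?invr_ge0//.
rewrite -invfM; apply: le_trans (bose_le (m0 k)).
have := @sum_geometric_le _ _ 0 N (E _ (m0 k)); rewrite big_mkord expr1; apply: le_trans.
apply: ler_sum => m _; rewrite -!expRM_natl ler_expR !mulrN lerN2.
by rewrite !mulrA [k.+1%:R * _]mulrC.
Unshelve. all: by end_near. Qed.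

(** In the same double sum only [K] values of $k$ are kept; $1/(e^{kt}-1) \ge 1/(kt) - 1$ then loses
    at most 1 for each. *)
Lemma lnP_ge K t : 0 < t -> zeta2_sum R K / t - K%:R <= lnP t.
Proof.
move=> t0.
have E (x : R) : 0 < x -> 0 <= expR (- x) < 1 by move=> x0; rewrite expR_ge0 expR_lt1 oppr_lt0.
have m0 (m : nat) : 0 < m.+1%:R * t by rewrite mulr_gt0.
have H N : \sum_(k < K) (\sum_(m < N) expR (- (k.+1%:R * t)) ^+ m.+1) / k.+1%:R <= lnP t.
  apply: le_trans (lnP_trunc_le N t0).
  under eq_bigr do rewrite big_distrl /=.
  rewrite exchange_big /=; apply: ler_sum => m _.
  have /andP[+ _] := ln_series_bounds K (E _ (m0 m)); apply: le_trans.
  apply: ler_sum => k _; rewrite ler_pM2r ?invr_gt0// -!expRM_natl ler_expR !mulrN lerN2.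
  by rewrite !mulrA [k.+1%:R * _]mulrC.
have c : \sum_(k < K) (\sum_(m < N) expR (- (k.+1%:R * t)) ^+ m.+1) / k.+1%:R @[N --> \oo] -->
    \sum_(k < K) (expR (- (k.+1%:R * t)) / (1 - expR (- (k.+1%:R * t)))) / k.+1%:R.
  apply: cvg_big => [|k _]; first exact: add_continuous.
  apply: cvgMr_tmp.
  have /andP[e0 e1] := E _ (m0 k).
  have := @cvg_geometric_series R (expR (- (k.+1%:R * t))) (expR (- (k.+1%:R * t))).
  rewrite ger0_norm// => /(_ e1); apply: cvg_trans.
  apply: near_eq_cvg; near=> n; rewrite /series /= big_mkord.
  by apply: eq_bigr => m _; rewrite /geometric /= exprS.
have {H} : \sum_(k < K) (expR (- (k.+1%:R * t)) / (1 - expR (- (k.+1%:R * t)))) / k.+1%:R <= lnP t.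
  by apply: (cvgr_to_le c); near=> N; exact: H.
apply: le_trans.
have -> : K%:R = \sum_(k < K) 1 :> R by rewrite sumr_const card_ord.
rewrite /zeta2_sum big_distrl -sumrB /=; apply: ler_sum => k _.
apply: (@le_trans _ _ (((k.+1%:R * t)^-1 - 1) / k.+1%:R)).
  rewrite mulrBl mul1r expr2 !invfM -!mulrA [t^-1 * _]mulrC lerD2l lerN2.
  by rewrite invf_le1 ?ler1n.
by rewrite ler_pM2r ?invr_gt0// bose_ge.
Unshelve. all: by end_near. Qed.

Lemma cvg_mul_lnP : t * lnP t @[t --> (0 : R)^'+] --> pi ^+ 2 / 6.
Proof.
apply/cvgrPdist_le => e e0.
have e2 : 0 < e / 2 by rewrite divr_gt0.
have /cvgrPdist_le/(_ _ e2)[K _ /(_ K (leqnn K)) HK] := @cvg_zeta2_sum R.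
near=> t.
have t0 : 0 < t by near: t; exact: nbhs_right_gt.
have h1 : t * lnP t <= pi ^+ 2 / 6.
  by rewrite mulrC -ler_pdivlMr// lnP_le.
rewrite ger0_norm ?subr_ge0// lerBlDr.
have h2 : zeta2_sum R K - K%:R * t <= t * lnP t.
  have := lnP_ge K t0; rewrite -(ler_pM2l t0); apply: le_trans.
  rewrite (_ : t * (_ - _) = zeta2_sum R K - K%:R * t)//.
  by field; rewrite gt_eqF.
have h3 : K%:R * t <= e / 2.
  have : t <= e / 2 / K.+1%:R.
    by near: t; apply: nbhs_right_le; rewrite divr_gt0.
  rewrite ler_pdivlMr// mulrC; apply: le_trans.
  by rewrite ler_pM2r// ler_nat.
have := le_trans (ler_norm _) HK; lra.
Unshelve. all: by end_near. Qed.

(** The expansion removed from [lnP] is $\pi^2/(6t) + \frac12\ln(t/(2\pi))$, as predicted by the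
    modular transformation of the eta function. *)
Definition lnP_error t : R :=
  lnP t - pi ^+ 2 / 6 / t - ln t / 2 + ln (2 * pi) / 2.

Lemma cvg_mul_ln : t * ln t @[t --> (0 : R)^'+] --> (0 : R).
Proof.
apply/cvgrPdist_le => e e0; near=> t; rewrite sub0r normrN.
have t0 : 0 < t by near: t; exact: nbhs_right_gt.
have t1 : t <= 1 by near: t; exact: nbhs_right_le.
have te : t <= (e / 2) ^+ 2.
  by near: t; apply: nbhs_right_le; rewrite exprn_gt0// divr_gt0.
have s0 : 0 < Num.sqrt t by rewrite sqrtr_gt0.
have ts : t = Num.sqrt t * Num.sqrt t by rewrite -expr2 sqr_sqrtr// ltW.
have se : Num.sqrt t <= e / 2.
  rewrite -[leRHS]ger0_norm ?divr_ge0// ?(ltW e0)// -sqrtr_sqr.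
  by rewrite ler_wsqrtr.
rewrite normrM (gtr0_norm t0) ler0_norm ?ln_le0//.
have : - ln (Num.sqrt t) < (Num.sqrt t)^-1.
  by rewrite -lnV ?posrE// ln_sublinear// invr_gt0.
have h : t / Num.sqrt t = Num.sqrt t by rewrite {1}ts mulfK ?gt_eqF.
rewrite -(ltr_pM2l t0) h => H.
have -> : ln t = 2 * ln (Num.sqrt t).
  by rewrite {1}ts lnM ?posrE//; ring.
lra.
Unshelve. all: by end_near. Qed.

(** This excludes an error of the form $C/t$, which [cvg_lnP_error_double] cannot detect. *)
Lemma cvg_mul_lnP_error : t * lnP_error t @[t --> (0 : R)^'+] --> (0 : R).
Proof.
have c : t * lnP t - pi ^+ 2 / 6 - t * ln t / 2 + t * (ln (2 * pi) / 2) @[t --> (0 : R)^'+] -->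
   (pi ^+ 2 / 6 - pi ^+ 2 / 6 - 0 / 2 + 0 * (ln (2 * pi) / 2) : R).
  apply: cvgD; last first.
    by apply: cvgMr_tmp; apply: cvg_at_right_filter; exact: cvg_id.
  apply: cvgB; last by apply: cvgMr_tmp; exact: cvg_mul_ln.
  by apply: cvgB; [exact: cvg_mul_lnP|exact: cvg_cst].
move: c; rewrite subrr !mul0r subr0 addr0; apply: cvg_trans.
apply: near_eq_cvg; near=> t.
have t0 : 0 < t by near: t; exact: nbhs_right_gt.
by rewrite /lnP_error; field; rewrite gt_eqF.
Unshelve. all: by end_near. Qed.

Lemma cvg_sqrt_theta : Num.sqrt (t / 2) * theta t @[t --> (0 : R)^'+] --> (Num.sqrt pi / 2 : R).
Proof.
have c0 : Num.sqrt (t / 2) @[t --> (0 : R)^'+] --> (0 : R).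
  rewrite -[X in _ --> X](@sqrtr0 R); apply: continuous_cvg; first exact: sqrt_continuous.
  rewrite -[X in _ --> X](mul0r (2^-1)); apply: cvgMr_tmp.
  by apply: cvg_at_right_filter; exact: cvg_id.
apply: (@squeeze_cvgr _ _ _ _ (fun t => Num.sqrt pi / 2 - Num.sqrt (t / 2))
  (fun t => Num.sqrt (t / 2) + Num.sqrt pi / 2)).
- near=> t; apply: theta_bounds; near: t; exact: nbhs_right_gt.
- by rewrite -[X in _ --> X]subr0; apply: cvgB => //; exact: cvg_cst.
- by rewrite -[X in _ --> X]add0r; apply: cvgD => //; exact: cvg_cst.
Unshelve. all: by end_near. Qed.

(** The terms in $1/t$ cancel, and what remains is the logarithm of $\sqrt{t/2}$ times [theta t],
    divided by its limit $\sqrt\pi/2$. This match is what determines the constant $\ln(2\pi)/2$. *)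
Lemma cvg_lnP_error_double : lnP_error t - 2 * lnP_error (2 * t) @[t --> (0 : R)^'+] --> (0 : R).
Proof.
have p0 := @pi_gt0 R.
have l0 : 0 < Num.sqrt pi / 2 :> R by rewrite divr_gt0// sqrtr_gt0.
have c : ln (Num.sqrt (t / 2) * theta t) - ln (Num.sqrt pi / 2) @[t --> (0 : R)^'+] --> (0 : R).
  rewrite -[X in _ --> X](subrr (ln (Num.sqrt pi / 2))); apply: cvgB; last exact: cvg_cst.
  apply: continuous_cvg; last exact: cvg_sqrt_theta.
  exact: continuous_ln.
move: c; apply: cvg_trans; apply: near_eq_cvg; near=> t.
have t0 : 0 < t by near: t; exact: nbhs_right_gt.
have lns x : 0 < x -> ln (Num.sqrt x) = ln x / 2.
  move=> x0; have E : ln x = ln (Num.sqrt x) *+ 2.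
    by rewrite -lnXn ?sqrtr_gt0// sqr_sqrtr// ltW.
  by rewrite E; lra.
rewrite lnM ?posrE ?sqrtr_gt0 ?expR_gt0 ?divr_gt0// /theta expRK.
rewrite !lns ?divr_gt0// ln_div ?posrE// ln_div ?posrE ?sqrtr_gt0// lns//.
rewrite /lnP_error !lnM ?posrE//; field; rewrite gt_eqF//.
Unshelve. all: by end_near. Qed.

(* Telescoping [t |-> t * lnP_error t] over [t, t / 2, t / 4, ...] upgrades the
   leading-order estimate to an error tending to 0. *)
Lemma cvg_lnP_error : lnP_error t @[t --> (0 : R)^'+] --> (0 : R).
Proof.
apply/cvgrPdist_le => e e0.
have /cvgrPdist_le/(_ _ e0) [d /= d0 Hd] := cvg_lnP_error_double.
near=> t; rewrite sub0r normrN.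
have t0 : 0 < t by near: t; exact: nbhs_right_gt.
have td : t < d by near: t; exact: nbhs_right_lt.
have p2 J : 0 < 2 ^- J :> R by rewrite invr_gt0 exprn_gt0.
have step J : `|t * lnP_error t| <=
    `|(t * 2 ^- J) * lnP_error (t * 2 ^- J)| + t * e * (1 - 2 ^- J).
  elim: J => [|J IHJ]; first by rewrite expr0 invr1 !mulr1 subrr mulr0 addr0.
  apply: le_trans IHJ _.
  set s := t * 2 ^- J.+1.
  have s0 : 0 < s by rewrite mulr_gt0.
  have ss : t * 2 ^- J = 2 * s.
    by rewrite /s exprS; field; rewrite expf_neq0.
  have sd : s < d.
    apply: le_lt_trans td; rewrite /s ler_piMr ?(ltW t0)// invf_le1 ?exprn_gt0//.
    by rewrite exprn_ege1// ler1n.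
  have := Hd s; rewrite /= sub0r normrN (gtr0_norm s0) => /(_ sd s0).
  rewrite sub0r normrN => H.
  have -> : 2 ^- J.+1 = 2 ^- J / 2 :> R by rewrite exprSr invfM.
  have -> : t * e * (1 - 2 ^- J / 2) = t * e * (1 - 2 ^- J) + s * e.
    rewrite /s exprSr invfM; field; rewrite gt_eqF// exprn_gt0//.
  rewrite ss addrA [leRHS]addrAC lerD2r.
  have -> : 2 * s * lnP_error (2 * s) = s * lnP_error s - s * (lnP_error s - 2 * lnP_error (2 * s)).
    by ring.
  apply: le_trans (ler_normB _ _) _; rewrite lerD2l normrM (gtr0_norm s0).
  by rewrite ler_pM2l.
have c : `|(t * 2 ^- J) * lnP_error (t * 2 ^- J)| + t * e * (1 - 2 ^- J) @[J --> \oo]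
   --> `|0 : R| + t * e * (1 - 0).
  have c0 : 2 ^- J @[J --> \oo] --> (0 : R).
    under eq_fun do rewrite -exprVn.
    by apply: cvg_expr; rewrite ger0_norm// invf_lt1// ltr1n.
  apply: cvgD; last by apply: cvgMl_tmp; apply: cvgB => //; exact: cvg_cst.
  apply: cvg_norm.
  have tc : (fun J => t * 2 ^- J) @ \oo --> (0 : R).
    by rewrite -(mulr0 t); apply: cvgMl_tmp.
  have /cvg_at_rightP H := cvg_mul_lnP_error.
  by apply: (H (fun J => t * 2 ^- J)); split => // J; rewrite mulr_gt0.
rewrite normr0 add0r subr0 mulr1 in c.
rewrite -(ler_pM2l t0) -{1}(gtr0_norm t0) -normrM.
by apply: (cvgr_to_ge c); near=> J; exact: step.
Unshelve. all: by end_near. Qed.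

End LogPartitionAsymptotics.

(** * Moments at the saddle point *)

Section Subgradient.
Variable R : realType.

(* A sequence of slopes supported from above by functions converging to one
   with a vanishing derivative at 0 must tend to 0. *)
Lemma subgradient_cvg0 (h : nat -> R -> R) (d : nat -> R) (g : R -> R) (r K : R) :
  0 < r -> 0 < K ->
  (forall x, `|x| < r -> h n x @[n --> \oo] --> g x) ->
  (forall x, `|x| < r -> \forall n \near \oo, d n * x <= h n x) ->
  (forall x, `|x| < r -> g x <= K * x ^+ 2) ->
  d n @[n --> \oo] --> (0 : R).
Proof.
move=> r0 K0 hg dh gK; apply/cvgrPdist_le => e e0.
pose x := Num.min (r / 2) (e / (2 * K)).
have x0 : 0 < x by rewrite lt_min !divr_gt0// mulr_gt0.
have xr : `|x| < r.
  rewrite gtr0_norm// gt_min; apply/orP; left; lra.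
have xe : K * x <= e / 2.
  rewrite mulrC -ler_pdivlMr// ge_min; apply/orP; right.
  by rewrite le_eqVlt; apply/orP; left; apply/eqP; field; rewrite gt_eqF.
have Nxr : `|- x| < r by rewrite normrN.
have ex : 0 < e / 2 * x by rewrite mulr_gt0// divr_gt0.
have /cvgrPdist_le/(_ _ ex) H1 := hg x xr.
have /cvgrPdist_le/(_ _ ex) H2 := hg (- x) Nxr.
have D1 := dh x xr; have D2 := dh (- x) Nxr.
near=> n; rewrite sub0r normrN.
have h1 : d n * x <= e * x.
  have : d n * x <= h n x by near: n.
  have : `|g x - h n x| <= e / 2 * x by near: n.
  rewrite ler_norml => /andP[+ _].
  have := gK x xr; rewrite expr2 mulrA.
  have : K * x * x <= e / 2 * x by rewrite ler_pM2r.
  lra.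
have h2 : - d n * x <= e * x.
  have : d n * (- x) <= h n (- x) by near: n.
  have : `|g (- x) - h n (- x)| <= e / 2 * x by near: n.
  rewrite ler_norml => /andP[+ _].
  have := gK (- x) Nxr; rewrite sqrrN expr2 mulrA.
  have : K * x * x <= e / 2 * x by rewrite ler_pM2r.
  lra.
rewrite ler_norml; apply/andP; split.
  by rewrite lerNl -(ler_pM2r x0).
by rewrite -(ler_pM2r x0).
Unshelve. all: by end_near. Qed.

End Subgradient.

Section Moments.
Variable R : realType.
Implicit Types (x y t : R).

(** The Bose-Einstein function $1/(e^x-1)$: minus the derivative of [lnP_term], and the mean of a
    geometric variable of ratio $e^{-x}$. Minus its own derivative is the variance $b(1+b)$ of that
    variable. *)
Definition bose x : R := expR (- x) / (1 - expR (- x)).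

Lemma bose_gt0 x : 0 < x -> 0 < bose x.
Proof. by move=> x0; rewrite divr_gt0 ?expR_gt0// expRN_lt1. Qed.

Lemma boseE x : 0 < x -> bose x = (expR x - 1)^-1.
Proof.
move=> x0; have e1 : 0 < expR x - 1 by rewrite subr_gt0 expR_gt1.
rewrite /bose expRN; have := expR_gt0 x; move: (expR x) e1 => e e1 e0.
by field; rewrite !gt_eqF.
Qed.

(** Convexity of [lnP_term] as a tangent inequality, obtained from $1+z \le e^z$ and $\ln(1+z) \le
    z$. *)
Lemma lnP_term_subgradient x y : 0 < x -> 0 < y ->
  - (bose x) * (y - x) <= lnP_term y - lnP_term x.
Proof.
move=> x0 y0; have px := expRN_lt1 x0; have py := expRN_lt1 y0.
have h : expR (- x) * (1 + (x - y)) <= expR (- y).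
  rewrite -[in leRHS](_ : - x + (x - y) = - y); last by ring.
  by rewrite expRD ler_pM2l ?expR_gt0// expR_ge1Dx.
have h1 : ln (1 - expR (- y)) - ln (1 - expR (- x)) <=
    (1 - expR (- y)) / (1 - expR (- x)) - 1.
  rewrite -ln_div ?posrE// -[X in ln X](subrK 1) addrC; apply: le_ln1Dx.
  by rewrite ltrBrDr addrC subrr divr_gt0.
have h2 : (1 - expR (- y)) / (1 - expR (- x)) - 1 <= bose x * (y - x).
  have -> : (1 - expR (- y)) / (1 - expR (- x)) - 1 =
      (expR (- x) - expR (- y)) / (1 - expR (- x)) by field; rewrite gt_eqF.
  rewrite /bose mulrAC ler_pM2r ?invr_gt0//; lra.
rewrite /lnP_term; lra.
Qed.

Lemma bose_subgradient x y : 0 < x -> 0 < y ->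
  - (bose x * (1 + bose x)) * (y - x) <= bose y - bose x.
Proof.
move=> x0 y0; rewrite !boseE//.
have eE : 0 < expR x - 1 by rewrite subr_gt0 expR_gt1.
have eF : 0 < expR y - 1 by rewrite subr_gt0 expR_gt1.
have : 1 + (x - y) <= expR (x - y) by exact: expR_ge1Dx.
rewrite expRB -[expR x](subrK 1) -[expR y](subrK 1) !addrK.
move: (expR x - 1) (expR y - 1) eE eF => E F E0 F0.
have F1 : 0 < F + 1 by rewrite addr_gt0.
move: (y - x) (opprB y x) => w <- H.
have {}H : (F - E) / (F + 1) <= w.
  have -> : (F - E) / (F + 1) = 1 - (E + 1) / (F + 1) by field; rewrite gt_eqF.
  lra.
rewrite -subr_ge0.
have -> : F^-1 - E^-1 - - (E^-1 * (1 + E^-1)) * w =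
  ((E - F) * E + w * ((E + 1) * F)) / (E ^+ 2 * F).
  by field; rewrite !gt_eqF.
rewrite divr_ge0 ?mulr_ge0 ?exprn_ge0 ?(ltW E0) ?(ltW F0)//.
(* Replacing [w] by its lower bound turns the numerator into $(F-E)^2/(F+1)$. *)
apply: (@le_trans _ _ ((E - F) * E + (F - E) / (F + 1) * ((E + 1) * F))).
  have -> : (E - F) * E + (F - E) / (F + 1) * ((E + 1) * F) = (F - E) ^+ 2 / (F + 1).
    by field; rewrite gt_eqF.
  by rewrite divr_ge0 ?sqr_ge0// ltW.
by rewrite lerD2l ler_pM2r// mulr_gt0// addr_gt0.
Qed.

(** Minus the derivative of [lnP_trunc]; minus its own derivative is [var_trunc]. They are the mean
    and variance of $\sum_m mG_m$ for independent geometric $G_m$ of mean [bose] at $mt$. *)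
Definition mean_trunc N t : R := \sum_(m < N) m.+1%:R * bose (m.+1%:R * t).

Definition var_trunc N t : R :=
  \sum_(m < N) m.+1%:R ^+ 2 * (bose (m.+1%:R * t) * (1 + bose (m.+1%:R * t))).

Lemma lnP_trunc_subgradient N x y : 0 < x -> 0 < y ->
  - mean_trunc N x * (y - x) <= lnP_trunc N y - lnP_trunc N x.
Proof.
move=> x0 y0; rewrite /mean_trunc /lnP_trunc -sumrB mulNr -mulrN big_distrl /=.
apply: ler_sum => m _.
have := @lnP_term_subgradient (m.+1%:R * x) (m.+1%:R * y); rewrite !mulr_gt0//.
move=> /(_ isT isT); apply: le_trans.
by rewrite le_eqVlt; apply/orP; left; apply/eqP; ring.
Qed.

Lemma mean_trunc_subgradient N x y : 0 < x -> 0 < y ->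
  - var_trunc N x * (y - x) <= mean_trunc N y - mean_trunc N x.
Proof.
move=> x0 y0; rewrite /mean_trunc /var_trunc -sumrB mulNr -mulrN big_distrl /=.
apply: ler_sum => m _.
have := @bose_subgradient (m.+1%:R * x) (m.+1%:R * y); rewrite !mulr_gt0//.
move=> /(_ isT isT) /(ler_wpM2l (ler0n R m.+1)) H.
rewrite -mulrBr; apply: le_trans H.
by rewrite le_eqVlt; apply/orP; left; apply/eqP; ring.
Qed.

Let a : R := pi ^+ 2 / 6.

Let a_gt0 : 0 < a.
Proof. by rewrite divr_gt0// exprn_gt0// pi_gt0. Qed.

(* The saddle point for the coefficient of index n.+1. *)
Definition saddle (n : nat) : R := pi / Num.sqrt (6 * n.+1%:R).

Lemma saddle_gt0 n : 0 < saddle n.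
Proof. by rewrite divr_gt0 ?pi_gt0// sqrtr_gt0 mulr_gt0. Qed.

(** Stationarity of $a/t + (n+1)t$ at the saddle point. *)
Lemma saddle_sqr n : n.+1%:R * saddle n ^+ 2 = a.
Proof.
rewrite /saddle exprMn exprVn sqr_sqrtr ?mulr_ge0//.
have n0 : n.+1%:R != 0 :> R by rewrite pnatr_eq0.
by rewrite /a; move: (n.+1%:R) n0 => N N0; field.
Qed.

Lemma cvg_saddle : saddle n @[n --> \oo] --> (0 : R).
Proof.
apply/cvgrPdist_le => e e0; near=> n.
rewrite sub0r normrN gtr0_norm ?saddle_gt0//.
rewrite -[leRHS]gtr0_norm// -sqrtr_sqr -[leLHS]gtr0_norm ?saddle_gt0// -sqrtr_sqr.
apply: ler_wsqrtr; rewrite -(@ler_pM2l _ n.+1%:R)// saddle_sqr -ler_pdivrMr ?exprn_gt0//.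
apply: le_trans (_ : n%:R <= _); last by rewrite ler_nat.
by near: n; exact: nbhs_infty_ger.
Unshelve. all: by end_near. Qed.

Lemma cvg_sqrt_saddle : Num.sqrt (saddle n) @[n --> \oo] --> (0 : R).
Proof.
rewrite -[X in _ --> X](@sqrtr0 R); apply: continuous_cvg; first exact: sqrt_continuous.
exact: cvg_saddle.
Qed.

(** From $e^{y/3} \ge y/3$. This is the form in which exponential decay will be played against
    powers of $1/t$. *)
Lemma expR_ge_cube y : 0 <= y -> y ^+ 3 / 27 <= expR y.
Proof.
move=> y0; have -> : expR y = expR (y / 3) ^+ 3.
  by rewrite -expRM_natl; congr expR; field.
have -> : y ^+ 3 / 27 = (y / 3) ^+ 3 by field.
rewrite lerXn2r ?nnegrE ?expR_ge0 ?divr_ge0//.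
by apply: le_trans (expR_ge1Dx _); rewrite lerDr.
Qed.

(** At the saddle point $(n+1)t = a/t$, so the first omitted exponential is much smaller than the
    factor $t^{-2}$ in [lnP_tail]. *)
Lemma cvg_lnP_tail (c : nat -> R) : (\forall n \near \oo, 2^-1 <= c n) ->
  lnP (c n * saddle n) - lnP_trunc n.+1 (c n * saddle n) @[n --> \oo] --> (0 : R).
Proof.
move=> c2.
(* Here $1944 = 216\cdot 3^2$: [expR_ge_cube] at $y = a/(2t)$ gives $27\cdot 2^3 = 216$, and
   $1-e^{-ct}$ has inverse at most $3/t$. *)
apply: (@squeeze_cvgr _ _ _ _ (cst 0) (fun n => 1944 / a ^+ 3 * saddle n)); last 2 first.
- exact: cvg_cst.
- by rewrite -[X in _ --> X](mulr0 (1944 / a ^+ 3)); apply: cvgMl_tmp; exact: cvg_saddle.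
near=> n; have t0 := saddle_gt0 n.
have t1 : saddle n <= 1.
  near: n; have /cvgrPdist_le/(_ _ ltr01) := cvg_saddle; apply: filterS => n.
  by rewrite sub0r normrN; exact: le_trans (ler_norm _).
have cn : 2^-1 <= c n by near: n.
set x := c n * saddle n; have x0 : 0 < x by rewrite mulr_gt0// (lt_le_trans _ cn).
have xt : saddle n / 2 <= x by rewrite mulrC ler_pM2r.
rewrite subr_ge0 lnP_trunc_le//=; apply: le_trans (lnP_tail _ x0) _.
have p := expRN_lt1 x0.
have h1 : (1 - expR (- x))^-1 <= 3 / saddle n.
  have : x / (1 + x) <= 1 - expR (- x).
    have : expR (- x) <= (1 + x)^-1.
      by rewrite expRN lef_pV2 ?posrE ?expR_gt0 ?addr_gt0// expR_ge1Dx.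
    have -> : x / (1 + x) = 1 - (1 + x)^-1 by field; rewrite gt_eqF// addr_gt0.
    lra.
  have q0 : 0 < x / (1 + x) by rewrite divr_gt0// addr_gt0.
  rewrite -lef_pV2 ?posrE// => /le_trans; apply; rewrite invf_div.
  rewrite mulrDl mul1r divff ?gt_eqF//.
  have : x^-1 <= 2 / saddle n.
    by rewrite -[2 / saddle n]invf_div lef_pV2 ?posrE// divr_gt0.
  have : 1 <= (saddle n)^-1 by rewrite invf_ge1.
  by rewrite (_ : 3 / saddle n = 2 / saddle n + (saddle n)^-1); [lra|ring].
have h2 : expR (- x) ^+ n.+2 <= 216 * saddle n ^+ 3 / a ^+ 3.
  pose y := a / (2 * saddle n).
  have y0 : 0 < y by rewrite divr_gt0// mulr_gt0.
  have -> : 216 * saddle n ^+ 3 / a ^+ 3 = (y ^+ 3 / 27)^-1.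
    by rewrite /y; field; rewrite !gt_eqF.
  apply: (@le_trans _ _ (expR (- y))); last first.
    by rewrite expRN lef_pV2 ?posrE ?expR_gt0 ?divr_gt0 ?exprn_gt0// expR_ge_cube// ltW.
  rewrite -expRM_natl ler_expR mulrN lerN2.
  apply: (@le_trans _ _ (n.+1%:R * (saddle n / 2))).
    by rewrite /y -(saddle_sqr n) le_eqVlt; apply/orP; left; apply/eqP; field; rewrite gt_eqF.
  apply: ler_pM => //; first by rewrite divr_ge0// ltW.
  by rewrite ler_nat.
have -> : 1944 / a ^+ 3 * saddle n = (216 * saddle n ^+ 3 / a ^+ 3) * (3 / saddle n) ^+ 2.
  by field; rewrite !gt_eqF.
rewrite -exprVn; apply: ler_pM; rewrite ?exprn_ge0 ?expR_ge0 ?invr_ge0 ?(ltW p)//.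
by rewrite lerXn2r ?nnegrE ?invr_ge0 ?(ltW p)// divr_ge0// ltW.
Unshelve. all: by end_near. Qed.

End Moments.

(** * Limits of the mean and the variance *)

Section MomentLimits.
Variable R : realType.
Let a : R := pi ^+ 2 / 6.

Let a_gt0 : 0 < a.
Proof. by rewrite divr_gt0// exprn_gt0// pi_gt0. Qed.

Let cvgn_cst (x : R) : (fun=> x) @ \oo --> x.
Proof. exact: cvg_cst. Qed.

(** The power $t^{3/2}$, of the order of the inverse standard deviation. *)
Definition saddle_scale (n : nat) : R := saddle R n * Num.sqrt (saddle R n).

Lemma sqrt_saddle_gt0 n : 0 < Num.sqrt (saddle R n).
Proof. by rewrite sqrtr_gt0 saddle_gt0. Qed.

Lemma sqr_sqrt_saddle n : Num.sqrt (saddle R n) ^+ 2 = saddle R n.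
Proof. by rewrite sqr_sqrtr// ltW// saddle_gt0. Qed.

Lemma sqrt_saddle_le2 n : Num.sqrt (saddle R n) <= 2.
Proof.
have t2 : saddle R n <= 2.
  rewrite -ler_sqr ?nnegrE ?(ltW (saddle_gt0 _ _))//.
  apply: (@le_trans _ _ a); first by rewrite /a -(saddle_sqr R n) ler_peMl ?sqr_ge0// ler1n.
  have pi4 : pi < 4 :> R by have := @pihalf_lt2 R; lra.
  have : pi ^+ 2 <= 4 ^+ 2 :> R by rewrite ler_sqr ?nnegrE ?pi_ge0// ltW.
  by rewrite /a; lra.
rewrite -ler_sqr ?nnegrE ?sqrtr_ge0// sqr_sqrt_saddle; lra.
Qed.

Lemma cvg_saddle_comp (f : R -> R) (l : R) (c : nat -> R) (c0 : R) :
  (forall n, 2^-1 <= c n) -> c n @[n --> \oo] --> c0 ->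
  f x @[x --> 0^'+] --> l -> f (c n * saddle R n) @[n --> \oo] --> l.
Proof.
move=> c2 cc /cvg_at_rightP H; apply: (H (fun n => c n * saddle R n)); split.
  by move=> n; rewrite mulr_gt0 ?saddle_gt0// (lt_le_trans _ (c2 n)).
by rewrite -(mulr0 c0); apply: cvgM => //; exact: cvg_saddle.
Qed.

(** Subgradients of [lnP_trunc] along $t(1+x\sqrt t)$. By [saddle_sqr] the linear part of $a/t$
    cancels $(n+1)t^{3/2}x$ and leaves $ax^2$ in the limit, with all errors $o(1)$ by
    [cvg_lnP_error] and [cvg_lnP_tail]. *)
Lemma cvg_mean_trunc :
  saddle_scale n * (n.+1%:R - mean_trunc n.+1 (saddle R n)) @[n --> \oo] --> (0 : R).
Proof.
pose c (x : R) n := 1 + x * Num.sqrt (saddle R n).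
pose h n x := lnP_trunc n.+1 (c x n * saddle R n) - lnP_trunc n.+1 (saddle R n)
              + n.+1%:R * saddle_scale n * x.
have c2 x n : `|x| < 4^-1 -> 2^-1 <= c x n.
  move=> x4; have := sqrt_saddle_le2 n; have := sqrt_saddle_gt0 n.
  rewrite /c; move: (Num.sqrt _) => w w0 w2.
  have : `|x * w| <= 4^-1 * 2.
    by rewrite normrM ler_pM// ?(ltW x4)// gtr0_norm.
  by rewrite ler_norml => /andP[+ _]; lra.
have cc x : c x n @[n --> \oo] --> (1 : R).
  rewrite -[X in _ --> X]addr0 -(mulr0 x); apply: cvgD; first exact: cvg_cst.
  by apply: cvgMl_tmp; exact: cvg_sqrt_saddle.
apply: (@subgradient_cvg0 R h _ (fun x => a * x ^+ 2) 4^-1 a) => //.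
- move=> x x4.
  have c2x n := c2 x n x4.
  have c0 n : 0 < c x n by rewrite (lt_le_trans _ (c2x n)).
  have L1 := cvg_saddle_comp c2x (cc x) (@cvg_lnP_error R).
  have one2 : 2^-1 <= 1 :> R by lra.
  have L2 := cvg_saddle_comp (c := fun=> 1) (fun=> one2) (@cvgn_cst (1)) (@cvg_lnP_error R).
  have T1 : lnP (c x n * saddle R n) - lnP_trunc n.+1 (c x n * saddle R n) @[n --> \oo] --> (0 : R).
    by apply: cvg_lnP_tail; near=> n.
  have T2 : lnP (1 * saddle R n) - lnP_trunc n.+1 (1 * saddle R n) @[n --> \oo] --> (0 : R).
    by apply: (@cvg_lnP_tail R (fun=> 1)); near=> n.
  have V : a * x ^+ 2 / c x n @[n --> \oo] --> a * x ^+ 2 / 1.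
    by apply: cvgMl_tmp; apply: cvgV => //; exact: cc.
  have W : ln (c x n) / 2 @[n --> \oo] --> (ln 1 / 2 : R).
    by apply: cvgMr_tmp; exact: (cvg_comp _ _ (cc x) (continuous_ln ltr01)).
  have {L1 L2 T1 T2 V W} H := cvgD (cvgD (cvgB L1 L2) (cvgB T2 T1)) (cvgD V W).
  rewrite ln1 mul0r !subr0 !add0r divr1 addr0 in H.
  suff -> : h ^~ x = (fun n => lnP_error (c x n * saddle R n) - lnP_error (1 * saddle R n)
    + (lnP (1 * saddle R n) - lnP_trunc n.+1 (1 * saddle R n) -
       (lnP (c x n * saddle R n) - lnP_trunc n.+1 (c x n * saddle R n)))
    + (a * x ^+ 2 / c x n + ln (c x n) / 2)) by exact: H.
  apply/funext => n; rewrite /h /lnP_error mul1r.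
  have t0 := saddle_gt0 R n; have w0 := sqrt_saddle_gt0 n.
  have cn0 := c0 n.
  rewrite lnM ?posrE//.
  have E : a / (c x n * saddle R n) - a / saddle R n + n.+1%:R * saddle_scale n * x =
           a * x ^+ 2 / c x n.
    have := saddle_sqr R n; rewrite -/a /saddle_scale => <-.
    have := sqr_sqrt_saddle n; move: cn0 w0; rewrite /c.
    move: (Num.sqrt (saddle R n)) => w; move: (saddle R n) => t k0 w0 <-.
    by field; rewrite !gt_eqF// mulrC.
  rewrite -/a; lra.
- move=> x x4; near=> n.
  have c0 : 0 < c x n by rewrite (lt_le_trans _ (c2 x n x4)).
  have := @lnP_trunc_subgradient R n.+1 (saddle R n) (c x n * saddle R n).
  rewrite saddle_gt0 mulr_gt0 ?saddle_gt0// => /(_ isT isT); rewrite /h.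
  have -> : c x n * saddle R n - saddle R n = saddle_scale n * x.
    by rewrite /c /saddle_scale; ring.
  lra.
Unshelve. all: by end_near. Qed.

Lemma cvg_mul_saddle_lnP_trunc (c : R) : 2^-1 <= c ->
  saddle R n * lnP_trunc n.+1 (c * saddle R n) @[n --> \oo] --> a / c.
Proof.
move=> c2; have c0 : 0 < c by rewrite (lt_le_trans _ c2).
have H := cvg_saddle_comp (c := fun=> c) (fun=> c2) (@cvgn_cst (c)) (@cvg_mul_lnP R).
have T : lnP (c * saddle R n) - lnP_trunc n.+1 (c * saddle R n) @[n --> \oo] --> (0 : R).
  by apply: (@cvg_lnP_tail R (fun=> c)); near=> n.
have {T}H := cvgB (cvgMr_tmp (b := c^-1) H) (cvgM (@cvg_saddle R) T).
rewrite mul0r subr0 in H.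
suff -> : (fun n => saddle R n * lnP_trunc n.+1 (c * saddle R n)) =
    (fun n => c * saddle R n * lnP (c * saddle R n) / c -
      saddle R n * (lnP (c * saddle R n) - lnP_trunc n.+1 (c * saddle R n))) by exact: H.
by apply/funext => n; field; rewrite gt_eqF.
Unshelve. all: by end_near. Qed.

(** At the coarser scale of a multiple of [t], the limit $a/c$ of the rescaled [lnP_trunc] has slope
    $-a/c^2$. The bound $3/4$ leaves room for perturbations of size $1/4$ above the bound $1/2$ of
    the previous limit, and below $c = 1$ for the next one. *)
Lemma cvg_mul_saddle_mean_trunc (c : R) : 3 / 4 <= c ->
  saddle R n ^+ 2 * mean_trunc n.+1 (c * saddle R n) @[n --> \oo] --> a / c ^+ 2.
Proof.
move=> c3; have c0 : 0 < c by apply: lt_le_trans c3; lra.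
pose h n x := saddle R n * lnP_trunc n.+1 ((c + x) * saddle R n)
   - saddle R n * lnP_trunc n.+1 (c * saddle R n) + a / c ^+ 2 * x.
have cx x : `|x| < 4^-1 -> 2^-1 <= c + x.
  by rewrite ltr_norml => /andP[+ _]; lra.
have : a / c ^+ 2 - saddle R n ^+ 2 * mean_trunc n.+1 (c * saddle R n) @[n --> \oo] --> (0 : R).
  apply: (@subgradient_cvg0 R h _ (fun x => a / (c + x) - a / c + a / c ^+ 2 * x) 4^-1 (4 * a)).
  - by [].
  - by rewrite mulr_gt0.
  - move=> x x4; apply: cvgD; last exact: cvg_cst.
    apply: cvgB; apply: cvg_mul_saddle_lnP_trunc; first exact: cx.
    by lra.
  - move=> x x4; near=> n; have t0 := saddle_gt0 R n.
    have := @lnP_trunc_subgradient R n.+1 (c * saddle R n) ((c + x) * saddle R n).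
    have cx0 : 0 < c + x by rewrite (lt_le_trans _ (cx _ x4)).
    move=> /(_ (mulr_gt0 c0 t0) (mulr_gt0 cx0 t0)) /(ler_wpM2l (ltW t0)).
    set m := mean_trunc _ _; rewrite /h -mulrBr mulrBl => H.
    rewrite addrC lerD2r; apply: le_trans H.
    by rewrite le_eqVlt; apply/orP; left; apply/eqP; ring.
  - move=> x x4; have := cx x x4 => cx2.
    have cx0 : 0 < c + x by rewrite (lt_le_trans _ cx2).
    have -> : a / (c + x) - a / c + a / c ^+ 2 * x = a * x ^+ 2 / (c ^+ 2 * (c + x)).
      by field; rewrite !gt_eqF.
    rewrite ler_pdivrMr ?mulr_gt0 ?exprn_gt0//.
    rewrite [leRHS](_ : _ = a * x ^+ 2 * (4 * (c ^+ 2 * (c + x)))); last by ring.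
    apply: ler_peMr; first exact: (mulr_ge0 (ltW a_gt0) (sqr_ge0 x)).
    have h1 : (3 / 4) ^+ 2 <= c ^+ 2 by rewrite ler_sqr ?nnegrE ?(ltW c0)//; lra.
    have : (3 / 4) ^+ 2 * 2^-1 <= c ^+ 2 * (c + x).
      by apply: ler_pM => //; rewrite ?sqr_ge0.
    lra.
move=> H; have {}H := cvgB (@cvgn_cst (a / c ^+ 2)) H; rewrite subr0 in H.
suff -> : (fun n => saddle R n ^+ 2 * mean_trunc n.+1 (c * saddle R n)) = (fun n => a / c ^+ 2 - (a / c ^+ 2 - saddle R n ^+ 2 * mean_trunc n.+1 (c * saddle R n))) by exact: H.
by apply/funext => n; rewrite opprB addrC subrK.
Unshelve. all: by end_near. Qed.

(** The same argument once more, for the convex [mean_trunc]: $a/c^2$ has slope $-2a$ at $c = 1$. *)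
Lemma cvg_var_trunc :
  saddle R n ^+ 3 * var_trunc n.+1 (saddle R n) @[n --> \oo] --> 2 * a.
Proof.
pose h n x := saddle R n ^+ 2 * mean_trunc n.+1 ((1 + x) * saddle R n)
   - saddle R n ^+ 2 * mean_trunc n.+1 (1 * saddle R n) + 2 * a * x.
have cx x : `|x| < 4^-1 -> 3 / 4 <= 1 + x :> R.
  by rewrite ltr_norml => /andP[+ _]; lra.
have : 2 * a - saddle R n ^+ 3 * var_trunc n.+1 (saddle R n) @[n --> \oo] --> (0 : R).
  apply: (@subgradient_cvg0 R h _ (fun x => a / (1 + x) ^+ 2 - a / 1 ^+ 2 + 2 * a * x) 4^-1 (8 * a)).
  - by [].
  - by rewrite mulr_gt0.
  - move=> x x4; apply: cvgD; last exact: cvg_cst.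
    apply: cvgB; apply: cvg_mul_saddle_mean_trunc; first exact: cx.
    by lra.
  - move=> x x4; near=> n; have t0 := saddle_gt0 R n.
    have := @mean_trunc_subgradient R n.+1 (saddle R n) ((1 + x) * saddle R n).
    have cx0 : 0 < 1 + x by have := cx _ x4; lra.
    move=> /(_ t0 (mulr_gt0 cx0 t0)) /(ler_wpM2l (exprn_ge0 2 (ltW t0))).
    set m := var_trunc _ _; rewrite /h mul1r -mulrBr mulrBl => H.
    rewrite addrC lerD2r; apply: le_trans H.
    by rewrite le_eqVlt; apply/orP; left; apply/eqP; ring.
  - move=> x x4; have := cx x x4 => cx2.
    have x1 : x <= 4^-1 by move: x4; rewrite ltr_norml => /andP[_ /ltW].
    have cx0 : 0 < 1 + x by lra.
    have -> : a / (1 + x) ^+ 2 - a / 1 ^+ 2 + 2 * a * x = a * x ^+ 2 * (3 + 2 * x) / (1 + x) ^+ 2.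
      by field; rewrite !gt_eqF.
    rewrite ler_pdivrMr ?exprn_gt0//.
    rewrite [leRHS](_ : _ = a * x ^+ 2 * (8 * (1 + x) ^+ 2)); last by ring.
    apply: ler_wpM2l; first exact: (mulr_ge0 (ltW a_gt0) (sqr_ge0 x)).
    have h1 : (3 / 4) ^+ 2 <= (1 + x) ^+ 2 by rewrite ler_sqr ?nnegrE ?(ltW cx0)//; lra.
    lra.
move=> H; have {}H := cvgB (@cvgn_cst (2 * a)) H; rewrite subr0 in H.
suff -> : (fun n => saddle R n ^+ 3 * var_trunc n.+1 (saddle R n)) = (fun n => 2 * a - (2 * a - saddle R n ^+ 3 * var_trunc n.+1 (saddle R n))) by exact: H.
by apply/funext => n; rewrite opprB addrC subrK.
Unshelve. all: by end_near. Qed.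

End MomentLimits.

(** * Fourier integral *)

Section CharacteristicFunction.
Variable R : realType.
Implicit Types (b x y u : R).

(* For a geometric variable G of mean b, E[exp(i x G)] is
   exp (- cf_ln b x / 2 + i * cf_arg b x). *)
Definition cf_ln b x : R := ln (1 + 2 * (b * (1 + b)) * (1 - cos x)).

Definition cf_arg b x : R := atan (b * sin x / (1 + b * (1 - cos x))).

Lemma ln1D_bounds (z : R) : 0 <= z -> z - z ^+ 2 <= ln (1 + z) <= z.
Proof.
move=> z0; have z1 : 0 < 1 + z by rewrite ltr_wpDr.
apply/andP; split; last by rewrite le_ln1Dx// (lt_le_trans (ltrN10 _)).
have : ln (1 + ((1 + z)^-1 - 1)) <= (1 + z)^-1 - 1.
  by apply: le_ln1Dx; rewrite ltrBrDr addrC subrr invr_gt0.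
rewrite addrC subrK lnV ?posrE//.
have : (1 + z)^-1 - 1 <= - (z - z ^+ 2).
  have -> : (1 + z)^-1 - 1 = - (z - z ^+ 2) - z ^+ 3 / (1 + z) by field; rewrite gt_eqF.
  by rewrite gerBl divr_ge0 ?exprn_ge0// ltW.
lra.
Qed.

Lemma cf_ln_bound b x : 0 <= b ->
  `|cf_ln b x - b * (1 + b) * x ^+ 2| <=
  (b * (1 + b) + (b * (1 + b)) ^+ 2) * x ^+ 4.
Proof.
move=> b0; rewrite /cf_ln.
have : 0 <= b * (1 + b) by rewrite mulr_ge0// addr_ge0.
move: (b * (1 + b)) => v v0.
have c1 := cos_ge_taylor2 x; have c2 := cos_le_taylor4 x.
pose z := 2 * v * (1 - cos x).
have z0 : 0 <= z by rewrite /z mulr_ge0 ?mulr_ge0// subr_ge0 cos_le1.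
have zu : z <= v * x ^+ 2.
  rewrite /z -subr_ge0 (_ : _ - _ = 2 * v * (cos x - (1 - x ^+ 2 / 2))); last by field.
  by rewrite mulr_ge0 ?mulr_ge0// subr_ge0.
have zl : v * x ^+ 2 - v * x ^+ 4 <= z.
  have x4 : 0 <= v * x ^+ 4 by rewrite mulr_ge0// exprn_even_ge0.
  have : v * x ^+ 2 - v * x ^+ 4 / 12 <= z.
    rewrite /z -subr_ge0.
    rewrite (_ : _ - _ = 2 * v * (1 - x ^+ 2 / 2 + x ^+ 4 / 24 - cos x)); last by field.
    by rewrite mulr_ge0 ?mulr_ge0// subr_ge0.
  lra.
have zz : z ^+ 2 <= v ^+ 2 * x ^+ 4.
  rewrite (_ : v ^+ 2 * x ^+ 4 = (v * x ^+ 2) ^+ 2); last by ring.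
  by rewrite ler_sqr ?nnegrE// (le_trans z0).
have /andP[h1 h2] := ln1D_bounds z0.
rewrite -/z ler_norml mulrDl; apply/andP; split; last first.
  have x4 : 0 <= x ^+ 4 by rewrite exprn_even_ge0.
  have : 0 <= v * x ^+ 4 by rewrite mulr_ge0.
  have : 0 <= v ^+ 2 * x ^+ 4 by rewrite mulr_ge0// sqr_ge0.
  lra.
lra.
Qed.

Lemma atan_bound (w : R) : `|atan w - w| <= `|w| ^+ 3.
Proof.
wlog w0 : w / 0 <= w.
  move=> H; case: (leP 0 w) => [/H//|w0].
  have -> : atan w - w = - (atan (- w) - - w) by rewrite atanN; ring.
  by rewrite normrN -[ `|w|]normrN H// oppr_ge0 ltW.
have h1 : atan w <= w.
  have := @derive_ge0_le R (fun y => y - atan y) (fun y => 1 - (1 + y ^+ 2)^-1) 0 w w0.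
  rewrite atan0 subr0 subr_ge0; apply => y _ /=.
  by rewrite subr_ge0 invf_le1 ?ltr_wpDr ?sqr_ge0// lerDl sqr_ge0.
have h2 : w - w ^+ 3 <= atan w.
  have := @derive_ge0_le R (fun y => (atan y - y) + y ^+ 3)
    (fun y => (1 + y ^+ 2)^-1 - 1 + 3 * y ^+ 2) 0 w w0.
  rewrite atan0 subr0 expr0n add0r => H.
  suff : 0 <= atan w - w + w ^+ 3 by lra.
  apply: H => y /=.
    have -> : (1 + y ^+ 2)^-1 - 1 + 3 * y ^+ 2 = (1 + y ^+ 2)^-1 - 1 + (3%:R * y ^+ 2) *: 1.
      by rewrite /GRing.scale /= mulr1.
    have -> : (fun y : R => atan y - y + y ^+ 3) = atan - id + (id ^+ 3).
      by apply/funext => z; rewrite exprfctE.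
    by apply: is_deriveD; apply: is_deriveX.
  move=> _; have y2 := sqr_ge0 y; have y1 : 0 < 1 + y ^+ 2 by rewrite ltr_wpDr.
  have : 1 - y ^+ 2 <= (1 + y ^+ 2)^-1.
    rewrite -[leRHS]mul1r ler_pdivlMr//.
    rewrite (_ : (1 - y ^+ 2) * (1 + y ^+ 2) = 1 - (y ^+ 2) ^+ 2); last by ring.
    by rewrite gerBl sqr_ge0.
  lra.
by rewrite ler0_norm ?subr_le0// ger0_norm// opprB; lra.
Qed.

Lemma cf_arg_bound b x : 0 <= b ->
  `|cf_arg b x - b * x| <= (b ^+ 3 + b + b ^+ 2) * `|x| ^+ 3.
Proof.
move=> b0; pose p := b * (1 - cos x).
have p0 : 0 <= p by rewrite mulr_ge0// subr_ge0 cos_le1.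
have p1 : 0 < 1 + p by rewrite ltr_wpDr.
have sx : `|sin x| <= `|x|.
  wlog x0 : x {p p0 p1} / 0 <= x.
    move=> H; case: (leP 0 x) => [/H//|x0].
    have -> : sin x = - sin (- x) by rewrite sinN opprK.
    by rewrite normrN -[ `|x|]normrN H// oppr_ge0 ltW.
  rewrite (ger0_norm x0); case: (leP 1 x) => x1; first by rewrite (le_trans (sin_max _)).
  rewrite ger0_norm ?sin_le_id// sin_ge0_pi// x0 (le_trans (ltW x1))//.
  by have := @pi_ge2 R; lra.
have sx3 : `|sin x - x| <= `|x| ^+ 3.
  wlog x0 : x {p p0 p1 sx} / 0 <= x.
    move=> H; case: (leP 0 x) => [/H//|x0].
    have -> : sin x - x = - (sin (- x) - - x) by rewrite sinN; ring.
    by rewrite normrN -[ `|x|]normrN H// oppr_ge0 ltW.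
  have := sin_le_id x0; have := sin_ge_taylor3 x0; have : 0 <= x ^+ 3 by rewrite exprn_ge0.
  by move=> h0 h1 h2; rewrite ler0_norm ?subr_le0// (ger0_norm x0) opprB; lra.
have px : p <= b * `|x| ^+ 2.
  rewrite /p ler_wpM2l// real_normK ?num_real//.
  have := cos_ge_taylor2 x; have := sqr_ge0 x; lra.
pose w := b * sin x / (1 + p).
have w1 : `|w| <= b * `|x|.
  rewrite normrM normrM (ger0_norm b0) normfV (gtr0_norm p1) ler_pdivrMr//.
  apply: (@le_trans _ _ (b * `|x|)); first by rewrite ler_wpM2l.
  by rewrite ler_peMr ?mulr_ge0// lerDl.
have w2 : `|w - b * x| <= b * `|x| ^+ 3 + b ^+ 2 * `|x| ^+ 3.
  have -> : w - b * x = b * (sin x - x) - w * p.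
    by rewrite /w; field; rewrite gt_eqF.
  apply: le_trans (ler_normB _ _) _; apply: lerD.
    by rewrite normrM (ger0_norm b0) ler_wpM2l.
  rewrite normrM (ger0_norm p0) (_ : b ^+ 2 * _ = (b * `|x|) * (b * `|x| ^+ 2)); last by ring.
  by apply: ler_pM.
have w3 : `|w| ^+ 3 <= b ^+ 3 * `|x| ^+ 3.
  by rewrite -exprMn lerXn2r ?nnegrE ?mulr_ge0.
rewrite /cf_arg -/p -/w.
rewrite (_ : atan w - b * x = (atan w - w) + (w - b * x)); last by ring.
apply: le_trans (ler_normD _ _) _.
have := atan_bound w; lra.
Qed.

Definition decay_const : R := 16 ^+ 4.

Lemma decay_const_ge0 : 0 <= decay_const.
Proof. exact: exprn_ge0. Qed.

(** With $F = e^{-y/16}$ one has $yb \le 2F^8$ and $yF \le 16$, so $y^i(yb)^k \le 16^i2^kF^4$ as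
    soon as $8k \ge i+4$. Both left sides are sums of such monomials, whose constants add up to less
    than [decay_const]. *)
Lemma bose_decay y : 0 < y -> let b := bose y in
  [/\ y ^+ 4 * (b * (1 + b) + (b * (1 + b)) ^+ 2) <= decay_const * expR (- (y / 4)) &
      y ^+ 3 * (b ^+ 3 + b + b ^+ 2) <= decay_const * expR (- (y / 4))].
Proof.
move=> y0 b; rewrite /decay_const; have b0 : 0 < b by exact: bose_gt0.
pose F := expR (- (y / 16)); pose w := y * F; pose p := y * b.
have F0 : 0 < F by exact: expR_gt0.
have F1 : F <= 1 by rewrite expR_le1 oppr_le0 divr_ge0// ltW.
have FX k : expR (- (y / 16 * k%:R)) = F ^+ k by rewrite -mulNr expRM_natr.
have -> : expR (- (y / 4)) = F ^+ 4 by rewrite -FX; congr expR; field.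
have w0 : 0 <= w by rewrite mulr_ge0// ltW.
have w16 : w <= 16.
  rewrite /w /F expRN ler_pdivrMr ?expR_gt0//.
  by have := expR_ge1Dx (y / 16); lra.
have p0 : 0 <= p by rewrite mulr_ge0// ltW.
have p2 : p <= 2 * F ^+ 8.
  have -> : F ^+ 8 = expR (- y) * expR (y / 2).
    by rewrite -FX -expRD; congr expR; field.
  have : 1 + y <= 2 * expR (y / 2) by have := expR_ge1Dx (y / 2); lra.
  move=> h; apply: (@le_trans _ _ (expR (- y) * (1 + y))); last first.
    by rewrite mulrCA ler_pM2l ?expR_gt0.
  have q0 := expRN_lt1 y0.
  rewrite /p /b /bose mulrCA ler_pM2l ?expR_gt0// ler_pdivrMr//.
  have : (1 + y) * expR (- y) <= 1.
    by rewrite expRN ler_pdivrMr ?expR_gt0// mul1r expR_ge1Dx.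
  lra.
have FK k : F ^+ k.+4 <= F ^+ 4 by rewrite ler_wiXn2l// ltW.
have G k c : 0 <= c -> c * F ^+ k.+4 <= c * F ^+ 4 by move=> c0; rewrite ler_wpM2l.
have Fk0 k : 0 <= F ^+ k by rewrite exprn_ge0// ltW.
have wk k : w ^+ k <= 16 ^+ k by rewrite lerXn2r ?nnegrE.
have wk0 k : 0 <= w ^+ k by rewrite exprn_ge0.
have q2 : 0 <= 2 * F ^+ 8 by rewrite mulr_ge0 ?Fk0.
have pk k : p ^+ k <= (2 * F ^+ 8) ^+ k by rewrite lerXn2r ?nnegrE.
have yk i k j c : y ^+ i * p ^+ k <= c * F ^+ j.+4 -> 0 <= c ->
    y ^+ i * p ^+ k <= c * F ^+ 4 by move=> h c0; apply: le_trans h (G _ _ c0).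
have base i k j : (8 * k = i + j.+4)%N -> y ^+ i * p ^+ k <= 16 ^+ i * 2 ^+ k * F ^+ 4.
  move=> e; apply: (yk i k j); last by rewrite mulr_ge0// exprn_ge0.
  apply: (@le_trans _ _ (y ^+ i * (2 * F ^+ 8) ^+ k)).
    by rewrite ler_wpM2l ?exprn_ge0// ltW.
  rewrite exprMn -exprM e exprD.
  rewrite (_ : _ * _ = w ^+ i * (2 ^+ k * F ^+ j.+4)); last by rewrite /w exprMn; ring.
  rewrite -mulrA ler_wpM2r// mulr_ge0// exprn_ge0//.
split.
  have -> : y ^+ 4 * (b * (1 + b) + (b * (1 + b)) ^+ 2) =
     y ^+ 3 * p ^+ 1 + y ^+ 2 * p ^+ 2 + (y ^+ 2 * p ^+ 2 + 2 * (y ^+ 1 * p ^+ 3) + y ^+ 0 * p ^+ 4).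
    by rewrite /p; ring.
  have := @base 3 1 1%N erefl; have := @base 2 2 10%N erefl.
  have := @base 1 3 19%N erefl; have := @base 0 4 28%N erefl.
  have := Fk0 4%N; rewrite !exprS !expr0 => *; lra.
have -> : y ^+ 3 * (b ^+ 3 + b + b ^+ 2) = y ^+ 0 * p ^+ 3 + y ^+ 2 * p ^+ 1 + y ^+ 1 * p ^+ 2.
  by rewrite /p; ring.
have := @base 0 3 20%N erefl; have := @base 2 1 2%N erefl; have := @base 1 2 11%N erefl.
have := Fk0 4%N; rewrite !exprS !expr0 => *; lra.
Qed.

Lemma expR_quarter_sum N (t : R) : 0 < t ->
  \sum_(m < N) expR (- (m.+1%:R * t / 4)) <= 4 / t.
Proof.
move=> t0; have t4 : 0 < t / 4 by rewrite divr_gt0.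
have e : 0 <= expR (- (t / 4)) < 1 by rewrite expR_ge0 expR_lt1 oppr_lt0.
have := sum_geometric_le 0 N e; rewrite big_mkord expr1 => H.
have := bose_le t4; rewrite invf_div; apply: le_trans; apply: le_trans H.
apply: ler_sum => m _; rewrite -expRM_natl ler_expR.
by rewrite le_eqVlt; apply/orP; left; apply/eqP; field.
Qed.

Let a : R := pi ^+ 2 / 6.

Definition cf_ln_sum n u : R :=
  \sum_(m < n.+1) cf_ln (bose (m.+1%:R * saddle R n)) (m.+1%:R * (saddle_scale R n * u)).

(** The subtracted term is the phase that selects the coefficient of index [n.+1]. *)
Definition cf_arg_sum n u : R :=
  \sum_(m < n.+1) cf_arg (bose (m.+1%:R * saddle R n)) (m.+1%:R * (saddle_scale R n * u))
  - n.+1%:R * (saddle_scale R n * u).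

(** At $x = mt^{3/2}u$ the quadratic parts add up to $t^3u^2$ times the variance. The quartic errors
    are $t^2$ times a summable function of $mt$, hence $O(t)$ in total. *)
Lemma cvg_cf_ln_sum u : cf_ln_sum n u @[n --> \oo] --> 2 * a * u ^+ 2.
Proof.
have E n : `|saddle R n ^+ 3 * var_trunc n.+1 (saddle R n) * u ^+ 2 - cf_ln_sum n u|
    <= 4 * decay_const * u ^+ 4 * saddle R n.
  have t0 := saddle_gt0 R n.
  rewrite distrC /cf_ln_sum /var_trunc big_distrr big_distrl /= -sumrB.
  apply: le_trans (ler_norm_sum _ _ _) _.
  apply: (@le_trans _ _ (\sum_(m < n.+1) decay_const * u ^+ 4 * saddle R n ^+ 2 *
      expR (- (m.+1%:R * saddle R n / 4)))); last first.
    rewrite -big_distrr /=.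
    have u4 : 0 <= decay_const * u ^+ 4 * saddle R n ^+ 2 :> R.
      by rewrite mulr_ge0 ?sqr_ge0// mulr_ge0 ?decay_const_ge0// exprn_even_ge0.
    apply: le_trans (ler_wpM2l u4 (expR_quarter_sum _ t0)) _.
    by rewrite le_eqVlt; apply/orP; left; apply/eqP; field; rewrite gt_eqF.
  apply: ler_sum => m _.
  have y0 : 0 < m.+1%:R * saddle R n by rewrite mulr_gt0.
  have [H _] := bose_decay y0; have b0 := ltW (bose_gt0 y0).
  have := cf_ln_bound (m.+1%:R * (saddle_scale R n * u)) b0.
  move: H; move: (bose _) => b H.
  have e2 : (m.+1%:R * (saddle_scale R n * u)) ^+ 2 = m.+1%:R ^+ 2 * u ^+ 2 * saddle R n ^+ 3.
    rewrite /saddle_scale; have := sqr_sqrt_saddle R n.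
    by move: (Num.sqrt (saddle R n)) => w; move: (saddle R n) => t <-; ring.
  have e4 : (m.+1%:R * (saddle_scale R n * u)) ^+ 4 =
      (m.+1%:R * saddle R n) ^+ 4 * (u ^+ 4 * saddle R n ^+ 2).
    by rewrite -[4%N]/(2 * 2)%N exprM e2; ring.
  rewrite e2 e4 => H2.
  have -> : saddle R n ^+ 3 * (m.+1%:R ^+ 2 * (b * (1 + b))) * u ^+ 2 =
    b * (1 + b) * (m.+1%:R ^+ 2 * u ^+ 2 * saddle R n ^+ 3) by ring.
  apply: le_trans H2 _.
  rewrite mulrA [X in X * _]mulrC.
  have u4 : 0 <= u ^+ 4 * saddle R n ^+ 2 by rewrite mulr_ge0 ?sqr_ge0// exprn_even_ge0.
  apply: le_trans (ler_wpM2r u4 H) _.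
  by rewrite le_eqVlt; apply/orP; left; apply/eqP; ring.
have c1 : saddle R n ^+ 3 * var_trunc n.+1 (saddle R n) * u ^+ 2 @[n --> \oo] --> 2 * a * u ^+ 2.
  by apply: cvgMr_tmp; exact: cvg_var_trunc.
have c2 : saddle R n ^+ 3 * var_trunc n.+1 (saddle R n) * u ^+ 2 - cf_ln_sum n u @[n --> \oo] --> (0 : R).
  apply/cvgrPdist_le => e e0; near=> n; rewrite sub0r normrN; apply: le_trans (E n) _.
  near: n.
  have c3 : 4 * decay_const * u ^+ 4 * saddle R n @[n --> \oo] --> (0 : R).
    by rewrite -(mulr0 (4 * decay_const * u ^+ 4)); apply: cvgMl_tmp; exact: cvg_saddle.
  have /cvgrPdist_le/(_ _ e0) := c3; apply: filterS => n.
  by rewrite sub0r normrN; exact: le_trans (ler_norm _).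
have := cvgB c1 c2; rewrite subr0 => H.
suff -> : cf_ln_sum ^~ u = (fun n => saddle R n ^+ 3 * var_trunc n.+1 (saddle R n) * u ^+ 2 -
  (saddle R n ^+ 3 * var_trunc n.+1 (saddle R n) * u ^+ 2 - cf_ln_sum n u)) by exact: H.
by apply/funext => n; rewrite opprB addrC subrK.
Unshelve. all: by end_near. Qed.

(** The linear parts reduce to the centred mean of [cvg_mean_trunc]; the cubic errors add up to
    $O(\sqrt t)$. *)
Lemma cvg_cf_arg_sum u : cf_arg_sum n u @[n --> \oo] --> (0 : R).
Proof.
have E n : `|cf_arg_sum n u - (- (saddle_scale R n *
      (n.+1%:R - mean_trunc n.+1 (saddle R n)) * u))|
    <= 4 * decay_const * `|u| ^+ 3 * Num.sqrt (saddle R n).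
  have t0 := saddle_gt0 R n; have w0 := sqrt_saddle_gt0 R n.
  have -> : cf_arg_sum n u - (- (saddle_scale R n * (n.+1%:R - mean_trunc n.+1 (saddle R n)) * u)) =
    \sum_(m < n.+1) (cf_arg (bose (m.+1%:R * saddle R n)) (m.+1%:R * (saddle_scale R n * u)) -
      m.+1%:R * bose (m.+1%:R * saddle R n) * (saddle_scale R n * u)).
    by rewrite sumrB -big_distrl /= -/(mean_trunc n.+1 (saddle R n)) /cf_arg_sum; ring.
  apply: le_trans (ler_norm_sum _ _ _) _.
  apply: (@le_trans _ _ (\sum_(m < n.+1) decay_const * `|u| ^+ 3 * Num.sqrt (saddle R n) ^+ 3 *
      expR (- (m.+1%:R * saddle R n / 4)))); last first.
    rewrite -big_distrr /=.
    have u4 : 0 <= decay_const * `|u| ^+ 3 * Num.sqrt (saddle R n) ^+ 3 :> R.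
      by rewrite mulr_ge0 ?exprn_ge0 ?(ltW w0)// mulr_ge0 ?decay_const_ge0// exprn_ge0.
    apply: le_trans (ler_wpM2l u4 (expR_quarter_sum _ t0)) _.
    rewrite [saddle R n in X in _ * X](_ : _ = Num.sqrt (saddle R n) ^+ 2); last by rewrite sqr_sqrt_saddle.
    by rewrite le_eqVlt; apply/orP; left; apply/eqP; field; rewrite gt_eqF.
  apply: ler_sum => m _.
  have y0 : 0 < m.+1%:R * saddle R n by rewrite mulr_gt0.
  have [_ H] := bose_decay y0; have b0 := ltW (bose_gt0 y0).
  have := cf_arg_bound (m.+1%:R * (saddle_scale R n * u)) b0.
  move: H; move: (bose _) => b H.
  have e3 : `|m.+1%:R * (saddle_scale R n * u)| ^+ 3 =
      (m.+1%:R * saddle R n) ^+ 3 * (`|u| ^+ 3 * Num.sqrt (saddle R n) ^+ 3).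
    rewrite /saddle_scale; move: t0 w0; move: (Num.sqrt (saddle R n)) => w.
    move: (saddle R n) => t t0 w0.
    by rewrite !normrM (gtr0_norm t0) (gtr0_norm w0) ger0_norm//; ring.
  rewrite e3 => H2.
  have -> : m.+1%:R * b * (saddle_scale R n * u) = b * (m.+1%:R * (saddle_scale R n * u)) by ring.
  apply: le_trans H2 _.
  rewrite mulrA [X in X * _]mulrC.
  have u4 : 0 <= `|u| ^+ 3 * Num.sqrt (saddle R n) ^+ 3 by rewrite mulr_ge0 ?exprn_ge0// ltW.
  apply: le_trans (ler_wpM2r u4 H) _.
  by rewrite le_eqVlt; apply/orP; left; apply/eqP; ring.
have c1 : - (saddle_scale R n * (n.+1%:R - mean_trunc n.+1 (saddle R n)) * u) @[n --> \oo] --> (0 : R).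
  rewrite -oppr0 -(mul0r u); apply: cvgN; apply: cvgMr_tmp; exact: cvg_mean_trunc.
have c2 : cf_arg_sum n u - (- (saddle_scale R n *
      (n.+1%:R - mean_trunc n.+1 (saddle R n)) * u)) @[n --> \oo] --> (0 : R).
  apply/cvgrPdist_le => e e0; near=> n; rewrite sub0r normrN; apply: le_trans (E n) _.
  near: n.
  have c3 : 4 * decay_const * `|u| ^+ 3 * Num.sqrt (saddle R n) @[n --> \oo] --> (0 : R).
    by rewrite -(mulr0 (4 * decay_const * `|u| ^+ 3)); apply: cvgMl_tmp; exact: cvg_sqrt_saddle.
  have /cvgrPdist_le/(_ _ e0) := c3; apply: filterS => n.
  by rewrite sub0r normrN; exact: le_trans (ler_norm _).
have := cvgD c2 c1; rewrite addr0 => H.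
suff -> : cf_arg_sum ^~ u = (fun n => cf_arg_sum n u - (- (saddle_scale R n *
      (n.+1%:R - mean_trunc n.+1 (saddle R n)) * u)) +
   - (saddle_scale R n * (n.+1%:R - mean_trunc n.+1 (saddle R n)) * u)) by exact: H.
by apply/funext => n; rewrite subrK.
Unshelve. all: by end_near. Qed.

End CharacteristicFunction.

(** * Decay of the integrand on the whole circle *)

Section Domination.
Variable R : realType.
Implicit Types (b x y u t th : R).

Lemma ln1D_ge (z : R) : 0 <= z -> z / (1 + z) <= ln (1 + z).
Proof.
move=> z0; have z1 : 0 < 1 + z by rewrite ltr_wpDr.
have : ln (1 + ((1 + z)^-1 - 1)) <= (1 + z)^-1 - 1.
  by apply: le_ln1Dx; rewrite ltrBrDr addrC subrr invr_gt0.
rewrite addrC subrK lnV ?posrE//.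
have -> : z / (1 + z) = - ((1 + z)^-1 - 1) by field; rewrite gt_eqF.
by rewrite -[X in _ -> _ <= X]opprK lerN2.
Qed.

Lemma cf_ln_mono b x (z : R) : 0 <= z -> 0 <= b ->
  z <= 2 * (b * (1 + b)) * (1 - cos x) -> ln (1 + z) <= cf_ln b x.
Proof.
move=> z0 b0 h; rewrite /cf_ln ler_ln ?posrE ?lerD2l//.
  by rewrite ltr_wpDr.
by rewrite ltr_wpDr// (le_trans z0).
Qed.

Lemma cf_ln_ge0 b x : 0 <= b -> 0 <= cf_ln b x.
Proof.
move=> b0; rewrite ln_ge0// lerDl mulr_ge0 ?subr_ge0 ?cos_le1//.
by rewrite mulr_ge0// mulr_ge0// addr_ge0.
Qed.

Lemma cf_ln_norm b k th : cf_ln b (k%:R * th) = cf_ln b (k%:R * `|th|).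
Proof.
by rewrite /cf_ln -[in LHS]cos_norm normrM ger0_norm.
Qed.

Lemma bose_var_ge y : 0 < y <= 2^-1 ->
  1 / (2 * y ^+ 2) <= bose y * (1 + bose y).
Proof.
move=> /andP[y0 y2]; have := bose_ge y0; rewrite -/(bose y) => h.
have i2 : 2 <= y^-1 by rewrite -[leLHS]invrK lef_pV2 ?posrE.
have -> : 1 / (2 * y ^+ 2) = (y^-1 / 2) * y^-1 by field; rewrite gt_eqF.
have iy : 0 <= y^-1 by rewrite invr_ge0 ltW.
by apply: ler_pM => //; [rewrite divr_ge0|lra|lra].
Qed.

(** Multiplied by $2\sin(\theta/2)$ the sum telescopes to at most 1, and $\sin(\theta/2) \ge
    \theta/6$ on $(0,\pi]$. *)
Lemma dirichlet_sum_le M th : 0 < th <= pi ->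
  \sum_(m < M) cos (m.+1%:R * th) <= 3 / th.
Proof.
move=> /andP[th0 thpi].
have E : 2 * sin (th / 2) * \sum_(m < M) cos (m.+1%:R * th) =
    sin (M%:R * th + th / 2) - sin (th / 2).
  elim: M => [|M IHM]; first by rewrite big_ord0 mul0r add0r subrr mulr0.
  rewrite big_ord_recr /= mulrDr IHM.
  have -> : M%:R * th + th / 2 = M.+1%:R * th - th / 2 by rewrite -natr1; field.
  by rewrite sinB sinD; ring.
have s0 : th / 6 <= sin (th / 2).
  have t2 : 0 <= th / 2 by rewrite divr_ge0// ltW.
  apply: le_trans (sin_ge_taylor3 t2).
  have t22 : th / 2 <= 2 by have := @pihalf_lt2 R; lra.
  have : (th / 2) ^+ 2 <= 2 ^+ 2 by rewrite ler_sqr ?nnegrE.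
  have -> : (th / 2) ^+ 3 = (th / 2) ^+ 2 * (th / 2) by rewrite exprSr.
  move=> /(ler_wpM2r t2); lra.
have s1 : 0 < sin (th / 2) by apply: lt_le_trans s0; rewrite divr_gt0.
have : 2 * sin (th / 2) * \sum_(m < M) cos (m.+1%:R * th) <= 1.
  by rewrite E; have := sin_le1 (M%:R * th + th / 2); lra.
case: (leP (\sum_(m < M) cos (m.+1%:R * th)) 0) => [S0 _|S0 H].
  by rewrite (le_trans S0)// divr_ge0// ltW.
rewrite ler_pdivlMr//.
have : th / 6 * \sum_(m < M) cos (m.+1%:R * th) <= sin (th / 2) * \sum_(m < M) cos (m.+1%:R * th).
  by rewrite ler_pM2r.
lra.
Qed.

Lemma bernoulli_ge k (x : R) : 0 <= x -> 1 + k%:R * x <= (1 + x) ^+ k.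
Proof.
move=> x0; elim: k => [|k IHk]; first by rewrite mul0r addr0.
rewrite exprSr; apply: (@le_trans _ _ ((1 + k%:R * x) * (1 + x))); last first.
  by rewrite ler_wpM2r// addr_ge0.
rewrite -natr1; have : 0 <= k%:R * x * x by rewrite !mulr_ge0.
lra.
Qed.

(** For $|m\theta| \le 2$ one has $1-\cos(m\theta) \ge m^2\theta^2/3$, while $b(1+b) \ge
    1/(2m^2t^2)$. The index cancels, so every term obeys the same lower bound. *)
Lemma cf_ln_sum_small_angle L t th : 0 < t -> L.*2%:R * t <= 2^-1 -> L%:R * `|th| <= 1 ->
  L.*2%:R * ln (1 + th ^+ 2 / (3 * t ^+ 2)) <=
  \sum_(m < L.*2) cf_ln (bose (m.+1%:R * t)) (m.+1%:R * th).
Proof.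
move=> t0 Lt Lth.
rewrite mulr_natl -[in leLHS](card_ord L.*2) -sumr_const; apply: ler_sum => m _.
have mL : m.+1%:R <= L.*2%:R :> R by rewrite ler_nat.
have y0 : 0 < m.+1%:R * t by rewrite mulr_gt0.
have y2 : m.+1%:R * t <= 2^-1 by apply: le_trans Lt; rewrite ler_pM2r.
apply: cf_ln_mono; first by rewrite divr_ge0 ?sqr_ge0// mulr_ge0// sqr_ge0.
  exact/ltW/bose_gt0.
have := bose_var_ge (_ : 0 < m.+1%:R * t <= 2^-1); rewrite y0 y2 => /(_ isT).
set v := bose _ * _ => hv.
set x := m.+1%:R * th.
have x2 : x ^+ 2 <= 4.
  rewrite -[x ^+ 2](real_normK (num_real x)) (_ : 4 = 2 ^+ 2 :> R); last by ring.
  rewrite ler_sqr ?nnegrE// /x normrM ger0_norm//.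
  apply: (@le_trans _ _ (L.*2%:R * `|th|)); first by rewrite ler_wpM2r.
  by rewrite -muln2 natrM mulrAC; lra.
have c : x ^+ 2 / 3 <= 1 - cos x.
  have := cos_le_taylor4 x; have -> : x ^+ 4 = x ^+ 2 * x ^+ 2 by rewrite -exprD.
  have := ler_wpM2r (sqr_ge0 x) x2; lra.
have -> : th ^+ 2 / (3 * t ^+ 2) = 2 * (1 / (2 * (m.+1%:R * t) ^+ 2)) * (x ^+ 2 / 3).
  have : m.+1%:R != 0 :> R by rewrite pnatr_eq0.
  by rewrite /x; move: (m.+1%:R) => k k0; field; rewrite k0 gt_eqF.
apply: ler_pM => //.
- by rewrite mulr_ge0// divr_ge0// mulr_ge0// sqr_ge0.
- by rewrite divr_ge0// sqr_ge0.
- by rewrite ler_pM2l.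
Qed.

(** With $d = 1-\cos(m\theta) \le 2$ each term is at least $\ln(1+d) \ge d/3$. The cosines add up to
    at most $3/|\theta| \le 3L$, which leaves $(8L-3L)/3 \ge L$. *)
Lemma cf_ln_sum_large_angle L t th : 0 < t -> (8 * L)%:R * t <= 2^-1 ->
  1 <= L%:R * `|th| -> `|th| <= pi ->
  L%:R <= \sum_(m < 8 * L) cf_ln (bose (m.+1%:R * t)) (m.+1%:R * th).
Proof.
move=> t0 Lt Lth thpi.
have th0 : 0 < `|th|.
  by rewrite normr_gt0; apply/eqP => th0; move: Lth; rewrite th0 normr0 mulr0 ler10.
under eq_bigr do rewrite cf_ln_norm.
have D := @dirichlet_sum_le (8 * L) `|th| ltac:(by rewrite th0 thpi).
have D2 : 3 / `|th| <= 3 * L%:R by rewrite ler_pdivrMr// -mulrA; lra.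
apply: (@le_trans _ _ (\sum_(m < 8 * L) (1 - cos (m.+1%:R * `|th|)) / 3)).
  rewrite -big_distrl /= sumrB sumr_const card_ord natrM.
  have L0 : 0 <= L%:R :> R by [].
  lra.
apply: ler_sum => m _.
have mL : m.+1%:R <= (8 * L)%:R :> R by rewrite ler_nat.
have y0 : 0 < m.+1%:R * t by rewrite mulr_gt0.
have y2 : m.+1%:R * t <= 2^-1 by apply: le_trans Lt; rewrite ler_pM2r.
have := bose_var_ge (_ : 0 < m.+1%:R * t <= 2^-1); rewrite y0 y2 => /(_ isT) hv.
have v2 : 1 <= bose (m.+1%:R * t) * (1 + bose (m.+1%:R * t)).
  apply: le_trans hv; rewrite ler_pdivlMr ?mulr_gt0 ?exprn_gt0// mul1r.
  have : (m.+1%:R * t) ^+ 2 <= 2^-1 ^+ 2 by rewrite ler_sqr ?nnegrE ?(ltW y0).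
  lra.
set d := 1 - cos _; have d0 : 0 <= d by rewrite subr_ge0 cos_le1.
have d2 : d <= 2 by have := cos_geN1 (m.+1%:R * `|th|); rewrite /d; lra.
apply: (@le_trans _ _ (ln (1 + d))).
  apply: le_trans (ln1D_ge d0); rewrite ler_wpM2l// lef_pV2 ?posrE//; first lra.
  by rewrite ltr_wpDr.
apply: cf_ln_mono => //; first exact/ltW/bose_gt0.
rewrite -/d ler_peMl//; lra.
Qed.

(* exp(-y) <= 27 / y^3 at y = 1 / (64 t), and t^3 + th^2 <= 17 for |th| <= pi. *)
Definition dom_const : R := 27 * 64 ^+ 3 * 17.

Lemma dom_const_gt0 : 0 < dom_const.
Proof. by rewrite mulr_gt0// mulr_gt0// exprn_gt0. Qed.

(* With L about 1 / (16 t): when L |th| <= 1 the first 2L factors already give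
   polynomial decay, otherwise the Dirichlet kernel makes the sum of 1 - cos over
   the first 8L indices at least of order L. *)
Lemma cf_ln_sum_dominated_at n u : saddle R n <= 32^-1 ->
  `|saddle_scale R n * u| <= pi ->
  expR (- (cf_ln_sum n u / 2)) <= dom_const / (1 + u ^+ 2).
Proof.
move=> t32 thpi; have t0 := saddle_gt0 R n.
have tsq := saddle_sqr R n.
have ssq : (saddle_scale R n * u) ^+ 2 = saddle R n ^+ 3 * u ^+ 2.
  rewrite /saddle_scale; have := sqr_sqrt_saddle R n.
  by move: (Num.sqrt (saddle R n)) => w; move: (saddle R n) => t <-; ring.
rewrite /cf_ln_sum.
move: (saddle_scale R n * u) thpi ssq => th thpi ssq.
move: (saddle R n) t0 t32 tsq ssq => t t0 t32 tsq ssq.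
pose L := Num.truncn (16 * t)^-1.
have i0 : 0 <= (16 * t)^-1 by rewrite invr_ge0 mulr_ge0// ltW.
have /andP[L1 L2] := truncn_itv i0; rewrite -/L in L1 L2.
have Lu : 16 * (L%:R * t) <= 1.
  rewrite mulrCA -ler_pdivlMr ?mulr_gt0// mul1r //.
have Ll : 1 <= 32 * (L%:R * t).
  move: L2; rewrite -(natr1 L) -ltrBlDr => /ltW /(ler_wpM2r (ltW t0)).
  have -> : ((16 * t)^-1 - 1) * t = 16^-1 - t by field; rewrite gt_eqF.
  lra.
have u1 : 0 < 1 + u ^+ 2 by rewrite ltr_wpDr ?sqr_ge0.
have LN : (8 * L <= n.+1)%N.
  rewrite -(ler_nat R) -(ler_pM2r (exprn_gt0 2 t0)) tsq natrM.
  have -> : 8 * L%:R * t ^+ 2 = 16 * (L%:R * t) * (t / 2) by field.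
  have h : 16 * (L%:R * t) * (t / 2) <= 1 * (t / 2) by rewrite ler_pM2r// divr_gt0.
  apply: le_trans h _.
  have : 2 ^+ 2 <= pi ^+ 2 :> R by rewrite ler_sqr ?nnegrE ?pi_ge0// pi_ge2.
  lra.
have partial K : (K <= n.+1)%N ->
    \sum_(m < K) cf_ln (bose (m.+1%:R * t)) (m.+1%:R * th) <=
    \sum_(m < n.+1) cf_ln (bose (m.+1%:R * t)) (m.+1%:R * th).
  move=> KN; rewrite -!(big_mkord xpredT (fun m => cf_ln (bose (m.+1%:R * t)) (m.+1%:R * th))).
  rewrite [leRHS](big_cat_nat (leq0n K) KN)/= lerDl sumr_ge0// => m _.
  by rewrite cf_ln_ge0// ltW// bose_gt0// mulr_gt0.
case: (leP (L%:R * `|th|) 1) => Lth.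
  have L2t : L.*2%:R * t <= 2^-1 by rewrite -muln2 natrM mulrAC; lra.
  have H := cf_ln_sum_small_angle t0 L2t Lth.
  have L2N : (L.*2 <= n.+1)%N.
    by apply: leq_trans LN; rewrite -mul2n leq_mul2r orbT.
  have {}H := le_trans H (partial _ L2N).
  set k := th ^+ 2 / (3 * t ^+ 2) in H.
  have kE : k = t * u ^+ 2 / 3 by rewrite /k ssq; field; rewrite gt_eqF.
  have k0 : 0 <= k by rewrite kE divr_ge0// mulr_ge0 ?sqr_ge0// ltW.
  apply: (@le_trans _ _ (expR (- (L%:R * ln (1 + k))))).
    by rewrite ler_expR lerN2; move: H; rewrite -muln2 natrM; lra.
  rewrite expRN expRM_natl lnK; last by rewrite posrE ltr_wpDr.
  rewrite -[leRHS]invrK invf_div lef_pV2 ?posrE ?exprn_gt0 ?divr_gt0//; first last.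
  - exact: dom_const_gt0.
  - by rewrite ltr_wpDr.
  apply: le_trans (bernoulli_ge L k0).
  (* Since $32Lt \ge 1$, the Bernoulli term $Ltu^2/3$ is at least $u^2/96$. *)
  have C96 : 96 <= dom_const.
    rewrite /dom_const; have : 1 <= 64 ^+ 3 :> R by rewrite exprn_ege1// ler1n. lra.
  apply: (@le_trans _ _ ((1 + u ^+ 2) / 96)).
    by rewrite ler_wpM2l ?(ltW u1)// lef_pV2 ?posrE// (lt_le_trans _ C96).
  have : u ^+ 2 * 1 <= u ^+ 2 * (32 * (L%:R * t)) by rewrite ler_wpM2l// sqr_ge0.
  rewrite kE; have := sqr_ge0 u; lra.
have L8t : (8 * L)%:R * t <= 2^-1 by rewrite natrM -mulrA; lra.
have H := le_trans (cf_ln_sum_large_angle t0 L8t (ltW Lth) thpi) (partial _ LN).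
pose y := (64 * t)^-1.
have y0 : 0 < y by rewrite invr_gt0 mulr_gt0.
apply: (@le_trans _ _ (expR (- y))).
  rewrite ler_expR lerN2; apply: (@le_trans _ _ (L%:R / 2)); last lra.
  rewrite /y -[leLHS]mul1r ler_pdivrMr ?mulr_gt0//; lra.
apply: (@le_trans _ _ (27 * 64 ^+ 3 * t ^+ 3)).
  have -> : 27 * 64 ^+ 3 * t ^+ 3 = (y ^+ 3 / 27)^-1.
    by rewrite /y; field; rewrite gt_eqF.
  by rewrite expRN lef_pV2 ?posrE ?expR_gt0 ?divr_gt0 ?exprn_gt0// expR_ge_cube// ltW.
rewrite ler_pdivlMr// /dom_const -(mulrA (27 * 64 ^+ 3)) ler_pM2l; last first.
  by rewrite mulr_gt0// exprn_gt0.
rewrite mulrDr mulr1 -ssq.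
have : t ^+ 3 <= 1 by rewrite exprn_ile1// ?(ltW t0)//; lra.
have pi4 : pi < 4 :> R by have := @pihalf_lt2 R; lra.
have : `|th| ^+ 2 <= 4 ^+ 2 by rewrite ler_sqr ?nnegrE// (le_trans thpi)// ltW.
rewrite real_normK ?num_real//; lra.
Qed.

Lemma near_saddle_le (e : R) : 0 < e -> \forall n \near \oo, saddle R n <= e.
Proof.
move=> e0; have /cvgrPdist_le/(_ _ e0) := @cvg_saddle R; apply: filterS => n.
by rewrite sub0r normrN; exact: le_trans (ler_norm _).
Qed.

End Domination.

(** * The generating function in polar form *)

Section FourierIdentity.
Variable R : realType.
Local Open Scope complex_scope.
Implicit Types (r t th x y : R).

Definition expi x : R[i] := cos x +i* sin x.

Lemma expi0 : expi 0 = 1.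
Proof. by rewrite /expi cos0 sin0. Qed.

Lemma expiD x y : expi (x + y) = expi x * expi y.
Proof. by apply/eqP; rewrite eq_complex /= cosD sinD addrC eqxx /= addrC mulrC [X in _ == _ + X]mulrC; apply/eqP; ring. Qed.

Lemma expiMn (k : nat) x : expi (k%:R * x) = expi x ^+ k.
Proof.
elim: k => [|k IHk]; first by rewrite mul0r expi0.
by rewrite exprS -IHk -expiD -natr1 mulrDl mul1r addrC.
Qed.

(** A submultiplicative norm with values in [R]; it bounds the real and imaginary parts directly. *)
Definition norm1 (z : R[i]) : R := `|complex.Re z| + `|complex.Im z|.

Lemma norm1_ge0 z : 0 <= norm1 z.
Proof. by rewrite addr_ge0. Qed.

Lemma norm1D z w : norm1 (z + w) <= norm1 z + norm1 w.
Proof.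
case: z w => [a b] [c d]; rewrite /norm1 /= addrACA.
by apply: lerD; exact: ler_normD.
Qed.

Lemma norm1N z : norm1 (- z) = norm1 z.
Proof. by case: z => [a b]; rewrite /norm1 /= !normrN. Qed.

Lemma norm1M z w : norm1 (z * w) <= norm1 z * norm1 w.
Proof.
case: z w => [a b] [c d]; rewrite /norm1 /=.
have h1 := ler_normB (a * c) (b * d); have h2 := ler_normD (a * d) (b * c).
rewrite !normrM in h1 h2.
rewrite mulrDl !mulrDr; lra.
Qed.

Lemma norm1_prod_sub1 n (f : nat -> R[i]) (g : nat -> R) :
  (forall i, norm1 (f i) <= g i) ->
  norm1 (\prod_(i < n) (1 - f i) - 1) <= \prod_(i < n) (1 + g i) - 1.
Proof.
move=> fg; elim: n => [|n IHn].
  by rewrite !big_ord0 !subrr /norm1 /= normr0 addr0.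
rewrite !big_ord_recr /=; set P := \prod_(i < n) _ in IHn *; set Q := \prod_(i < n) _ in IHn *.
have -> : P * (1 - f n) - 1 = (P - 1) + - ((P - 1) * f n + f n) by ring.
apply: le_trans (norm1D _ _) _; rewrite norm1N.
have h1 := norm1D ((P - 1) * f n) (f n); have h2 := norm1M (P - 1) (f n).
have h3 : norm1 (P - 1) * norm1 (f n) <= (Q - 1) * g n.
  by apply: ler_pM; rewrite ?norm1_ge0.
have := fg n; lra.
Qed.

(** One has $1-b(e^{ix}-1) = D(1-iw)$ with $D = 1+b(1-\cos x) > 0$. Its argument is thus $-\arctan
    w$, and no choice of a branch arises. *)
Lemma geometric_factor b x : 0 <= b ->
  (1 - b%:C * (expi x - 1)) * ((expR (- (cf_ln b x / 2)))%:C * expi (cf_arg b x)) = 1.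
Proof.
move=> b0; pose D := 1 + b * (1 - cos x).
have D0 : 0 < D by rewrite ltr_wpDr// mulr_ge0// subr_ge0 cos_le1.
pose w := b * sin x / D.
have w1 : 0 < 1 + w ^+ 2 by rewrite ltr_wpDr// sqr_ge0.
have s0 : 0 < Num.sqrt (1 + w ^+ 2) by rewrite sqrtr_gt0.
have ca : cos (atan w) = (Num.sqrt (1 + w ^+ 2))^-1 by rewrite cos_atan.
have sa : sin (atan w) = w * (Num.sqrt (1 + w ^+ 2))^-1.
  have c0 : cos (atan w) != 0 by rewrite ca gt_eqF// invr_gt0.
  by have := atanK w; rewrite /tan -ca => {2}<-; rewrite divfK.
have wD : w * D = b * sin x by rewrite /w divfK// gt_eqF.
have K : 1 + 2 * (b * (1 + b)) * (1 - cos x) = (D * Num.sqrt (1 + w ^+ 2)) ^+ 2.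
  transitivity (D ^+ 2 + (w * D) ^+ 2).
    by rewrite wD exprMn sin2cos2 /D; ring.
  by rewrite [RHS]exprMn sqr_sqrtr ?(ltW w1)//; ring.
have E : expR (cf_ln b x / 2) = D * Num.sqrt (1 + w ^+ 2).
  apply/eqP; rewrite -(@eqrXn2 _ 2)// ?expR_ge0 ?mulr_ge0 ?(ltW D0) ?(ltW s0)//.
  rewrite -expRM_natl (_ : 2%:R * (cf_ln b x / 2) = cf_ln b x); last by field.
  by rewrite /cf_ln lnK ?K// posrE exprn_gt0// mulr_gt0.
have -> : 1 - b%:C * (expi x - 1) = D +i* (- (w * D)).
  by apply/eqP; rewrite eq_complex /= wD /D; apply/andP; split; apply/eqP; ring.
have -> : cf_arg b x = atan w by [].
rewrite /expi ca sa expRN E.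
have q2 : Num.sqrt (1 + w ^+ 2) ^+ 2 = 1 + w ^+ 2 by rewrite sqr_sqrtr// ltW.
move: (Num.sqrt (1 + w ^+ 2)) s0 q2 => q q0 q2.
apply/eqP; rewrite eq_complex /=; apply/andP; split; apply/eqP.
  transitivity ((1 + w ^+ 2) / q ^+ 2); last by rewrite q2 divff// gt_eqF.
  by field; rewrite !gt_eqF.
by field; rewrite !gt_eqF.
Qed.

(** Each factor splits as $1-e^{-y+ix} = (1-e^{-y})(1-b(e^{ix}-1))$ with $b$ = [bose y], and
    [geometric_factor] inverts the second part. The form with product 1 also shows that [qpoch] does
    not vanish. *)
Lemma qpoch_polar (t th : R) n : 0 < t ->
  qpoch ((expR (- t))%:C * expi th) n *
  ((expR (lnP_trunc n t) * expR (- ((\sum_(m < n) cf_ln (bose (m.+1%:R * t)) (m.+1%:R * th)) / 2)))%:C *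
   expi (\sum_(m < n) cf_arg (bose (m.+1%:R * t)) (m.+1%:R * th))) = 1.
Proof.
move=> t0; elim: n => [|n IHn].
  by rewrite /qpoch /lnP_trunc !big_ord0 mul0r oppr0 expR0 !mulr1 expi0 mulr1 mul1r.
rewrite qpochS /lnP_trunc !big_ord_recr /= -/(lnP_trunc n t).
set S := \sum_(m < n) cf_ln _ _ in IHn *; set A := \sum_(m < n) cf_arg _ _ in IHn *.
set y := n.+1%:R * t; have y0 : 0 < y by rewrite mulr_gt0.
set x := n.+1%:R * th.
have p := expRN_lt1 y0.
have -> : ((expR (- t))%:C * expi th) ^+ n.+1 = (expR (- y))%:C * expi x.
  by rewrite exprMn -expiMn -rmorphXn /= -expRM_natl mulrN.
have F : 1 - (expR (- y))%:C * expi x = (1 - expR (- y))%:C * (1 - (bose y)%:C * (expi x - 1)).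
  rewrite mulrBr mulr1 mulrA -rmorphM /= /bose mulrCA divff ?gt_eqF// mulr1.
  rewrite rmorphB /=; ring.
have G := geometric_factor x (ltW (bose_gt0 y0)).
have e1 : expR (lnP_trunc n t + lnP_term y) = expR (lnP_trunc n t) * (1 - expR (- y))^-1.
  by rewrite expRD expR_lnP_term.
have e2 : expR (- ((S + cf_ln (bose y) x) / 2)) = expR (- (S / 2)) * expR (- (cf_ln (bose y) x / 2)).
  by rewrite -expRD; congr expR; field.
rewrite F e1 e2 expiD.
have -> : (expR (lnP_trunc n t) * (1 - expR (- y))^-1 * (expR (- (S / 2)) * expR (- (cf_ln (bose y) x / 2))))%:C =
  (expR (lnP_trunc n t) * expR (- (S / 2)))%:C * ((1 - expR (- y))^-1)%:C * (expR (- (cf_ln (bose y) x / 2)))%:C :> R[i].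
  by rewrite -!rmorphM /=; congr (_%:C); ring.
move: IHn G; have : (1 - expR (- y))%:C * ((1 - expR (- y))^-1)%:C = 1 :> R[i].
  by rewrite -rmorphM /= divff// gt_eqF.
move: (1 - (bose y)%:C * (expi x - 1)) => U; move: (qpoch _ _) (expi A) (expi (cf_arg _ _)).
move: (1 - expR (- y))%:C ((1 - expR (- y))^-1)%:C (expR (- (cf_ln (bose y) x / 2)))%:C.
move: (expR (lnP_trunc n t) * expR (- (S / 2)))%:C => a b c d f g h bc IH G.
transitivity ((f * (a * g)) * (b * c) * (U * (d * h))); first by ring.
by rewrite IH bc G !mulr1.
Qed.

Lemma complex_Re_sum (I : Type) (s : seq I) (f : I -> R[i]) :
  complex.Re (\sum_(i <- s) f i) = \sum_(i <- s) complex.Re (f i).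
Proof. by apply: (big_morph (@complex.Re R)) => // -[a b] [c d]. Qed.

(** The factors of index $n+1$ to $2n$: what $(q)_{2n}/(q)_n^2$ contains besides $1/(q)_n$. *)
Definition tail_prod (t th : R) (n : nat) : R[i] :=
  \prod_(i < n) (1 - ((expR (- t))%:C * expi th) ^+ (n + i.+1)).

(** Real parts of [box_symbols_qbinomial] multiplied by $e^{-in\theta}$. They keep the integral
    real, and cosines of nonzero integer frequency still integrate to 0 over a period. *)
Lemma box_symbols_cos (t th : R) n : 0 < t ->
  \sum_(p <- box_symbols n) expR (- t) ^+ frobenius_size p *
      cos (((frobenius_size p)%:R - n%:R) * th) =
  expR (lnP_trunc n t) *
  expR (- ((\sum_(m < n) cf_ln (bose (m.+1%:R * t)) (m.+1%:R * th)) / 2)) *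
  complex.Re (tail_prod t th n *
    expi (\sum_(m < n) cf_arg (bose (m.+1%:R * t)) (m.+1%:R * th) - n%:R * th)).
Proof.
move=> t0; set q := (expR (- t))%:C * expi th.
have H := qpoch_polar th n t0.
set c := expR _ * expR _ in H *; set B := \sum_(m < n) cf_arg _ _ in H *.
rewrite -/q in H.
have q0 : qpoch q n != 0.
  by apply/eqP => q0; move: H; rewrite q0 mul0r => /eqP; rewrite eq_sym oner_eq0.
have G : (\sum_(p <- box_symbols n) q ^+ frobenius_size p) = tail_prod t th n * (c%:C * expi B).
  apply: (mulIf q0); apply: (mulIf q0).
  rewrite box_symbols_qbinomial {1}/qpoch big_split_ord /= -/(qpoch q n).
  rewrite (eq_bigr (fun i : 'I_n => 1 - q ^+ (n + i.+1))) => [|i _]; last by rewrite addnS.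
  rewrite -/(tail_prod t th n); move: H; set e := c%:C * expi B => H.
  by rewrite -[LHS]mulr1 -H; ring.
transitivity (complex.Re ((\sum_(p <- box_symbols n) q ^+ frobenius_size p) * expi (- (n%:R * th)))).
  rewrite big_distrl /= complex_Re_sum; apply: eq_bigr => p _.
  have -> : q ^+ frobenius_size p * expi (- (n%:R * th)) =
      (expR (- t) ^+ frobenius_size p)%:C * expi ((frobenius_size p)%:R * th - n%:R * th).
    by rewrite /q exprMn -expiMn -rmorphXn -mulrA -expiD.
  by rewrite mulrBl /= mul0r subr0.
rewrite G expiD.
have -> : tail_prod t th n * (c%:C * expi B) * expi (- (n%:R * th)) =
   c%:C * (tail_prod t th n * (expi B * expi (- (n%:R * th)))) by ring.
by case: (tail_prod t th n * _) => u v /=; rewrite mul0r subr0.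
Qed.

(** The bound is uniform in [th], so it serves both the pointwise limit and the domination. *)
Lemma norm1_tail_prod_sub1 (t th : R) n : 0 < t ->
  norm1 (tail_prod t th n - 1) <= expR (2 * n%:R * expR (- t) ^+ n) - 1.
Proof.
move=> t0; pose g (i : nat) : R := 2 * expR (- t) ^+ n.
have h (i : nat) : norm1 (((expR (- t))%:C * expi th) ^+ (n + i.+1)) <= g i.
  rewrite exprMn -expiMn -rmorphXn /= /norm1 /= !mul0r subr0 addr0 !normrM.
  rewrite -mulrDr (ger0_norm (exprn_ge0 _ (expR_ge0 _))) /g mulrC.
  apply: ler_pM; rewrite ?addr_ge0 ?exprn_ge0 ?expR_ge0//.
    have := cos_max ((n + i.+1)%:R * th); have := sin_max ((n + i.+1)%:R * th); lra.
  by rewrite ler_wiXn2l ?expR_ge0 ?expR_le1 ?oppr_le0 ?(ltW t0)// leq_addr.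
apply: le_trans (norm1_prod_sub1 n h) _; rewrite lerD2r.
rewrite /g prodr_const card_ord -mulrA mulrCA expRM_natl.
by apply: lerXn2r; rewrite ?nnegrE ?expR_ge0 ?expR_ge1Dx.
Qed.

End FourierIdentity.

(** * The number of symbols as an integral *)

Section SaddleIntegral.
Variable R : realType.
Implicit Types (u x c w : R).
Local Notation mu := (@lebesgue_measure R).
Let a : R := pi ^+ 2 / 6.

Lemma continuous_integrable_itv (f : R -> R) x y : continuous f ->
  mu.-integrable `[x, y] (EFin \o f).
Proof.
move=> cf; apply: continuous_compact_integrable; first exact: segment_compact.
exact: continuous_subspaceT.
Qed.

Lemma Rintegral_sum_continuous (I : Type) (s : seq I) (g : I -> R -> R) x y :
  (forall i, continuous (g i)) ->
  \int[mu]_(u in `[x, y]) (\sum_(i <- s) g i u) =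
  \sum_(i <- s) \int[mu]_(u in `[x, y]) g i u.
Proof.
move=> cg; elim: s => [|i s IHs].
  rewrite big_nil; under eq_Rintegral do rewrite big_nil.
  by rewrite /Rintegral integral0.
rewrite big_cons -IHs; under eq_Rintegral do rewrite big_cons.
rewrite RintegralD//; apply: continuous_integrable_itv => //.
by apply: continuous_big => //; exact: add_continuous.
Qed.

Lemma sin_nat_pi (k : nat) : sin (k%:R * pi) = 0 :> R.
Proof.
elim: k => [|k IHk]; first by rewrite mul0r sin0.
by rewrite -natr1 mulrDl mul1r sinDpi IHk oppr0.
Qed.

Lemma continuous_cosM c : continuous (fun u => cos (c * u)).
Proof.
move=> u; apply: (@continuous_comp _ _ _ (fun u => c * u) cos).
  by apply: cvgMl_tmp; exact: cvg_id.
exact: continuous_cos.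
Qed.

Lemma continuous_cosMM c d : continuous (fun u => cos (c * (d * u)) : R).
Proof.
rewrite (_ : (fun u => _) = (fun u => cos (c * d * u))); first exact: continuous_cosM.
by apply/funext => u; rewrite mulrA.
Qed.

Lemma Rintegral_cosM c w : c != 0 -> 0 < w -> sin (c * w) = 0 ->
  \int[mu]_(u in `[- w, w]) cos (c * u) = 0.
Proof.
move=> c0 w0 scw; pose F u : R := sin (c * u) / c.
have dF u : is_derive u (1 : R) F (cos (c * u)).
  have -> : F = c^-1 \*: (@sin R \o (c \*: id)).
    by apply/funext => z; rewrite /F /= /GRing.scale /= mulrC.
  have -> : cos (c * u) = c^-1 *: (cos (c *: u) * (c *: 1)).
    by rewrite /GRing.scale /= mulr1 mulrCA mulVf ?mulr1.
  apply: is_deriveZ.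
have cF : continuous F.
  by move=> u; apply: differentiable_continuous; apply/derivable1_diffP; case: (dF u).
rewrite /Rintegral (@continuous_FTC2 _ _ F).
- by rewrite /F -EFinB /= mulrN sinN scw oppr0 mul0r subrr.
- by rewrite gtrN.
- by apply: continuous_subspaceT; exact: continuous_cosM.
- split.
  + by move=> z _; case: (dF z).
  + by apply: cvg_at_right_filter; exact: cF.
  + by apply: cvg_at_left_filter; exact: cF.
- by move=> z _; rewrite derive1E; case: (dF z) => _ ->.
Qed.

Lemma Rintegral_cos_period (k N : nat) s : 0 < s ->
  \int[mu]_(u in `[- (pi / s), pi / s]) cos ((k%:R - N%:R) * (s * u)) =
  if k == N then 2 * (pi / s) else 0.
Proof.
move=> s0; have w0 : 0 < pi / s by rewrite divr_gt0// pi_gt0.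
case: eqP => [->|/eqP kN].
  under eq_Rintegral do rewrite subrr mul0r cos0.
  rewrite Rintegral_cst//= lebesgue_measure_itv /= lte_fin gtrN//=.
  by rewrite mul1r opprK; ring.
under eq_Rintegral do rewrite mulrA.
apply: Rintegral_cosM => //.
  by apply: mulf_neq0; [rewrite subr_eq0 eqr_nat|rewrite gt_eqF].
have -> : (k%:R - N%:R) * s * (pi / s) = (k%:R - N%:R) * pi by field; rewrite gt_eqF.
case: (leqP N k) => Nk; first by rewrite -natrB// sin_nat_pi.
by rewrite -opprB mulNr sinN -natrB ?sin_nat_pi ?oppr0// ltnW.
Qed.

(** The right side of [box_symbols_cos] for index [n.+1] at the angle [saddle_scale R n * u],
    without its factor [expR (lnP_trunc n.+1 (saddle R n))]. *)
Definition saddle_integrand (n : nat) u : R :=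
  expR (- (cf_ln_sum n u / 2)) *
  complex.Re (tail_prod (saddle R n) (saddle_scale R n * u) n.+1 * expi (cf_arg_sum n u)).

Lemma saddle_scale_gt0 n : 0 < saddle_scale R n.
Proof. by rewrite mulr_gt0// ?saddle_gt0// sqrt_saddle_gt0. Qed.

Lemma saddle_integrandE n u : saddle_integrand n u =
  \sum_(p <- box_symbols n.+1)
    expR (- lnP_trunc n.+1 (saddle R n)) * expR (- saddle R n) ^+ frobenius_size p *
      cos (((frobenius_size p)%:R - n.+1%:R) * (saddle_scale R n * u)).
Proof.
under eq_bigr do rewrite -mulrA.
rewrite -big_distrr /= box_symbols_cos ?saddle_gt0// -mulrA [RHS]mulrA -expRD.
by rewrite addNr expR0 mul1r.
Qed.

Lemma continuous_saddle_integrand n : continuous (saddle_integrand n).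
Proof.
rewrite (funext (saddle_integrandE n)).
apply: continuous_big => [|p _ u]; first exact: add_continuous.
by apply: cvgMl_tmp; exact: continuous_cosMM.
Qed.

Lemma Rintegral_saddle_integrand n :
  \int[mu]_(u in `[- (pi / saddle_scale R n), pi / saddle_scale R n]) saddle_integrand n u =
  expR (- lnP_trunc n.+1 (saddle R n)) * expR (- saddle R n) ^+ n.+1 *
  (2 * (pi / saddle_scale R n)) * (nsymbols n.+1)%:R.
Proof.
under eq_Rintegral do rewrite saddle_integrandE.
rewrite Rintegral_sum_continuous; last first.
  by move=> p u; apply: cvgMl_tmp; exact: continuous_cosMM.
rewrite /nsymbols /symbols_where size_filter -sum1_count natr_sum [RHS]big_distrr /=.
rewrite [RHS]big_mkcond /=; apply: eq_bigr => p _.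
rewrite RintegralZl//; last first.
  by apply: continuous_integrable_itv; exact: continuous_cosMM.
rewrite Rintegral_cos_period ?saddle_scale_gt0// andbT.
by case: eqP => [->|_]; rewrite ?mulr1 ?mulr0.
Qed.

End SaddleIntegral.

(** * Dominated convergence to the Gaussian integral *)

Section SaddleLimit.
Variable R : realType.
Implicit Types (u x c w : R).
Local Notation mu := (@lebesgue_measure R).
Let a : R := pi ^+ 2 / 6.

Let a_gt0 : 0 < a.
Proof. by rewrite divr_gt0// exprn_gt0// pi_gt0. Qed.

Definition tail_bound (n : nat) : R :=
  expR (2 * n.+1%:R * expR (- saddle R n) ^+ n.+1) - 1.

Lemma cvg_tail_bound : tail_bound n @[n --> \oo] --> (0 : R).
Proof.
have c : 2 * n.+1%:R * expR (- saddle R n) ^+ n.+1 @[n --> \oo] --> (0 : R).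
  (* With $n+1 = a/t^2$ and [expR_ge_cube] at $y = a/t$, the constant is $54 = 2\cdot27$. *)
  apply: (@squeeze_cvgr _ _ _ _ (cst 0) (fun n => 54 / a ^+ 2 * saddle R n)); last 2 first.
  - exact: cvg_cst.
  - by rewrite -[X in _ --> X](mulr0 (54 / a ^+ 2)); apply: cvgMl_tmp; exact: cvg_saddle.
  near=> n; rewrite mulr_ge0 ?mulr_ge0 ?exprn_ge0 ?expR_ge0//=.
  have t0 := saddle_gt0 R n; have tsq := saddle_sqr R n; rewrite -/a in tsq.
  move: (saddle R n) t0 tsq => t t0 tsq.
  have NE : n.+1%:R = a / t ^+ 2 by rewrite -tsq mulfK// expf_neq0// gt_eqF.
  have -> : expR (- t) ^+ n.+1 = expR (- (a / t)).
    rewrite -expRM_natl NE; congr expR; field; rewrite gt_eqF//.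
  have y0 : 0 < a / t by rewrite divr_gt0.
  have h : expR (- (a / t)) <= ((a / t) ^+ 3 / 27)^-1.
    by rewrite expRN lef_pV2 ?posrE ?expR_gt0 ?divr_gt0 ?exprn_gt0// expR_ge_cube// ltW.
  have N0 : 0 <= 2 * n.+1%:R :> R by rewrite mulr_ge0.
  apply: le_trans (ler_wpM2l N0 h) _; rewrite NE.
  by rewrite le_eqVlt; apply/orP; left; apply/eqP; field; rewrite !gt_eqF.
rewrite -(subrr 1); apply: cvgB; last exact: cvg_cst.
rewrite -[X in _ --> X]expR0.
exact: (cvg_comp _ _ c (@continuous_expR R 0)).
Unshelve. all: by end_near. Qed.

Lemma Re_mul_expi (z : R[i]) x :
  complex.Re (z * expi x) = complex.Re z * cos x - complex.Im z * sin x.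
Proof. by case: z. Qed.

Lemma cvg_saddle_integrand u : saddle_integrand n u @[n --> \oo] --> expR (- (a * u ^+ 2)).
Proof.
have c1 : expR (- (cf_ln_sum n u / 2)) @[n --> \oo] --> expR (- (2 * a * u ^+ 2 / 2)).
  have c0 : - (cf_ln_sum n u / 2) @[n --> \oo] --> - (2 * a * u ^+ 2 / 2).
    by apply: cvgN; apply: cvgMr_tmp; exact: cvg_cf_ln_sum.
  exact: (cvg_comp _ _ c0 (@continuous_expR R _)).
have cc : cos (cf_arg_sum n u) @[n --> \oo] --> (1 : R).
  by have := cvg_comp _ _ (@cvg_cf_arg_sum R u) (@continuous_cos R _); rewrite cos0.
have cs : sin (cf_arg_sum n u) @[n --> \oo] --> (0 : R).
  by have := cvg_comp _ _ (@cvg_cf_arg_sum R u) (@continuous_sin R _); rewrite sin0.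
pose T n := tail_prod (saddle R n) (saddle_scale R n * u) n.+1.
have Tb n : norm1 (T n - 1) <= tail_bound n.
  exact: norm1_tail_prod_sub1 (saddle_gt0 R n).
have sq (f : nat -> R) : (forall n, `|f n| <= tail_bound n) -> f n @[n --> \oo] --> (0 : R).
  move=> H; apply/cvgrPdist_le => e e0.
  have /cvgrPdist_le/(_ _ e0) := cvg_tail_bound; apply: filterS => n.
  rewrite !sub0r !normrN => h; apply: le_trans (H n) (le_trans (ler_norm _) h).
have cR : complex.Re (T n) @[n --> \oo] --> (1 : R).
  have H : complex.Re (T n) - 1 @[n --> \oo] --> (0 : R).
    apply: sq => n; apply: le_trans (Tb n); rewrite /norm1.
    by case: (T n) => b d /=; rewrite lerDl.
  have k1 : (fun=> (1 : R)) @ \oo --> (1 : R) by exact: cvg_cst.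
  have {}H := cvgD H k1; rewrite add0r in H.
  suff -> : (fun n => complex.Re (T n)) = (fun n => complex.Re (T n) - 1 + 1) by exact: H.
  by apply/funext => n; rewrite subrK.
have cI : complex.Im (T n) @[n --> \oo] --> (0 : R).
  apply: sq => n; apply: le_trans (Tb n); rewrite /norm1.
  by case: (T n) => b d /=; rewrite subr0 lerDr.
have -> : (fun n => saddle_integrand n u) = (fun n => expR (- (cf_ln_sum n u / 2)) *
    (complex.Re (T n) * cos (cf_arg_sum n u) - complex.Im (T n) * sin (cf_arg_sum n u))).
  by apply/funext => n; rewrite /saddle_integrand Re_mul_expi.
have -> : expR (- (a * u ^+ 2)) = expR (- (2 * a * u ^+ 2 / 2)) * (1 * 1 - 0 * 0).
  by rewrite mul0r subr0 !mulr1; congr expR; field.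
by apply: cvgM => //; apply: cvgB; apply: cvgM.
Qed.

Lemma saddle_integrand_bound : \forall n \near \oo, forall u,
  `|saddle_scale R n * u| <= pi -> `|saddle_integrand n u| <= 4 * dom_const R / (1 + u ^+ 2).
Proof.
near=> n => u su.
have t32 : saddle R n <= 32^-1 by near: n; apply: near_saddle_le; rewrite invr_gt0.
have tb1 : tail_bound n <= 1.
  near: n; have /cvgrPdist_le/(_ _ ltr01) := cvg_tail_bound; apply: filterS => n.
  by rewrite sub0r normrN; exact: le_trans (ler_norm _).
have := cf_ln_sum_dominated_at t32 su => dom.
have := norm1_tail_prod_sub1 (saddle_scale R n * u) n.+1 (saddle_gt0 R n).
rewrite -/(tail_bound n) /saddle_integrand; move: (tail_prod _ _ _) => T /le_trans /(_ tb1) T1.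
rewrite normrM (ger0_norm (expR_ge0 _)) [leRHS](_ : _ = dom_const R / (1 + u ^+ 2) * 4); last by field; rewrite gt_eqF// ltr_wpDr ?sqr_ge0.
apply: ler_pM => //; rewrite ?expR_ge0//.
rewrite Re_mul_expi; apply: le_trans (ler_normB _ _) _; rewrite !normrM.
have hc := cos_max (cf_arg_sum n u); have hs := sin_max (cf_arg_sum n u).
have [hR hI] : `|complex.Re T| <= 2 /\ `|complex.Im T| <= 2.
  move: T1; rewrite /norm1; case: T => b d /=; rewrite subr0 => H; split.
    have := ler_normD (b - 1) 1; rewrite subrK normr1.
    by have := normr_ge0 d; lra.
  by have := normr_ge0 (b - 1); lra.
have h1 : `|complex.Re T| * `|cos (cf_arg_sum n u)| <= 2 * 1 by apply: ler_pM.
have h2 : `|complex.Im T| * `|sin (cf_arg_sum n u)| <= 2 * 1 by apply: ler_pM.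
lra.
Unshelve. all: by end_near. Qed.

Lemma integrable_oneDsqrV c : mu.-integrable [set: R] (EFin \o (fun u => c / (1 + u ^+ 2))).
Proof.
have i1 : mu.-integrable [set: R] (EFin \o (fun u : R => (oneDsqr u)^-1)).
  have cO : continuous (fun u : R => (oneDsqr u)^-1) by exact: continuous_oneDsqrV.
  have mO : measurable_fun [set: R] (fun u : R => (oneDsqr u)^-1).
    exact: continuous_measurable_fun.
  apply/integrableP; split; first exact/measurable_EFinP.
  under eq_integral do rewrite /= ger0_norm ?invr_ge0//.
  rewrite ge0_symfun_integralT//.
  - rewrite (_ : [set x | _] = `[0, +oo[%classic); last first.
      by apply/seteqP; split => x/=; rewrite in_itv/= andbT.
    by rewrite integral0y_oneDsqr -EFinM ltry.
  - by move=> x /=; rewrite /oneDsqr sqrrN.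
have := integrableZl measurableT c i1.
by apply: eq_integrable => // x _.
Qed.

Lemma integral_gauss_scaled : (\int[mu]_u (expR (- (a * u ^+ 2)))%:E = (Num.sqrt (6 / pi))%:E)%E.
Proof.
have p0 := @pi_gt0 R.
(* The standard deviation with $1/(2s^2) = \pi^2/6$; the normalising constant is $\sqrt{2\pi s^2} =
   \sqrt{6/\pi}$. *)
pose s : R := Num.sqrt 3 / pi.
have s0 : s != 0 by rewrite mulf_neq0 ?invr_eq0 ?gt_eqF// sqrtr_gt0.
have s2 : s ^+ 2 = 3 / pi ^+ 2 by rewrite /s exprMn exprVn sqr_sqrtr.
have E u : expR (- (a * u ^+ 2)) = Num.sqrt (6 / pi) * normal_pdf 0 s u.
  rewrite normal_pdfE// /normal_peak s2.
  have h1 (p : R) : 0 < p -> 3 / p ^+ 2 * p *+ 2 = 6 / p.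
    by move=> p1; field; rewrite gt_eqF.
  have h2 (p : R) : 0 < p -> - (p ^+ 2 / 6 * u ^+ 2) = - u ^+ 2 / (3 / p ^+ 2 *+ 2).
    by move=> p1; field; rewrite gt_eqF.
  rewrite (h1 _ p0).
  rewrite [RHS]mulrA divff ?mul1r; last by rewrite gt_eqF// sqrtr_gt0 divr_gt0.
  by rewrite /normal_fun subr0 s2 -(h2 _ p0).
under eq_integral do rewrite E EFinM.
rewrite integralZl//; last exact: integrable_normal_pdf.
by rewrite integral_normal_pdf mule1.
Qed.

(** The intervals exhaust the line because [saddle_scale] tends to 0. Integrands are extended by
    zero, and indices are shifted by [n0], from which on the domination holds. *)
Lemma cvg_Rintegral_saddle_integrand :
  \int[mu]_(u in `[- (pi / saddle_scale R n), pi / saddle_scale R n]) saddle_integrand n u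
    @[n --> \oo] --> Num.sqrt (6 / pi).
Proof.
pose D n : set R := `[- (pi / saddle_scale R n), pi / saddle_scale R n]%classic.
have DE n u : D n u <-> `|saddle_scale R n * u| <= pi.
  have s0 := saddle_scale_gt0 R n.
  rewrite /D /= in_itv /= -ler_norml normrM (gtr0_norm s0).
  by rewrite ler_pdivlMr// mulrC.
have [n0 _ bnd] := saddle_integrand_bound.
pose f n : R -> \bar R := (EFin \o saddle_integrand n) \_ (D n).
have mf n : measurable_fun [set: R] (f n).
  have mD : measurable (D n) by exact: measurable_itv.
  have mS : measurable_fun (D n) (EFin \o @saddle_integrand R n).
    apply/measurable_EFinP; apply: measurable_funTS; apply: continuous_measurable_fun.
    exact: continuous_saddle_integrand.
  exact: ((measurable_restrictT _ mD).1 mS).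
have ff u : f n u @[n --> \oo] --> (expR (- (a * u ^+ 2)))%:E.
  have cs : saddle_scale R n @[n --> \oo] --> (0 : R).
    rewrite -(mul0r 0); apply: cvgM; [exact: cvg_saddle|exact: cvg_sqrt_saddle].
  have cu : saddle_scale R n * u @[n --> \oo] --> (0 : R).
    by rewrite -(mul0r u); apply: cvgMr_tmp.
  have H : (saddle_integrand n u)%:E @[n --> \oo] --> (expR (- (a * u ^+ 2)))%:E.
    by apply: cvg_EFin; [near=> n|exact: cvg_saddle_integrand].
  move: H; apply: cvg_trans; apply: near_eq_cvg.
  have /cvgrPdist_le/(_ _ (pi_gt0 R)) := cu; apply: filterS => n.
  rewrite sub0r normrN => /DE Dn.
  by rewrite /f patchE mem_set.
have mg : measurable_fun [set: R] (fun u => (expR (- (a * u ^+ 2)))%:E).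
  apply/measurable_EFinP; apply: continuous_measurable_fun => u.
  have c0 : - (a * x ^+ 2) @[x --> u] --> - (a * u ^+ 2).
    by apply: cvgN; apply: cvgMl_tmp; exact: exprn_continuous.
  exact: (cvg_comp _ _ c0 (@continuous_expR R _)).
have aef : {ae mu, forall u, [set: R] u -> (fun n => f (n + n0)%N u) @ \oo --> (expR (- (a * u ^+ 2)))%:E}.
  by apply: aeW => u _; have := ff u; rewrite -(cvg_shiftn n0).
have aeb : {ae mu, forall u n, [set: R] u ->
    (`|f (n + n0)%N u| <= (EFin \o (fun u => 4 * dom_const R / (1 + u ^+ 2))%R) u)%E}.
  apply: aeW => u n _; rewrite /f patchE; case: ifPn => [|_].
    rewrite inE => /DE Du; rewrite /= lee_fin; apply: bnd => //.
    exact: leq_addl.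
  rewrite (_ : point = 0%E)// abse0 lee_fin divr_ge0 ?mulr_ge0 ?(ltW (dom_const_gt0 R))//.
  by rewrite addr_ge0// sqr_ge0.
have [_ _] := @dominated_convergence _ (measurableTypeR R) R mu [set: R] measurableT
  (fun n => f (n + n0)%N) _ _ (fun n => mf (n + n0)%N) mg aef (integrable_oneDsqrV _) aeb.
rewrite integral_gauss_scaled => /fine_cvg H.
rewrite -(@cvg_shiftn n0 R).
suff -> : [sequence \int[mu]_(u in `[- (pi / saddle_scale R (n + n0)),
    pi / saddle_scale R (n + n0)]) saddle_integrand (n + n0) u]_n =
    fine \o [sequence (\int[mu]_x f (n + n0)%N x)%E]_n by exact: H.
apply/funext => n /=; rewrite /Rintegral; congr fine.
by rewrite [LHS]integral_mkcond.
Unshelve. all: by end_near. Qed.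

End SaddleLimit.

(** * Asymptotics of the number of symbols *)

Section Asymptotics.
Variable R : realType.
Let a : R := pi ^+ 2 / 6.

(** Half of the Hardy-Ramanujan main term for the partition numbers, so [nsymbols] is compared with
    its double. *)
Definition hr_main (n : nat) : R :=
  1 / (8%:R * Num.sqrt 3%:R * n%:R) * expR (pi * Num.sqrt (2%:R / 3%:R * n%:R)).

Lemma hr_exponent n : pi * Num.sqrt (2 / 3 * n.+1%:R) = 2 * a / saddle R n.
Proof.
have p0 := @pi_gt0 R.
rewrite /saddle invf_div.
have -> : 2 / 3 * n.+1%:R = 3^-1 ^+ 2 * (6 * n.+1%:R) :> R by field.
rewrite (sqrtrM (6 * n.+1%:R) (sqr_ge0 (3^-1 : R))) sqrtr_sqr ger0_norm//.
by rewrite /a; move: (pi : R) p0 => p p0; field; rewrite gt_eqF.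
Qed.

(** An exact identity: the integral tends to $\sqrt{6/\pi}$, the inverse of the first factor, and
    the last exponent tends to 0. *)
Lemma nsymbols_saddle n :
  (nsymbols n.+1)%:R / (2 * hr_main n.+1) =
  Num.sqrt (pi / 6) *
  (\int[@lebesgue_measure R]_(u in `[- (pi / saddle_scale R n), pi / saddle_scale R n])
     saddle_integrand n u) *
  expR (lnP_error (saddle R n) -
        (lnP (1 * saddle R n) - lnP_trunc n.+1 (1 * saddle R n))).
Proof.
have p0 := @pi_gt0 R; have t0 := saddle_gt0 R n; have w0 := sqrt_saddle_gt0 R n.
rewrite Rintegral_saddle_integrand mul1r /lnP_error /hr_main hr_exponent.
have tsq := saddle_sqr R n; rewrite -/a in tsq *.
have -> : expR (- saddle R n) ^+ n.+1 = expR (- (a / saddle R n)).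
  rewrite -expRM_natl; congr expR; rewrite -tsq.
  by move: (saddle R n) t0 => t t0; field; rewrite gt_eqF.
have -> : lnP (saddle R n) - a / saddle R n - ln (saddle R n) / 2 + ln (2 * pi) / 2 -
    (lnP (saddle R n) - lnP_trunc n.+1 (saddle R n)) =
  lnP_trunc n.+1 (saddle R n) + (- (a / saddle R n) + (ln (2 * pi) / 2 - ln (saddle R n) / 2)).
  by ring.
rewrite [in RHS]expRD [expR (- (a / _) + _)]expRD [expR (_ / 2 - _)]expRB.
have lns x : 0 < x -> expR (ln x / 2) = Num.sqrt x.
  move=> x0; apply/eqP; rewrite -(@eqrXn2 _ 2)// ?expR_ge0 ?sqrtr_ge0//.
  rewrite sqr_sqrtr ?(ltW x0)// -expRM_natl (_ : 2%:R * (ln x / 2) = ln x); last by field.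
  by rewrite lnK.
rewrite !lns ?mulr_gt0//.
have E2 : expR (2 * a / saddle R n) = (expR (- (a / saddle R n)) * expR (- (a / saddle R n)))^-1.
  rewrite -expRD -expRN; congr expR; ring.
rewrite E2.
have Ep : expR (- lnP_trunc n.+1 (saddle R n)) = (expR (lnP_trunc n.+1 (saddle R n)))^-1.
  by rewrite expRN.
rewrite Ep /saddle_scale.
have L0 := expR_gt0 (lnP_trunc n.+1 (saddle R n)).
have A0 := expR_gt0 (- (a / saddle R n)).
have w2 := sqr_sqrt_saddle R n.
move: (expR (lnP_trunc _ _)) L0 (expR (- (a / _))) A0 (nsymbols _)%:R => L L0 A A0 f.
have NE : n.+1%:R = a / saddle R n ^+ 2 by rewrite -tsq mulfK// expf_neq0// gt_eqF.
rewrite NE /a; move: (Num.sqrt (saddle R n)) w0 w2 => w w0 w2.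
rewrite -w2.
rewrite !sqrtrM ?(ltW p0)// sqrtrV// (_ : 6 = 2 * 3 :> R); last by rewrite -natrM.
rewrite sqrtrM//.
have h2 : Num.sqrt 2 ^+ 2 = 2 :> R by rewrite sqr_sqrtr.
have h3 : Num.sqrt 3 ^+ 2 = 3 :> R by rewrite sqr_sqrtr.
have hp : Num.sqrt pi ^+ 2 = pi :> R by rewrite sqr_sqrtr// ltW.
have g2 : 0 < Num.sqrt 2 :> R by rewrite sqrtr_gt0.
have g3 : 0 < Num.sqrt 3 :> R by rewrite sqrtr_gt0.
have gp : 0 < Num.sqrt pi :> R by rewrite sqrtr_gt0.
move: (Num.sqrt 2) (Num.sqrt 3) (Num.sqrt pi) h2 h3 hp g2 g3 gp => x2 x3 xp h2 h3 hp g2 g3 gp.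
rewrite -hp.
have -> : (8 : R) = 4 * 2 by ring.
have e3 : x3 / 3 = x3^-1 by rewrite -h3; field; rewrite gt_eqF.
transitivity (f * A ^+ 2 * xp ^+ 4 / w ^+ 4 * 2 * (x3 / 3)).
  by field; rewrite !gt_eqF.
by rewrite e3; field; rewrite !gt_eqF.
Qed.

Lemma cvg_nsymbols : (nsymbols n.+1)%:R / (2 * hr_main n.+1) @[n --> \oo] --> (1 : R).
Proof.
have p0 := @pi_gt0 R.
have E : Num.sqrt (pi / 6) * Num.sqrt (6 / pi) * expR (0 - 0) = 1 :> R.
  rewrite subr0 expR0 mulr1 -sqrtrM ?divr_ge0 ?(ltW p0)//.
  rewrite (_ : pi / 6 * (6 / pi) = 1) ?sqrtr1//.
  by move: (pi : R) p0 => p p0; field; rewrite gt_eqF.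
rewrite (funext nsymbols_saddle) -[X in _ --> X]E.
apply: cvgM.
  have K := @cvg_Rintegral_saddle_integrand R.
  exact (@cvgMl_tmp R nat _ _ _ _ _ K).
have one2 : 2^-1 <= 1 :> R by rewrite invf_le1// ler1n.
have L : lnP_error (saddle R n) @[n --> \oo] --> (0 : R).
  have E1 n : lnP_error (saddle R n) = lnP_error (1 * saddle R n) by rewrite mul1r.
  rewrite (funext E1).
  exact (@cvg_saddle_comp R (@lnP_error R) 0 (fun=> 1) 1 (fun=> one2) (@cvg_cst _ _ _ _ _)
    (@cvg_lnP_error R)).
have T : lnP (1 * saddle R n) - lnP_trunc n.+1 (1 * saddle R n) @[n --> \oo] --> (0 : R).
  by apply: (@cvg_lnP_tail R (fun=> 1)); near=> n.
have D : lnP_error (saddle R n) - (lnP (1 * saddle R n) - lnP_trunc n.+1 (1 * saddle R n))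
  @[n --> \oo] --> (0 - 0 : R) by apply: cvgB.
exact: (cvg_comp _ _ D (@continuous_expR R _)).
Unshelve. all: by end_near. Qed.

Lemma hr_main_gt0 n : 0 < hr_main n.+1.
Proof. by rewrite mulr_gt0 ?expR_gt0// divr_gt0// !mulr_gt0// sqrtr_gt0. Qed.

(** With $t$ and $u$ the two consecutive saddle points, [saddle_sqr] gives $a/u^2 - a/t^2 = 1$;
    dividing by $1/u + 1/t$ yields the difference. *)
Lemma saddle_invS n :
  a / saddle R n.+1 - a / saddle R n =
  saddle R n * saddle R n.+1 / (saddle R n + saddle R n.+1).
Proof.
have t0 := saddle_gt0 R n; have t1 := saddle_gt0 R n.+1.
have e0 := saddle_sqr R n; have e1 := saddle_sqr R n.+1; rewrite -/a in e0 e1.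
move: (saddle R n) (saddle R n.+1) t0 t1 e0 e1 => t u t0 u0 et eu.
have st : 0 < t + u by rewrite addr_gt0.
have K : a * (t - u) * (t + u) = t ^+ 2 * u ^+ 2.
  have -> : a * (t - u) * (t + u) = a * t ^+ 2 - a * u ^+ 2 by ring.
  rewrite -{1}eu -[in X in _ - X]et -(natr1 n.+1); ring.
have M0 : t * u * (t + u) != 0 by rewrite gt_eqF// mulr_gt0// mulr_gt0.
apply: (mulIf M0).
transitivity (a * (t - u) * (t + u)); first by field; rewrite !gt_eqF.
by rewrite K; field; rewrite gt_eqF.
Qed.

Lemma cvg_hr_mainS : hr_main n.+1 / hr_main n.+2 @[n --> \oo] --> (1 : R).
Proof.
pose e n := saddle R n * saddle R n.+1 / (saddle R n + saddle R n.+1).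
have E n : hr_main n.+1 / hr_main n.+2 = (1 + n.+1%:R^-1) * expR (- (2 * e n)).
  rewrite /hr_main !hr_exponent.
  have -> : - (2 * e n) = 2 * a / saddle R n - 2 * a / saddle R n.+1.
    by rewrite /e -saddle_invS; ring.
  rewrite expRB -[in n.+2%:R](natr1 n.+1).
  have g3 : 0 < Num.sqrt 3 :> R by rewrite sqrtr_gt0.
  move: (Num.sqrt 3) g3 (expR (2 * a / saddle R n)) (expR_gt0 (2 * a / saddle R n.+1)) => x x0 A.
  move: (expR _) => B B0.
  have n0 : 0 < n.+1%:R :> R by rewrite ltr0n.
  move: n.+1%:R n0 => N N0.
  by field; rewrite !gt_eqF// addr_gt0.
rewrite (funext E).
have e0 : e n @[n --> \oo] --> (0 : R).
  apply: (@squeeze_cvgr _ _ _ _ (fun=> 0) (saddle R)); last 2 first.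
  - exact: cvg_cst.
  - exact: cvg_saddle.
  near=> n; have t0 := saddle_gt0 R n; have t1 := saddle_gt0 R n.+1.
  rewrite /e; move: (saddle R n) (saddle R n.+1) t0 t1 => t u t0 u0.
  rewrite divr_ge0 ?mulr_ge0 ?addr_ge0 ?(ltW t0) ?(ltW u0)//= ler_pdivrMr ?addr_gt0//.
  by rewrite ler_wpM2l ?(ltW t0)// lerDr ltW.
have E1 : (1 + 0) * expR (- (2 * 0)) = 1 :> R by rewrite mulr0 oppr0 expR0 addr0 mulr1.
rewrite -[X in _ --> X]E1; apply: cvgM.
  by apply: cvgD; [exact: cvg_cst | exact: cvg_harmonic].
have D : - (2 * e n) @[n --> \oo] --> (- (2 * 0) : R) by apply: cvgN; exact: cvgMl_tmp.
exact: (cvg_comp _ _ D (@continuous_expR R _)).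
Unshelve. all: by end_near. Qed.

(** The bounds on the excess of [F_phi] place $2F_0(n+2)$ between the numbers of all symbols of size
    $n+1$ and $n+2$, which are asymptotically equal. *)
Lemma cvg_F_0 : (F_0 n.+2)%:R / hr_main n.+2 @[n --> \oo] --> (1 : R).
Proof.
pose f n : R := (nsymbols n.+1)%:R / (2 * hr_main n.+1).
have fS : f n.+1 @[n --> \oo] --> (1 : R) by rewrite cvg_shiftS; exact: cvg_nsymbols.
apply: (@squeeze_cvgr _ _ _ _ (fun n => f n * (hr_main n.+1 / hr_main n.+2)) (f \o S)).
- near=> n.
  have h1 := hr_main_gt0 n; have h2 := hr_main_gt0 n.+1.
  have le1 := leq_F_0_F_phi (ltn0Sn n); have le2 := leq_F_phi_F_0 (ltn0Sn n).
  have Z := nsymbolsE n.+2; rewrite Z in le2.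
  have le3 : (nsymbols n.+1 <= 2 * F_0 n.+2)%N by lia.
  have le4 : (2 * F_0 n.+2 <= nsymbols n.+2)%N by lia.
  rewrite /f /=; apply/andP; split.
    have -> : (nsymbols n.+1)%:R / (2 * hr_main n.+1) * (hr_main n.+1 / hr_main n.+2) =
      (nsymbols n.+1)%:R / 2 / hr_main n.+2.
      by move: (hr_main n.+1) (hr_main n.+2) h1 h2 => x y x0 y0; field; rewrite !gt_eqF.
    rewrite ler_pM2r ?invr_gt0// ler_pdivrMr// mulrC -natrM ler_nat; exact: le3.
  move: (hr_main n.+2) h2 => x x0.
  by rewrite invfM mulrA ler_pM2r ?invr_gt0// ler_pdivlMr// mulrC -natrM ler_nat.
- by rewrite -(mulr1 1); apply: cvgM; [exact: cvg_nsymbols | exact: cvg_hr_mainS].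
- exact: fS.
Unshelve. all: by end_near. Qed.

Lemma cvg_F_phi : (F_phi n.+2)%:R / hr_main n.+2 @[n --> \oo] --> (1 : R).
Proof.
have E n : (F_phi n.+2)%:R / hr_main n.+2 =
    2 * ((nsymbols n.+2)%:R / (2 * hr_main n.+2)) - (F_0 n.+2)%:R / hr_main n.+2.
  rewrite nsymbolsE natrD.
  by move: (hr_main _) (hr_main_gt0 n.+1) => x x0; field; rewrite gt_eqF.
rewrite (funext E).
rewrite [X in _ --> X](_ : 1 = 2 * 1 - 1 :> R); last by ring.
apply: cvgB; last exact: cvg_F_0.
apply: cvgMl_tmp.
rewrite (cvg_shiftS (fun n => (nsymbols n.+1)%:R / (2 * hr_main n.+1))).
exact: cvg_nsymbols.
Qed.

End Asymptotics.

Theorem theorem1p2 (R : realType) :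
  asymp_equiv (fun n : nat => (F_phi n)%:R : R) (fun n : nat => (F_0 n)%:R : R) /\
  asymp_equiv (fun n : nat => (F_0 n)%:R : R)
    (fun n : nat => 1 / (8%:R * Num.sqrt 3%:R * n%:R)
                    * expR (pi * Num.sqrt (2%:R / 3%:R * n%:R)) : R).
Proof.
have F0 := @cvg_F_0 R; have Fphi := @cvg_F_phi R.
have shift2 (f : nat -> R) : f n.+2 @[n --> \oo] --> (1 : R) -> f n @[n --> \oo] --> (1 : R).
  by move=> H; rewrite -cvg_shiftS -cvg_shiftS.
split; apply: shift2; last exact: F0.
have E n : (F_phi n.+2)%:R / (F_0 n.+2)%:R =
    (F_phi n.+2)%:R / hr_main R n.+2 / ((F_0 n.+2)%:R / hr_main R n.+2).
  have h0 := hr_main_gt0 R n.+1.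
  by rewrite invf_div mulrA mulfVK// gt_eqF.
rewrite (funext E) -[X in _ --> X](divr1 1); apply: cvgM => //.
by apply: cvgV.
Qed.
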